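(* Let $X=X(\mathbb T)$ be a Banach lattice satisfying Assumption A, and let $r,s\in\mathbb N$ with $2r\ge s$. Let $(G_n)_{n\in\mathbb N}$ be linear sampling operators with $G_nf\in\mathcal T_n$ for all $f\in X$, $n\in\mathbb N$ (i.e. $G_n:X_n\to\mathcal T_n$), for which there are constants $K_1,K_3,K_4>0$ such that for all $n\in\mathbb N$ $$\|G_nf\|_X\le K_1\|f\|_{X_n}\ \ (f\in X),\qquad K_4n^{-s}\|T^{(s)}\|_X\le\|T-G_nT\|_X\le K_3n^{-s}\|T^{(s)}\|_X\ \ (T\in\mathcal T_n).$$ Then for all $f\in X$ and $n\in\mathbb N$ $$\|f-G_nf\|_X+\|f-G_nf\|_{X_n}\asymp\|(I-\dot A_{\gamma/n})^sf\|_X+\|(I-A_{\gamma/n})^rf\|_{X_n},$$ where $\asymp$ denotes a two-sided inequality with positive constants independent of $f$ and $n$.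
   Context: $\mathbb T$ is the unit circle identified with $[-\pi,\pi)$ (functions on $\mathbb T$ are $2\pi$-periodic), with normalized Lebesgue measure $\mu$. A Banach lattice $X=X(\mathbb T)$ is a Banach space of measurable functions on $\mathbb T$ such that: 1) if $f$ is measurable, $g\in X$ and $|f|\le|g|$, then $f\in X$ and $\|f\|_X\le\|g\|_X$; 2) if $f_n\in X$, $\sup_n\|f_n\|_X<\infty$ and $0\le f_n\uparrow f$, then $f\in X$ and $\|f_n\|_X\to\|f\|_X$; 3) for every measurable $E$ with $\mu(E)<\infty$, $\chi_E\in X$ and there is $c_E>0$ with $\int_E|f|\,d\mu\le c_E\|f\|_X$. Functions in $X$ are regarded as finite-valued and defined at every point, not as equivalence classes. Steklov averages: $A_hf(x)=\frac1h\int_{x-h/2}^{x+h/2}f(t)\,dt$ and $\dot A_hf(x)=A_hf(x+\tfrac h2)$ for $h>0$; $I$ is the identity. Assumption A: $A_hf\in X$ for all $f\in X$, $h>0$, and $\sup_{h>0,\,\|f\|_X\le1}\|A_hf\|_X<\infty$. $\mathcal T_n$ is the set of trigonometric polynomials of degree at most $n$. $(\Phi_n)$ are linear subspaces of $X$ with $\Phi_m\subset\Phi_n$ for $m\le n$, $\Phi_0=\{0\}$, satisfying $\|\varphi^{(q)}\|_X\le(Bn)^q\|\varphi\|_X$ for all $q\in\mathbb N$, $\varphi\in\Phi_n$, with a constant $B=B_X>0$. (If $X$ is translation-invariant, spline spaces of smoothness $s$ are also admitted, with this inequality required only for $q\le s$.) Sampling operators: $G_nf(x)=\sum_{k=1}^{m_n}f(x_{k,n})\varphi_{k,n}(x)$,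 $n\in\mathbb N$, where $\varphi_{k,n}\in\Phi_n$ are $2\pi$-periodic and $x_k=x_{k,n}\in\mathbb T$ are nodes such that for some fixed $\gamma,\gamma'>0$, $\frac{\gamma}{n}\le x_{k+1,n}-x_{k,n}\le\frac{\gamma'}{n}$ for $k=1,\dots,m_n$, with $x_{m_n+1,n}=2\pi+x_{1,n}$. The constant $\gamma$ in the claim is this one. The discrete semi-norm is $\|f\|_{X_n}=\big\|\sum_{k=1}^{m_n}|f(x_k)|\chi_{[x_k,x_{k+1})}\big\|_X$. *)

(* Defs.v *)
From mathcomp Require Import all_boot all_order all_algebra.
From mathcomp Require Import all_classical all_reals all_analysis.
From mathcomp.real_closed Require Import complex.

Set Implicit Arguments.
Unset Strict Implicit.
Unset Printing Implicit Defensive.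

Import Order.TTheory GRing.Theory Num.Theory.
Import numFieldNormedType.Exports.

Local Open Scope classical_set_scope.
Local Open Scope ring_scope.
Local Open Scope complex_scope.

(* Real and complex function spaces are treated together: all functions take
   values in R[i] and, for [RealScalars], are required to be real-valued. *)
Variant scalars := RealScalars | ComplexScalars.

Definition in_scalars (R : realType) (K : scalars) : set R[i] :=
  match K with
  | RealScalars => [set z | complex.Im z = 0]
  | ComplexScalars => setT
  end.

(* The real line with the Lebesgue (not just Borel) measurable sets; it is an
   alias of R. *)
Definition lebesgueR (R : realType) :=
  caratheodory_type ((@wlength R idfun)^*)%mu.

Definition leb (R : realType) :
    {measure set (lebesgueR R) -> \bar R} :=
  @completed_lebesgue_measure R.

(* Functions on the circle are 2 pi-periodic functions on R. *)
Definition circle_periodic (R : realType) (f : R -> R[i]) : Prop :=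
  forall x, f (x + 2 * pi) = f x.

Definition measurable_circle (R : realType) (K : scalars) : set (R -> R[i]) :=
  [set f | [/\ circle_periodic f, (forall x, in_scalars K (f x)),
     measurable_fun (setT : set (lebesgueR R)) (fun x => complex.Re (f x)) &
     measurable_fun (setT : set (lebesgueR R)) (fun x => complex.Im (f x))]].

(* 2 pi-periodic extension of the indicator of A, for A contained in an
   interval [a, a + 2 pi). *)
Definition chi (R : realType) (A : set R) (x : R) : R[i] :=
  (\1_[set y | exists j : int, A (y + 2 * pi * j%:~R)] x : R)%:C.

Definition circle_set (R : realType) (E : set R) : Prop :=
  @measurable _ (lebesgueR R) E /\ E `<=` `[- pi, pi[%classic.

(* Integral of |f| over E for the normalized Lebesgue measure on [-pi, pi). *)
Definition circle_int_norm (R : realType) (E : set R) (f : R -> R[i]) : \bar R :=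
  (((2 * pi)^-1)%:E * \int[leb R]_(x in (E : set (lebesgueR R)))
    (ComplexField.Normc.normc (f x))%:E)%E.

(* The members of X are functions, not classes, while the norm only sees
   classes modulo almost everywhere equality; accordingly, inequalities and
   limits in the lattice axioms are almost everywhere. *)
Record banach_lattice (R : realType) (K : scalars) := BanachLattice {
  bl_set : set (R -> R[i]);
  bl_norm : (R -> R[i]) -> R;
  bl_measurable : bl_set `<=` measurable_circle K;
  bl_zero : bl_set (fun=> 0);
  bl_add : forall f g, bl_set f -> bl_set g -> bl_set (fun x => f x + g x);
  bl_scale : forall a f, in_scalars K a -> bl_set f ->
    bl_set (fun x => a * f x);
  bl_norm_ge0 : forall f, bl_set f -> 0 <= bl_norm f;
  bl_norm_eq0 : forall f, bl_set f ->
    (bl_norm f = 0 <-> \forall x \ae leb R, f x = 0);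
  bl_normD : forall f g, bl_set f -> bl_set g ->
    bl_norm (fun x => f x + g x) <= bl_norm f + bl_norm g;
  bl_normZ : forall a f, in_scalars K a -> bl_set f ->
    bl_norm (fun x => a * f x) = ComplexField.Normc.normc a * bl_norm f;
  bl_complete : forall f_ : nat -> R -> R[i], (forall n, bl_set (f_ n)) ->
    (forall e, 0 < e -> exists N, forall m n, (N <= m)%N -> (N <= n)%N ->
      bl_norm (fun x => f_ m x - f_ n x) < e) ->
    exists2 f, bl_set f &
      bl_norm (fun x => f_ n x - f x) @[n --> \oo] --> (0 : R);
  bl_ideal : forall f g, measurable_circle K f -> bl_set g ->
    (\forall x \ae leb R, `|f x| <= `|g x|) ->
    bl_set f /\ bl_norm f <= bl_norm g;
  bl_fatou : forall (f_ : nat -> R -> R[i]) (f : R -> R[i]),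
    (forall n, bl_set (f_ n)) -> measurable_circle K f ->
    (exists M, forall n, bl_norm (f_ n) <= M) ->
    (\forall x \ae leb R, (forall n, 0 <= f_ n x <= f_ n.+1 x) /\
      ComplexField.Normc.normc (f_ n x - f x) @[n --> \oo] --> (0 : R)) ->
    bl_set f /\ bl_norm (f_ n) @[n --> \oo] --> bl_norm f;
  bl_chi : forall E, circle_set E -> bl_set (chi E);
  bl_integral : forall E, circle_set E -> exists2 c : R, 0 < c &
    forall f, bl_set f -> (circle_int_norm E f <= (c * bl_norm f)%:E)%E
}.

Definition steklov (R : realType) (h : R) (f : R -> R[i]) (x : R) : R[i] :=
  let D : set (lebesgueR R) := `[x - h / 2, x + h / 2]%classic in
  (h^-1 * \int[leb R]_(t in D) complex.Re (f t)) +i*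
  (h^-1 * \int[leb R]_(t in D) complex.Im (f t)).

Definition steklov_dot (R : realType) (h : R) (f : R -> R[i]) (x : R) : R[i] :=
  steklov h f (x + h / 2).

(* (I - A)^j, the j-th iterate of I - A. *)
Definition id_minus_pow (R : realType) (A : (R -> R[i]) -> R -> R[i]) (j : nat) :
    (R -> R[i]) -> R -> R[i] :=
  iter j (fun f x => f x - A f x).

Definition assumption_A (R : realType) (K : scalars) (X : banach_lattice R K) :
    Prop :=
  (forall h f, 0 < h -> bl_set X f -> bl_set X (steklov h f)) /\
  exists C : R, forall h f, 0 < h -> bl_set X f -> bl_norm X f <= 1 ->
    bl_norm X (steklov h f) <= C.

Definition trig_poly (R : realType) (K : scalars) (n : nat) : set (R -> R[i]) :=
  [set f | exists a b : nat -> R[i],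
    (forall j, in_scalars K (a j) /\ in_scalars K (b j)) /\
    forall x, f x = a 0%N + \sum_(1 <= j < n.+1)
      (a j * (cos (j%:R * x))%:C + b j * (sin (j%:R * x))%:C)].

Definition nth_derivative (R : realType) (j : nat) (f : R -> R[i]) (x : R) : R[i] :=
  derive1n j (fun y => complex.Re (f y)) x +i*
  derive1n j (fun y => complex.Im (f y)) x.

(* The nodes x_1, ..., x_m of level n, together with x_(m+1) = 2 pi + x_1; the
   values of x outside 1, ..., m + 1 are irrelevant. *)
Definition nodes (R : realType) (gamma gamma' : R) (n m : nat) (x : nat -> R) :
    Prop :=
  [/\ (forall k, (1 <= k <= m)%N -> - pi <= x k < pi),
      x m.+1 = 2 * pi + x 1%N &
      forall k, (1 <= k <= m)%N ->
        gamma / n%:R <= x k.+1 - x k <= gamma' / n%:R].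

Definition sampling_op (R : realType) (m : nat) (x : nat -> R)
    (phi : nat -> R -> R[i]) (f : R -> R[i]) (t : R) : R[i] :=
  \sum_(1 <= k < m.+1) f (x k) * phi k t.

Definition discrete_norm (R : realType) (K : scalars) (X : banach_lattice R K)
    (m : nat) (x : nat -> R) (f : R -> R[i]) : R :=
  bl_norm X (fun t => \sum_(1 <= k < m.+1) `|f (x k)| * chi `[x k, x k.+1[ t).

(* Main.v *)
Require Import Defs.
From mathcomp Require Import all_boot all_order all_algebra.
From mathcomp Require Import all_classical all_reals all_analysis.
From mathcomp.real_closed Require Import complex.
From mathcomp Require Import measurable_realfun ring lra.

(* Fourier multipliers whose symbol is C^(1,1) with compact support, applied to p
   at scale 1/n, are dominated at every point within O(1/n) of x by a sum over j
   of 2^-j times averages of |p| over the interval of radius O(2^j/n) around x: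
   two summations by parts bound the kernel by min(n, 1/(n t^2)).  By Assumption
   A they are bounded on X without translation invariance, and trigonometric
   polynomials satisfy ||T||_(X_n) <= C ||T||_X.

   Let h = gamma/n.  The multiplier of 1 - A' (forward averages) is i xi times a
   symbol without zeros, and that of 1 - A (centered averages) is a symbol times
   (i xi)^2.  Division by these symbols gives, for a smooth spectral cut-off T of
   f, the realization
     ||f - T|| + n^-s ||T^(s)|| <= C ||(1 - A')^s f||;
   the frequencies above L n, where there is nothing to divide by, are absorbed,
   because A' A' f is Lipschitz at scale h and so is nearly band-limited for
   large L.  Moreover f - (1 - A)^r f is an average of f, so its discrete norm is
   at most C ||f||.  The upper estimate follows from
     f - G f = (f - T) + (T - G T) - G (f - T),
   and the lower one from G f - G G f = G (f - G f). *)

Set Implicit Arguments.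
Unset Strict Implicit.
Unset Printing Implicit Defensive.

Import Order.TTheory GRing.Theory Num.Theory.
Import numFieldNormedType.Exports.

Local Open Scope classical_set_scope.
Local Open Scope ring_scope.
Local Open Scope complex_scope.

(** The norm sees classes modulo null sets, the discrete semi-norm sees values at the nodes, and
    neither controls the other on X. Fourier analysis is therefore done on Borel representatives of
    the real and imaginary parts. It returns to f because averages depend only on the class: 1 - (1
    - A)^r takes the same value, at every point, on f and on its representative.

    The kernel bound sees only second differences, so no derivative of a symbol is ever taken:
    cut-offs are explicit quadratic splines, and quotients such as (1 - cos x) / x^2 are Taylor
    remainders in integral form, regular at the origin.

    One forward average turns local means into pointwise bounds; the second turns these into a
    Lipschitz bound, which is why A' A' f appears. Absorption requires the small factor to multiply
    the remainder f - V f itself and not f; comparing two cut-offs V whose frequencies differ by a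
    factor 2 achieves this. The difference of two cut-offs vanishes near frequency 0, where the
    symbol of 1 - A' has its zero.

    The condition 2r >= s leaves the polynomial factor (i xi)^(2r - s) once n^-s T^(s) is split off
    from (1 - A)^r T. *)

Section periodic_integrals.
Context {R : realType}.
Notation mu := (@lebesgue_measure R).
Implicit Types (p : R -> R) (a b c t x y : R).

(** * Integrals of periodic, locally integrable functions on the line *)

Definition itg a b p : R := \int[mu]_(x in `[a, b]) p x.

(** Borel measurability keeps (x, t) |-> p (x + t) jointly measurable, as Tonelli and Fubini
    require; Lebesgue measurable functions are brought into this class by [borel_rep]. *)
Definition pint p : Prop :=
  [/\ measurable_fun setT p, forall x, p (x + 2 * pi) = p x &
      mu.-integrable `[- pi, pi] (EFin \o p)].

Lemma measurable_addr t : measurable_fun [set: R] (fun x => x + t : measurableTypeR R).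
Proof. by apply: measurable_funD. Qed.

Lemma preimage_addr_itv t a b :
  (fun x => x + t) @^-1` `[a + t, b + t]%classic = `[a, b]%classic.
Proof. by apply/seteqP; split => x /=; rewrite !in_itv/= !lerD2r. Qed.

(** The push-forward under a shift gives every interval its length, and Lebesgue measure is the only
    measure that does so. *)
Lemma lebesgue_measure_addr t (A : set R) : measurable A ->
  pushforward mu (fun x : R => x + t : measurableTypeR R) A = mu A.
Proof.
move=> mA; apply/esym.
pose m' := [the {measure set (measurableTypeR R) -> \bar R} of (measure_function_pushforward__canonical__measure_function_Measure mu (measurable_addr t))].
have := @lebesgue_measure_unique R m'.
apply => // _ [[a b]] _ <-.
rewrite /= /pushforward.
rewrite (_ : _ @^-1` _ = `]a - t, b - t]%classic); last first.
  by apply/seteqP; split => x /=; rewrite !in_itv/= ltrBlDr lerBrDr.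
by rewrite !lebesgue_measure_itv/= !lte_fin ltrD2r -!EFinB opprB addrA subrK.
Qed.

Lemma ge0_integral_addr t a b (f : R -> \bar R) : measurable_fun setT f ->
  (forall x, 0 <= f x)%E ->
  (\int[mu]_(x in `[a, b]) f (x + t)%R = \int[mu]_(x in `[(a + t)%R, (b + t)%R]) f x)%E.
Proof.
move=> mf f0.
pose phi := fun x : measurableTypeR R => (x + t)%R : measurableTypeR R.
have mphi : measurable_fun setT phi by exact: measurable_addr.
have -> : `[a, b]%classic = phi @^-1` `[(a + t)%R, (b + t)%R]%classic.
  by rewrite -(preimage_addr_itv t a b).
have H := @ge0_integral_pushforward _ _ _ _ R phi mphi mu `[(a + t)%R, (b + t)%R]%classic f.
rewrite -[LHS]H//; last exact: measurable_funS mf.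
by apply: eq_measure_integral => //= A mA AS; exact/lebesgue_measure_addr.
Qed.

Lemma itg_addr a b t p : measurable_fun setT p ->
  mu.-integrable `[a + t, b + t] (EFin \o p) ->
  itg a b (fun x => p (x + t)) = itg (a + t) (b + t) p /\
  mu.-integrable `[a, b] (EFin \o (fun x => p (x + t))).
Proof.
move=> mp ip; have mE : measurable_fun setT (EFin \o p) by exact/measurable_EFinP.
split.
  rewrite /itg /Rintegral; congr fine; rewrite integralE [in RHS]integralE.
  congr (_ - _)%E.
  - rewrite -(ge0_integral_addr t a b (f := ((EFin \o p)^\+)%E)); first by apply: eq_integral => x _; rewrite !funeposE.
    + exact: measurable_funepos.
    + by move=> x; exact: funepos_ge0.
  - rewrite -(ge0_integral_addr t a b (f := ((EFin \o p)^\-)%E)); first by apply: eq_integral => x _; rewrite !funenegE.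
    + exact: measurable_funeneg.
    + by move=> x; exact: funeneg_ge0.
apply/integrableP; split.
  apply: measurable_funTS; apply/measurable_EFinP.
  by apply: measurableT_comp => //; exact: measurable_addr.
rewrite (ge0_integral_addr t a b (f := fun x => `|(p x)%:E|%E))//.
  by case/integrableP : ip.
by apply: measurableT_comp => //; exact/measurable_EFinP.
Qed.

Lemma periodic_int p x (j : int) : (forall x, p (x + 2 * pi) = p x) ->
  p (x + 2 * pi * j%:~R) = p x.
Proof.
move=> pp; have H (k : nat) y : p (y + 2 * pi * k%:R) = p y.
  elim: k => [|k IH]; first by rewrite mulr0 addr0.
  by rewrite -[k.+1%:R]natr1 mulrDr mulr1 addrA pp.
case: j => k; first exact: H.
by rewrite NegzE rmorphN/= mulrN -[in RHS](subrK (2 * pi * k.+1%:R) x) H.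
Qed.

Lemma pint_shift p (k : nat) x : pint p -> p (x + (2 * pi) *+ k) = p x.
Proof. by move=> [_ pp _]; rewrite -mulr_natr; exact: (periodic_int x k pp). Qed.

Lemma pint_shiftN p (k : nat) x : pint p -> p (x - (2 * pi) *+ k) = p x.
Proof. by move=> pp; rewrite -[LHS](pint_shift k _ pp) subrK. Qed.

Lemma integrable_itvU p a b c : mu.-integrable `[a, b] (EFin \o p) ->
  mu.-integrable `[b, c] (EFin \o p) -> a <= b -> b <= c ->
  mu.-integrable `[a, c] (EFin \o p).
Proof.
move=> /integrableP[m1 i1] /integrableP[m2 i2] ab bc.
have E : `[a, c]%classic = `[a, b]%classic `|` `]b, c]%classic.
  by apply: itv_bndbnd_setU; rewrite bnd_simp.
have S : `]b, c]%classic `<=` `[b, c]%classic.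
  by apply: subset_itv; rewrite bnd_simp.
have mU : measurable_fun `[a, c]%classic (EFin \o p).
  rewrite E; apply/measurable_funU => //; split => //.
  exact: measurable_funS m2.
apply/integrableP; split => //; rewrite E ge0_integral_setU//.
- rewrite lte_add_pinfty// (le_lt_trans _ i2)//.
  apply: ge0_subset_integral => //.
  by apply: measurableT_comp.
- by rewrite -E; apply: measurableT_comp.
- apply/disj_setPS => x /= []; rewrite !in_itv/= => /andP[_ xb] /andP[].
  by rewrite ltNge xb.
Qed.

(** Symmetric windows around 0 are enlarged by one period on each side; each added piece is a shift
    of [- pi, pi], where integrability is given. *)
Lemma pint_integrable p a b : pint p -> mu.-integrable `[a, b] (EFin \o p).
Proof.
move=> pp; have [mp per ip] := pp; have pi0 := @pi_gt0 R.
have H (k : nat) : mu.-integrable `[- pi - (2 * pi) *+ k, pi + (2 * pi) *+ k] (EFin \o p).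
  elim: k => [|k IH]; first by rewrite mulr0n subr0 addr0.
  have k0 : 0 <= (2 * pi : R) *+ k by apply: mulrn_wge0; lra.
  apply: (@integrable_itvU _ _ (pi + (2 * pi) *+ k)); last 2 first.
  - by rewrite mulrSr; lra.
  - by rewrite mulrSr; lra.
  - apply: (@integrable_itvU _ _ (- pi - (2 * pi) *+ k)) => //; last 2 first.
    + by rewrite mulrSr; lra.
    + by lra.
    have := @itg_addr (- pi - (2 * pi) *+ k.+1) (- pi - (2 * pi) *+ k) ((2 * pi) *+ k.+1) p mp.
    rewrite subrK (_ : - pi - _ + _ = pi); last by rewrite mulrSr; lra.
    case/(_ ip) => _; apply: eq_integrable => // x _ /=.
    by rewrite pint_shift.
  have := @itg_addr (pi + (2 * pi) *+ k) (pi + (2 * pi) *+ k.+1) (- ((2 * pi) *+ k.+1)) p mp.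
  rewrite addrK (_ : pi + _ - _ = - pi); last by rewrite mulrSr; lra.
  case/(_ ip) => _; apply: eq_integrable => // x _ /=.
  by rewrite pint_shiftN.
have [k kab] : exists k : nat, `|a| + `|b| < k%:R.
  by exists (Num.truncn (`|a| + `|b|)).+1; exact: truncnS_gt.
apply: integrableS (H k) => //; apply: subset_itv; rewrite bnd_simp.
all: have : k%:R <= (2 * pi : R) *+ k by rewrite -(mulr_natl (2 * pi) k) ler_peMr//; have := @pi_ge2 R; lra.
- have := ler_norm (- a); rewrite normrN; have := normr_ge0 b; lra.
- have := ler_norm b; have := normr_ge0 a; lra.
Qed.

Lemma itgU p a b c : pint p -> a <= b -> b <= c ->
  itg a c p = itg a b p + itg b c p.
Proof.
move=> pp ab bc; have i := fun x y => pint_integrable x y pp.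
have := @Rintegral_itvB R p (BLeft a) (BRight c) b (i a c).
rewrite !bnd_simp Rintegral_itv_obnd_cbnd.
  by move=> /(_ ab bc) H; rewrite /itg -H addrC subrK.
by apply: integrableS (i b c) => //; apply: subset_itv; rewrite bnd_simp.
Qed.

Lemma itg_shift2pi p a b : pint p -> itg (a + 2 * pi) (b + 2 * pi) p = itg a b p.
Proof.
move=> pp; have [mp per _] := pp.
have [<- _] := itg_addr mp (pint_integrable (a + 2 * pi) (b + 2 * pi) pp).
by congr itg; apply/funext => x.
Qed.

(** Cutting [a, b + 2 pi] at b or at a + 2 pi leaves two end pieces that are shifts of each other by
    a period. *)
Lemma itg_period p a b : pint p -> itg a (a + 2 * pi) p = itg b (b + 2 * pi) p.
Proof.
move=> pp; wlog ab : a b / a <= b.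
  by move=> H; have [/H//|/ltW/H] := leP a b.
have pi0 := @pi_gt0 R.
have e1 : itg a (b + 2 * pi) p = itg a b p + itg b (b + 2 * pi) p by apply: itgU => //; lra.
have e2 : itg a (b + 2 * pi) p = itg a (a + 2 * pi) p + itg (a + 2 * pi) (b + 2 * pi) p.
  by apply: itgU => //; lra.
rewrite itg_shift2pi// in e2; lra.
Qed.

End periodic_integrals.

(** * Forward averages: measurability, boundedness, exchange of integrals *)

Section average_operators.
Context {R : realType}.
Notation mu := (@lebesgue_measure R).
Implicit Types (p q g : R -> R) (a b c d h t x y : R).

Lemma pint_bounded g (C : R) : measurable_fun setT g ->
  (forall x, g (x + 2 * pi) = g x) -> (forall x, `|g x| <= C) -> pint g.
Proof.
move=> mg pg bg; split => //.
have fin : (mu [set` `[(- pi)%R, pi%R]] < +oo)%E.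
  by rewrite lebesgue_measure_itv/=; case: ifP => // _; rewrite -EFinB ltry.
apply: measurable_bounded_integrable => //.
- exact: measurable_funTS.
- exists C; split; first exact: num_real.
  by move=> M CM x _ /=; rewrite (le_trans (bg x))// ltW.
Qed.

Lemma pintM p g (C : R) : pint p -> measurable_fun setT g ->
  (forall x, g (x + 2 * pi) = g x) -> (forall x, `|g x| <= C) ->
  pint (fun x => p x * g x).
Proof.
move=> [mp pp ip] mg pg bg; split; first exact: measurable_funM.
  by move=> x; rewrite pp pg.
have := @integrableMl _ _ _ mu `[- pi, pi]%classic (measurable_itv _) (EFin \o p) g ip.
apply.
- exact: measurable_funTS.
- exists C; split; first exact: num_real.
  by move=> M CM x _ /=; rewrite (le_trans (bg x))// ltW.
Qed.

Lemma pintD p q : pint p -> pint q -> pint (fun x => p x + q x).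
Proof.
move=> [mp pp ip] [mq pq iq]; split; first exact: measurable_funD.
  by move=> x; rewrite pp pq.
exact: (integrableD _ ip iq).
Qed.

Lemma pintZ c p : pint p -> pint (fun x => c * p x).
Proof.
move=> [mp pp ip]; split; first exact: measurable_funM.
  by move=> x; rewrite pp.
exact: (integrableZl _ c ip).
Qed.

Lemma pintB p q : pint p -> pint q -> pint (fun x => p x - q x).
Proof.
move=> ip /(pintZ (-1)) /(pintD ip); congr pint; apply/funext => x.
by rewrite mulN1r.
Qed.

Lemma pint_norm p : pint p -> pint (fun x => `|p x|).
Proof.
move=> [mp pp ip]; split; first exact: measurableT_comp.
  by move=> x; rewrite pp.
exact: integrable_norm ip.
Qed.

Lemma itgD a b p q : pint p -> pint q ->
  itg a b (fun x => p x + q x) = itg a b p + itg a b q.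
Proof. by move=> ip iq; rewrite /itg RintegralD//; exact: pint_integrable. Qed.

Lemma itgZ a b c p : pint p -> itg a b (fun x => c * p x) = c * itg a b p.
Proof. by move=> ip; rewrite /itg RintegralZl//; exact: pint_integrable. Qed.

Lemma itgB a b p q : pint p -> pint q ->
  itg a b (fun x => p x - q x) = itg a b p - itg a b q.
Proof. by move=> ip iq; rewrite /itg RintegralB//; exact: pint_integrable. Qed.

Lemma itg_ge0 a b p : (forall x, 0 <= p x) -> 0 <= itg a b p.
Proof. by move=> p0; apply: Rintegral_ge0. Qed.

Lemma itg_le a b p q : pint p -> pint q -> (forall x, a <= x <= b -> p x <= q x) ->
  itg a b p <= itg a b q.
Proof.
move=> ip iq pq; apply: le_Rintegral => //.
- exact: pint_integrable.
- exact: pint_integrable.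
Qed.

Lemma itg_norm a b p : pint p -> `|itg a b p| <= itg a b (fun x => `|p x|).
Proof. by move=> ip; apply: le_normr_Rintegral => //; exact: pint_integrable. Qed.

Lemma eq_itg a b p q : (forall x, a <= x <= b -> p x = q x) -> itg a b p = itg a b q.
Proof.
by move=> pq; apply: eq_Rintegral => x; rewrite inE/= in_itv/=; exact: pq.
Qed.

Lemma itgS a b c d p : pint p -> (forall x, 0 <= p x) -> c <= a -> b <= d ->
  itg a b p <= itg c d p.
Proof.
move=> ip p0 ca bd; have [ab|ba] := leP a b; last first.
  by rewrite /itg set_itv_ge ?Rintegral_set0 ?itg_ge0// bnd_simp -ltNge.
rewrite (itgU ip ca (le_trans ab bd)) (itgU ip ab bd).
have := itg_ge0 c a p0; have := itg_ge0 b d p0; lra.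
Qed.

Lemma itg_cst a b c : a <= b -> itg a b (fun=> c) = c * (b - a).
Proof.
move=> ab; rewrite /itg Rintegral_cst//; congr (_ * _).
have : (mu [set` `[a, b]] = (b - a)%:E)%E; last by move=> /(congr1 fine).
rewrite lebesgue_measure_itv/= lte_fin; case: ltP => // ba.
by rewrite (_ : a = b) ?subrr//; apply/eqP; rewrite eq_le ba ab.
Qed.

Definition adot h p x : R := h^-1 * itg x (x + h) p.

Lemma itg_shift0 h p x : pint p -> itg x (x + h) p = itg 0 h (fun t => p (x + t)).
Proof.
move=> ip; have [mp _ _] := ip.
have [E _] := itg_addr mp (pint_integrable (0 + x) (h + x) ip).
rewrite (_ : itg 0 h _ = itg 0 h (fun t => p (t + x))); last first.
  by apply: eq_itg => t _; rewrite addrC.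
by rewrite E add0r (addrC h).
Qed.

Lemma measurable_shift2 p : measurable_fun setT p ->
  measurable_fun setT (fun z : R * R => p (z.1 + z.2)).
Proof.
move=> mp; apply: (measurableT_comp (f := p) (g := fun z : R * R => z.1 + z.2)) => //.
by apply: measurable_funD; [exact: measurable_fst|exact: measurable_snd].
Qed.

(** A shift turns the moving window into the fixed interval [0, h]. Tonelli then applies to the
    positive and negative parts of p separately. *)
Lemma measurable_itg_window h p : pint p ->
  measurable_fun setT (fun x => itg x (x + h) p).
Proof.
move=> ip; have [mp _ _] := ip.
have H (q : R -> R) : measurable_fun setT q -> (forall x, 0 <= q x) ->
  measurable_fun setT (fun x => (\int[mu]_(t in `[0%R, h]) (q (x + t))%:E)%E).
  move=> mq q0.
  pose f (z : R * R) := (q (z.1 + z.2) * \1_`[0, h]%classic z.2)%:E.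
  have mf : measurable_fun setT f.
    apply/measurable_EFinP; apply: measurable_funM; first exact: measurable_shift2.
    apply: (measurableT_comp (f := \1_`[0, h]%classic : R -> R)) => //.
  have f0 z : (0 <= f z)%E by rewrite lee_fin mulr_ge0.
  have := measurable_fun_fubini_tonelli_F (m2 := mu) f mf f0.
  congr (measurable_fun _ _); apply/funext => x; rewrite /fubini_F [RHS]integral_mkcond.
  apply: eq_integral => t _; rewrite /f /= patchE indicE.
  by case: ifP; rewrite ?mulr1 ?mulr0.
rewrite (_ : (fun x => _) = (fun x =>
   fine (\int[mu]_(t in `[0%R, h]) (Num.max (p (x + t)) 0)%:E)%E -
   fine (\int[mu]_(t in `[0%R, h]) (Num.max (- p (x + t)) 0)%:E)%E)).
  apply: measurable_funB; apply: measurableT_comp => //.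
    apply: (H (fun x => Num.max (p x) 0)); first exact: measurable_maxr.
    by move=> x; rewrite le_max lexx orbT.
  apply: (H (fun x => Num.max (- p x) 0)).
    by apply: measurable_maxr => //; exact: measurableT_comp.
  by move=> x; rewrite le_max lexx orbT.
apply/funext => x; rewrite itg_shift0// /itg.
have [_ I] := itg_addr mp (pint_integrable (0 + x) (h + x) ip).
have I1 : mu.-integrable `[0, h] (EFin \o (fun t => Num.max (p (x + t)) 0)).
  have := (fun H => integrable_funrpos H I) => /(_ (measurable_itv _)).
  by apply: eq_integrable => // t _ /=; rewrite /funrpos (addrC x).
have I2 : mu.-integrable `[0, h] (EFin \o (fun t => Num.max (- p (x + t)) 0)).
  have := (fun H => integrable_funrneg H I) => /(_ (measurable_itv _)).
  by apply: eq_integrable => // t _ /=; rewrite /funrneg (addrC x).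
rewrite -[LHS]/(\int[mu]_(t in `[0, h]) p (x + t)).
transitivity (\int[mu]_(t in `[0, h]) (Num.max (p (x + t)) 0 - Num.max (- p (x + t)) 0)).
  apply: eq_Rintegral => t _; case: (leP (p (x + t)) 0) => ?; case: (leP (- p (x + t)) 0) => ?; lra.
by rewrite RintegralB.
Qed.

Lemma period_rep x : exists y (j : int), - pi <= y < pi /\ x = y + 2 * pi * j%:~R.
Proof.
have pi0 := @pi_gt0 R.
pose z := Num.floor ((x + pi) / (2 * pi)).
have /andP[z1 z2] : z%:~R <= (x + pi) / (2 * pi) < (z + 1)%:~R by apply: floor_itv; exact: num_real.
rewrite ler_pdivlMr ?mulr_gt0// in z1; rewrite ltr_pdivrMr ?mulr_gt0// rmorphD/= mulrDl mul1r in z2.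
exists (x - z%:~R * (2 * pi)), z; split; last by rewrite mulrC subrK.
by apply/andP; split; lra.
Qed.

Lemma adot_periodic h p : pint p -> forall x, adot h p (x + 2 * pi) = adot h p x.
Proof.
by move=> ip x; rewrite /adot -(itg_shift2pi x (x + h) ip) addrAC.
Qed.

Lemma adot_bounded h p : 0 < h -> pint p -> exists C, forall x, `|adot h p x| <= C.
Proof.
move=> h0 ip; exists (h^-1 * itg (- pi) (pi + h) (fun x => `|p x|)) => x.
have [y [j [/andP[y1 /ltW y2] ->]]] := period_rep x.
rewrite (periodic_int _ _ (adot_periodic h ip)).
rewrite normrM gtr0_norm ?invr_gt0// ler_pM2l ?invr_gt0//.
by rewrite (le_trans (itg_norm _ _ ip))// itgS ?lerD2r//; exact: pint_norm.
Qed.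

Lemma pint_adot h p : 0 < h -> pint p -> pint (adot h p).
Proof.
move=> h0 ip; have [C bC] := adot_bounded h0 ip.
apply: (@pint_bounded _ C) => //; last exact: adot_periodic.
by apply: measurable_funM => //; exact: measurable_itg_window.
Qed.

Lemma integral_itv_slice a b q c : measurable_fun setT q ->
  mu.-integrable `[a, b] (EFin \o q) ->
  (\int[mu]_x (q x * c * \1_`[a, b]%classic x)%:E = (itg a b q * c)%:E)%E.
Proof.
move=> mq iq.
transitivity (\int[mu]_(x in `[a, b]) (c * q x)%:E)%E.
  rewrite [RHS]integral_mkcond; apply: eq_integral => t _.
  rewrite patchE indicE; case: ifP; rewrite ?mulr1 ?mulr0// => _.
  by rewrite mulrC.
rewrite -[LHS]fineK.
  by rewrite -[fine _]/(\int[mu]_(x in `[a, b]) (c * q x)) RintegralZl// mulrC.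
apply: integrable_fin_num => //.
exact: (integrableZl _ c iq).
Qed.

Lemma itg_Fubini a b h p g : pint p -> measurable_fun setT g ->
  (forall x, `|g x| <= 1) ->
  itg a b (fun x => itg 0 h (fun t => p (x + t)) * g x) =
  itg 0 h (fun t => itg a b (fun x => p (x + t) * g x)).
Proof.
move=> ip mg g1.
pose I1 := \1_`[a, b]%classic : R -> R.
pose I2 := \1_`[0, h]%classic : R -> R.
have slice1 q c x : pint q ->
    (\int[mu]_t (q (x + t)%R * c * I2 t)%:E = (itg 0 h (fun t => q (x + t)) * c)%:E)%E.
  move=> iq; have [mq _ _] := iq; apply: integral_itv_slice.
    by apply: measurableT_comp => //; apply: measurable_funD.
  have [_ I] := itg_addr mq (pint_integrable (0 + x) (h + x) iq).
  by apply: eq_integrable I => // t _ /=; rewrite addrC.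
pose f (z : R * R) := (p (z.1 + z.2) * (g z.1 * I1 z.1) * I2 z.2)%:E.
have [mp _ _] := ip.
have m1 : measurable_fun setT (fun z : R * R => I1 z.1).
  by apply: (measurableT_comp (f := I1)); rewrite /I1.
have m2 : measurable_fun setT (fun z : R * R => I2 z.2).
  by apply: (measurableT_comp (f := I2)); rewrite /I2.
have mgz : measurable_fun setT (fun z : R * R => g z.1).
  exact: (measurableT_comp (f := g)).
have mf : measurable_fun setT f.
  apply/measurable_EFinP; apply: measurable_funM => //; apply: measurable_funM.
    exact: measurable_shift2.
  exact: measurable_funM.
have intf : (mu \x mu)%E.-integrable setT f.
  apply/(integrable12ltyP mu mu mf).
  (* For x in [a, b] the window [x, x + h] stays inside [a, b + h], so K bounds all inner integrals
     at once. *)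
  pose K := itg a (b + h) (fun t => `|p t|).
  have inp := pint_norm ip.
  apply: (@le_lt_trans _ _ (\int[mu]_x (K * 1 * I1 x)%:E)%E); last first.
    rewrite integral_itv_slice ?ltry//.
    by apply: pint_integrable; apply: (@pint_bounded _ `|K|).
  apply: ge0_le_integral => //.
  - move=> x _; exact: integral_ge0.
  - apply: (measurable_fun_fubini_tonelli_F (m2 := mu) (fun z => `|f z|%E)) => //.
    exact: measurableT_comp.
  - by apply/measurable_EFinP; apply: measurable_funM => //; exact: measurable_indic.
  move=> x _.
  rewrite (_ : (fun y => _) = fun t => (`|p (x + t)| * (`|g x| * I1 x) * I2 t)%:E); last first.
    have nm (u v w z : R) : `|u * (v * w) * z| = `|u| * (`|v| * `|w|) * `|z| by rewrite !normrM.
    have n1 : `|I1 x| = I1 x by rewrite ger0_norm.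
    apply/funext => t /=; have n2 : `|I2 t| = I2 t by rewrite ger0_norm.
    by rewrite nm n1 n2.
  rewrite (slice1 (fun t => `|p t|))// lee_fin mulr1 mulrA.
  rewrite /I1 indicE; case: (boolP (x \in _)) => xab; rewrite ?mulr0// !mulr1; move: xab => /set_mem/=.
  rewrite in_itv/= => /andP[ax xb].
  rewrite -[itg 0 h _](itg_shift0 h x inp) (le_trans (ler_piMr _ (g1 x)))//.
  - by rewrite itg_ge0.
  - by apply: itgS => //; rewrite lerD2r.
have slice2 t : (\int[mu]_x f (x, t) =
    (itg a b (fun x => p (x + t) * g x) * 1 * I2 t)%:E)%E.
  rewrite mulr1 -(@integral_itv_slice a b (fun x => p (x + t) * g x) (I2 t)).
  - apply: eq_integral => x _; rewrite /f/=; congr EFin; ring.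
  - by apply: measurable_funM => //; apply: measurableT_comp => //; exact: measurable_funD.
  have [_ I] := itg_addr mp (pint_integrable (a + t) (b + t) ip).
  have := (fun H => @integrableMl _ _ _ mu `[a, b]%classic H _ g I) => /(_ (measurable_itv _)).
  apply; first exact: measurable_funTS.
  exists 1; split; first exact: num_real.
  by move=> M CM x _ /=; rewrite (le_trans (g1 x))// ltW.
have := Fubini intf.
rewrite (_ : (fun x => (\int[mu]_y f (x, y))%E) = fun x => (itg 0 h (fun t => p (x + t)) * (g x * I1 x))%:E); last first.
  by apply/funext => x; rewrite -slice1.
rewrite (_ : (fun y => (\int[mu]_x f (x, y))%E) = fun t => (itg a b (fun x => p (x + t) * g x) * 1 * I2 t)%:E); last first.
  by apply/funext => t; rewrite slice2.
move=> /(congr1 fine) E.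
rewrite /itg [LHS]Rintegral_mkcond [RHS]Rintegral_mkcond /Rintegral.
move: E; congr (fine _ = fine _); apply: eq_integral => x _; rewrite patchE /I1 /I2 indicE.
- by case: ifP; rewrite ?mulr1 ?mulr0// mulrA.
- by case: ifP; rewrite ?mulr1 ?mulr0.
Qed.

End average_operators.

(** * Symbols with bounded second differences on compact sets *)

Section smooth_symbols.
Context {R : realType}.
Implicit Types (p q : R -> R) (M C c x y d : R).

(** A derivative-free form of C^(1,1) on [-M, M]: summation by parts only needs second differences,
    and the three bounds together are stable under products and inverses. *)
Definition C11 M C p : Prop :=
  [/\ forall x, `|x| <= M -> `|p x| <= C,
      forall x y, `|x| <= M -> `|y| <= M -> `|p x - p y| <= C * `|x - y| &
      forall x d, `|x + d| <= M -> `|x - d| <= M ->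
        `|p (x + d) - 2 * p x + p (x - d)| <= C * d ^+ 2].

Definition loc_C11 p : Prop := forall M, exists C, C11 M C p.

Lemma loc_C11_pos p M : loc_C11 p -> exists2 C : R, 0 < C & C11 M C p.
Proof.
move=> /(_ M)[C [h1 h2 h3]]; exists (`|C| + 1); first by rewrite ltr_wpDl.
have CC : C <= `|C| + 1 by rewrite (le_trans (ler_norm C))// lerDl.
split => [x hx|x y hx hy|x d h h'].
- exact: le_trans (h1 x hx) CC.
- by rewrite (le_trans (h2 x y hx hy))// ler_wpM2r.
- by rewrite (le_trans (h3 x d h h'))// ler_wpM2r// sqr_ge0.
Qed.

Lemma mid_bound M x d : `|x + d| <= M -> `|x - d| <= M -> `|x| <= M.
Proof. rewrite !ler_norml => /andP[? ?] /andP[? ?]; apply/andP; split; lra. Qed.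

Lemma loc_C11_cst c : loc_C11 (fun=> c).
Proof.
move=> M; exists `|c|; split => [//|x y _ _|x d _ _].
  by rewrite subrr normr0 mulr_ge0.
by rewrite (_ : c - 2 * c + c = 0); [rewrite normr0 mulr_ge0 ?sqr_ge0|ring].
Qed.

Lemma loc_C11_id : loc_C11 (fun x => x).
Proof.
move=> M; exists (`|M| + 1); split => [x hx|x y _ _|x d _ _].
- by rewrite (le_trans hx)// (le_trans (ler_norm _))// lerDl.
- by rewrite ler_peMl// lerDr.
- rewrite (_ : x + d - 2 * x + (x - d) = 0); last by ring.
  by rewrite normr0 mulr_ge0 ?sqr_ge0// addr_ge0.
Qed.

Lemma loc_C11D p q : loc_C11 p -> loc_C11 q -> loc_C11 (fun x => p x + q x).
Proof.
move=> hp hq M; have [A A0 [a1 a2 a3]] := loc_C11_pos M hp.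
have [B B0 [b1 b2 b3]] := loc_C11_pos M hq; exists (A + B); split.
- by move=> x hx; rewrite (le_trans (ler_normD _ _))// lerD ?a1 ?b1.
- move=> x y hx hy; rewrite (_ : _ - _ = (p x - p y) + (q x - q y)); last by ring.
  by rewrite (le_trans (ler_normD _ _))// mulrDl lerD ?a2 ?b2.
- move=> x d h h'.
  rewrite (_ : _ + _ = (p (x + d) - 2 * p x + p (x - d)) + (q (x + d) - 2 * q x + q (x - d))); last by ring.
  by rewrite (le_trans (ler_normD _ _))// [leRHS]mulrDl lerD ?a3 ?b3.
Qed.

Lemma loc_C11M p q : loc_C11 p -> loc_C11 q -> loc_C11 (fun x => p x * q x).
Proof.
move=> hp hq M; have [A A0 [a1 a2 a3]] := loc_C11_pos M hp.
have [B B0 [b1 b2 b3]] := loc_C11_pos M hq; exists (4 * (A * B)).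
have AB : 0 <= A * B by rewrite mulr_ge0// ltW.
split.
- move=> x hx; rewrite normrM (le_trans (ler_pM _ _ (a1 x hx) (b1 x hx)))//; lra.
- move=> x y hx hy; rewrite (_ : _ - _ = p x * (q x - q y) + (p x - p y) * q y); last by ring.
  rewrite (le_trans (ler_normD _ _))// !normrM.
  apply: (@le_trans _ _ (A * (B * `|x - y|) + A * `|x - y| * B)).
    by rewrite lerD// ler_pM// ?a1 ?b2 ?a2 ?b1.
  rewrite -subr_ge0 (_ : _ - _ = 2 * (A * B * `|x - y|)); last by ring.
  by apply: mulr_ge0 => //; apply: mulr_ge0.
- move=> x d h h'; have h0 := mid_bound h h'.
  (* Discrete Leibniz rule; its four terms account for the factor 4 in the constant. *)
  rewrite (_ : _ + _ = p x * (q (x + d) - 2 * q x + q (x - d)) +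
     q x * (p (x + d) - 2 * p x + p (x - d)) +
     (p (x + d) - p x) * (q (x + d) - q x) +
     (p (x - d) - p x) * (q (x - d) - q x)); last by ring.
  rewrite (_ : 4 * (A * B) * d ^+ 2 = A * (B * d ^+ 2) + B * (A * d ^+ 2)
     + (A * `|d|) * (B * `|d|) + (A * `|d|) * (B * `|d|)); last first.
    by rewrite -[d ^+ 2]real_normK ?num_real//; ring.
  have e1 : `|x + d - x| = `|d| by congr (`|_|); ring.
  have e2 : `|x - d - x| = `|d| by rewrite -normrN; congr (`|_|); ring.
  rewrite (le_trans (ler_normD _ _))// lerD//.
    rewrite (le_trans (ler_normD _ _))// lerD//.
      rewrite (le_trans (ler_normD _ _))// lerD// normrM ler_pM//.
      + exact: a1.
      + exact: b3.
      + exact: b1.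
      + exact: a3.
    rewrite normrM -e1 ler_pM//; [exact: a2|exact: b2].
  rewrite normrM -e2 ler_pM//; [exact: a2|exact: b2].
Qed.

Lemma loc_C11Z c p : loc_C11 p -> loc_C11 (fun x => c * p x).
Proof. by apply: loc_C11M; exact: loc_C11_cst. Qed.

Lemma loc_C11N p : loc_C11 p -> loc_C11 (fun x => - p x).
Proof.
by move=> /(loc_C11Z (-1)); congr loc_C11; apply/funext => x; rewrite mulN1r.
Qed.

Lemma loc_C11_comp_affine c b p : loc_C11 p -> loc_C11 (fun x => p (c * x + b)).
Proof.
move=> hp M; have [A A0 [a1 a2 a3]] := loc_C11_pos (`|c| * M + `|b|) hp.
have H x : `|x| <= M -> `|c * x + b| <= `|c| * M + `|b|.
  by move=> hx; rewrite (le_trans (ler_normD _ _))// lerD2r normrM ler_wpM2l.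
have A0' := ltW A0; exists (A * (1 + `|c| + c ^+ 2)).
have c2 := sqr_ge0 c; have c1 := normr_ge0 c.
split.
- move=> x hx; rewrite (le_trans (a1 _ (H x hx)))// ler_peMr //; lra.
- move=> x y hx hy; rewrite (le_trans (a2 _ _ (H x hx) (H y hy)))//.
  rewrite opprD addrACA subrr addr0 -mulrBr normrM -mulrA ler_wpM2l // ler_wpM2r//; lra.
- move=> x d /H h /H h'.
  have e1 : c * (x + d) + b = c * x + b + c * d by ring.
  have e2 : c * (x - d) + b = c * x + b - c * d by ring.
  rewrite e1 e2 in h h' *; rewrite (le_trans (a3 _ _ h h'))//.
  rewrite exprMn -[leRHS]mulrA ler_wpM2l // ler_wpM2r ?sqr_ge0//; lra.
Qed.

Lemma loc_C11_scale c p : loc_C11 p -> loc_C11 (fun x => p (c * x)).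
Proof.
by move=> /(loc_C11_comp_affine c 0); congr loc_C11; apply/funext => x; rewrite addr0.
Qed.

Lemma loc_C11_continuous p : loc_C11 p -> continuous p.
Proof.
move=> hp x; have [C C0 [_ L _]] := loc_C11_pos (`|x| + 1) hp.
apply/cvgrPdist_le => e e0.
have m0 : 0 < Num.min 1 (e / C) by rewrite lt_min ltr01 divr_gt0.
apply/nbhs_ballP; exists (Num.min 1 (e / C)) => // y.
rewrite /ball/= lt_min => /andP[/ltW y1 /ltW yC].
rewrite (le_trans (L _ _ _ _))//.
- by rewrite lerDl.
- have := ler_normB x (x - y); rewrite opprB addrC subrK; lra.
- by rewrite mulrC -ler_pdivlMr.
Qed.

Lemma loc_C11_lower M p : loc_C11 p -> (forall x, p x != 0) ->
  exists2 c : R, 0 < c & forall x, `|x| <= M -> c <= `|p x|.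
Proof.
move=> hp p0; have [M0|M0] := leP 0 M; last first.
  by exists 1 => // x hx; have := normr_ge0 x; lra.
have MM : - M <= M by lra.
have cp : {within `[- M, M], continuous (fun x => `|p x|)}.
  apply: continuous_subspaceT => x; apply: continuous_comp.
    exact: loc_C11_continuous.
  exact: norm_continuous.
have [c _ hc] := EVT_min MM cp.
exists `|p c|; first by rewrite normr_gt0.
by move=> x; rewrite ler_norml => hx; apply: hc; rewrite in_itv.
Qed.

Lemma loc_C11V p : loc_C11 p -> (forall x, p x != 0) -> loc_C11 (fun x => (p x)^-1).
Proof.
move=> hp p0 M; have [c c0 cp] := loc_C11_lower M hp p0.
have [A A0 [a1 a2 a3]] := loc_C11_pos M hp.
have iv x : `|x| <= M -> `|(p x)^-1| <= c^-1.
  by move=> hx; rewrite normfV lef_pV2 ?posrE ?cp// (lt_le_trans c0 (cp x hx)).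
have c0' : 0 <= c^-1 by rewrite invr_ge0 ltW.
have L x y : `|x| <= M -> `|y| <= M -> `|(p x)^-1 - (p y)^-1| <= c^-2 * A * `|x - y|.
  move=> hx hy; rewrite (_ : _ - _ = (p x)^-1 * (p y)^-1 * (p y - p x)); last first.
    by move: (p0 x) (p0 y); move: (p x) (p _) => u v *; field; apply/andP.
  rewrite normrM -mulrA; apply: ler_pM => //.
    by rewrite normrM -exprVn expr2 ler_pM ?iv.
  by rewrite distrC a2.
exists (c^-1 + c^-2 * A + 2 * c^-1 * A * (c^-2 * A)).
have A0' := ltW A0.
have K1 : 0 <= c^-2 * A by rewrite mulr_ge0// invr_ge0 sqr_ge0.
have K2 : 0 <= 2 * c^-1 * A * (c^-2 * A) by rewrite mulr_ge0// mulr_ge0// mulr_ge0.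
split.
- move=> x /iv h; lra.
- by move=> x y hx hy; rewrite (le_trans (L x y hx hy))// ler_wpM2r//; lra.
- move=> x d h h'; have h0 := mid_bound h h'.
  (* This is the discrete Leibniz rule for the product of p and 1/p, which is constant, solved for
     the second difference of 1/p. *)
  have -> : (p (x + d))^-1 - 2 * (p x)^-1 + (p (x - d))^-1 =
     - ((p x)^-1 * ((p (x + d) - 2 * p x + p (x - d)) * (p x)^-1 +
     (p (x + d) - p x) * ((p (x + d))^-1 - (p x)^-1) +
     (p (x - d) - p x) * ((p (x - d))^-1 - (p x)^-1))).
    by move: (p0 x) (p0 (x + d)) (p0 (x - d)); move: (p x) (p _) (p _) => u v w *; field; apply/and3P.
  have e1 : `|x + d - x| = `|d| by congr (`|_|); ring.
  have e2 : `|x - d - x| = `|d| by rewrite -normrN; congr (`|_|); ring.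
  rewrite normrN normrM.
  apply: (@le_trans _ _ (c^-1 * (A * d ^+ 2 * c^-1 + A * `|d| * (c^-2 * A * `|d|) + A * `|d| * (c^-2 * A * `|d|)))).
    apply: ler_pM => //; first exact: iv.
    rewrite (le_trans (ler_normD _ _))// lerD//.
      rewrite (le_trans (ler_normD _ _))// lerD//.
        by rewrite normrM ler_pM//; [exact: a3|exact: iv].
      by rewrite normrM -e1 ler_pM//; [exact: a2|exact: L].
    by rewrite normrM -e2 ler_pM//; [exact: a2|exact: L].
  rewrite -[d ^+ 2]real_normK ?num_real//.
  have : 0 <= c^-1 * `|d| ^+ 2 by rewrite mulr_ge0 ?sqr_ge0.
  rewrite -exprVn; move: (c^-1) (`|d|) => e D eD; rewrite -subr_ge0.
  by rewrite (_ : _ - _ = e * D ^+ 2)//; ring.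
Qed.

End smooth_symbols.

(** * Taylor remainders of sine and cosine in integral form *)

Section trigonometric_weights.
Context {R : realType}.
Notation mu := (@lebesgue_measure R).
Implicit Types (f F w : R -> R) (a b c h x y C : R).

Lemma itg_FTC f F a b : a <= b -> (forall x, is_derive x 1 F (f x)) ->
  continuous f -> itg a b f = F b - F a.
Proof.
rewrite le_eqVlt => /predU1P[->|ab] dF cf.
  by rewrite /itg set_itv1 Rintegral_set1 subrr.
have cF : continuous F.
  by move=> x; apply: differentiable_continuous; apply/derivable1_diffP; have [] := dF x.
rewrite /itg /Rintegral (@continuous_FTC2 _ f F) => //.
- exact: continuous_subspaceT.
- split; first by move=> x _; have [] := dF x.
  + by apply: cvg_at_right_filter; exact: cF.
  + by apply: cvg_at_left_filter; exact: cF.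
- by move=> x _; rewrite derive1E; have [] := dF x.
Qed.

Lemma continuous_itv_integrable f a b : continuous f ->
  mu.-integrable `[a, b] (EFin \o f).
Proof.
move=> cf; apply: continuous_compact_integrable; first exact: segment_compact.
exact: continuous_subspaceT.
Qed.

(** For the weights [w1] and [w2] below these are Taylor remainders: (1 - cos x) / x^2, (x - sin x)
    / x^2 and (x - sin x) / x^3, with the value at the origin already filled in. *)
Definition wcos w x : R := itg 0 1 (fun u => w u * cos (x * u)).
Definition wsin w x : R := itg 0 1 (fun u => w u * sin (x * u)).

Lemma itg01_bound f C : continuous f -> (forall u, 0 <= u <= 1 -> `|f u| <= C) ->
  `|itg 0 1 f| <= C.
Proof.
move=> cf fC; have If := continuous_itv_integrable 0 1 cf.
rewrite (le_trans (le_normr_Rintegral _ If))//.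
rewrite -[leRHS]mulr1 -[X in _ * X]subr0 -(itg_cst C (@ler01 R)).
apply: le_Rintegral => //.
- apply: continuous_itv_integrable => x; apply: continuous_comp; first exact: cf.
  exact: norm_continuous.
- by apply: continuous_itv_integrable => x; exact: cst_continuous.
Qed.

Lemma itgB_continuous f g a b : continuous f -> continuous g ->
  itg a b (fun x => f x - g x) = itg a b f - itg a b g.
Proof. by move=> cf cg; rewrite /itg RintegralB//; exact: continuous_itv_integrable. Qed.

Lemma itgD_continuous f g a b : continuous f -> continuous g ->
  itg a b (fun x => f x + g x) = itg a b f + itg a b g.
Proof. by move=> cf cg; rewrite /itg RintegralD//; exact: continuous_itv_integrable. Qed.

Lemma itgZ_continuous c f a b : continuous f ->
  itg a b (fun x => c * f x) = c * itg a b f.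
Proof. by move=> cf; rewrite /itg RintegralZl//; exact: continuous_itv_integrable. Qed.

Lemma itg_le_continuous f g a b : continuous f -> continuous g ->
  (forall x, a <= x <= b -> f x <= g x) -> itg a b f <= itg a b g.
Proof.
move=> cf cg fg; apply: le_Rintegral => //; exact: continuous_itv_integrable.
Qed.

Lemma derivative_bound F f C x y : (forall x, is_derive x 1 F (f x)) ->
  continuous f -> (forall x, `|f x| <= C) -> `|F x - F y| <= C * `|x - y|.
Proof.
move=> dF cf fC; wlog yx : x y / y <= x.
  by move=> H; have [/H//|/ltW/H] := leP y x; rewrite distrC (distrC y).
rewrite -(itg_FTC yx dF cf) [X in _ * X]ger0_norm ?subr_ge0// -(itg_cst C yx).
rewrite (le_trans (le_normr_Rintegral _ (continuous_itv_integrable _ _ cf)))//.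
apply: itg_le_continuous => [z|z|z _]; last exact: fC.
- by apply: continuous_comp; [exact: cf|exact: norm_continuous].
- exact: cst_continuous.
Qed.

Lemma cos_lip x y : `|cos x - cos y| <= `|x - y|.
Proof.
rewrite -[leRHS]mul1r; apply: (derivative_bound (f := fun x => - sin x)) => [z|z].
- by apply: continuousN; exact: continuous_sin.
- by rewrite normrN sin_max.
Qed.

Lemma sin_lip x y : `|sin x - sin y| <= `|x - y|.
Proof.
rewrite -[leRHS]mul1r; apply: (derivative_bound (f := @cos R)) => [z|z].
- exact: continuous_cos.
- exact: cos_max.
Qed.

Lemma cos_ge x : 1 - cos x <= x ^+ 2 / 2.
Proof.
have := sin_lip (x / 2) 0; rewrite sin0 !subr0 => H.
have -> : cos x = 1 - 2 * sin (x / 2) ^+ 2.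
  have {1}-> : x = x / 2 + x / 2 by field.
  by rewrite cosD -!expr2 cos2sin2; ring.
have : sin (x / 2) ^+ 2 <= (x / 2) ^+ 2.
  by rewrite -[leLHS]real_normK ?num_real// -[leRHS]real_normK ?num_real// ler_sqr ?nnegrE.
rewrite expr_div_n; lra.
Qed.

Let continuous_scale c : continuous (fun u : R => c * u).
Proof. by move=> u; apply: continuousM; [exact: cst_continuous|exact: cvg_id]. Qed.

Lemma continuous_cosZ c : continuous (fun u : R => cos (c * u)).
Proof.
by move=> u; apply: continuous_comp; [exact: continuous_scale|exact: continuous_cos].
Qed.

Lemma continuous_sinZ c : continuous (fun u : R => sin (c * u)).
Proof.
by move=> u; apply: continuous_comp; [exact: continuous_scale|exact: continuous_sin].
Qed.

Lemma continuous_mul f g : continuous f -> continuous g -> continuous (fun u : R => f u * g u).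
Proof. by move=> cf cg u; apply: continuousM; [exact: cf|exact: cg]. Qed.

Lemma continuous_Z c f : continuous f -> continuous (fun u : R => c * f u).
Proof. by apply: continuous_mul => u; exact: cst_continuous. Qed.

Lemma continuous_add f g : continuous f -> continuous g -> continuous (fun u : R => f u + g u).
Proof. by move=> cf cg u; apply: continuousD; [exact: cf|exact: cg]. Qed.

Lemma continuous_sub f g : continuous f -> continuous g -> continuous (fun u : R => f u - g u).
Proof. by move=> cf cg u; apply: continuousB; [exact: cf|exact: cg]. Qed.

(** Differences in x pass under the integral and become differences of K with step d u. Since 0 <= u
    <= 1, the bounds for K carry over with constant 1. *)
Lemma weight_C11 w (K : R -> R) : continuous w -> (forall u, 0 <= u <= 1 -> `|w u| <= 1) ->
  (forall c, continuous (fun u => K (c * u))) ->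
  (forall x, `|K x| <= 1) -> (forall x y, `|K x - K y| <= `|x - y|) ->
  (forall x d, `|K (x + d) - 2 * K x + K (x - d)| <= d ^+ 2) ->
  loc_C11 (fun x => itg 0 1 (fun u => w u * K (x * u))).
Proof.
move=> cw w1 cK K1 KL K2 M.
have cwK c : continuous (fun u => w u * K (c * u)) by apply: continuous_mul.
exists 1; split.
- move=> x _; apply: itg01_bound => // u hu.
  by rewrite normrM -[leRHS]mulr1 ler_pM ?w1.
- move=> x y _ _; rewrite -itgB_continuous// mul1r.
  apply: itg01_bound; first exact: continuous_sub.
  move=> u hu; rewrite -mulrBr normrM -[leRHS]mul1r ler_pM ?w1//.
  rewrite (le_trans (KL _ _))// -mulrBl normrM ler_piMr//.
  by case/andP: hu => u0 u1; rewrite ger0_norm.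
- move=> x d _ _; rewrite -itgZ_continuous// -itgB_continuous//; last first.
    exact: continuous_Z.
  rewrite -itgD_continuous//; last first.
    apply: continuous_sub => //.
    exact: continuous_Z.
  rewrite mul1r; apply: itg01_bound.
    apply: continuous_add => //; apply: continuous_sub => //.
    exact: continuous_Z.
  move=> u hu; rewrite (_ : _ + _ = w u * (K (x * u + d * u) - 2 * K (x * u) + K (x * u - d * u))).
    rewrite normrM -[leRHS]mul1r ler_pM ?w1//.
    rewrite (le_trans (K2 _ _))// exprMn ler_piMr ?sqr_ge0//.
    by case/andP: hu => u0 u1; rewrite expr_le1.
  by rewrite -mulrDl -mulrBl; ring.
Qed.

Lemma wcos_C11 w : continuous w -> (forall u, 0 <= u <= 1 -> `|w u| <= 1) ->
  loc_C11 (wcos w).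
Proof.
move=> cw w1; apply: weight_C11 => //; last 2 first.
- exact: cos_lip.
- move=> x d; rewrite cosD cosB.
  rewrite (_ : _ + _ = - (2 * cos x * (1 - cos d))); last by ring.
  rewrite normrN !normrM ger0_norm// [`|1 - _|]ger0_norm ?subr_ge0 ?cos_le1//.
  have := cos_ge d; have := cos_max x; have : 0 <= 1 - cos d by rewrite subr_ge0 cos_le1.
  nra.
- exact: continuous_cosZ.
- exact: cos_max.
Qed.

Lemma wsin_C11 w : continuous w -> (forall u, 0 <= u <= 1 -> `|w u| <= 1) ->
  loc_C11 (wsin w).
Proof.
move=> cw w1; apply: weight_C11 => //; last 2 first.
- exact: sin_lip.
- move=> x d; rewrite sinD sinB.
  rewrite (_ : _ + _ = - (2 * sin x * (1 - cos d))); last by ring.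
  rewrite normrN !normrM ger0_norm// [`|1 - _|]ger0_norm ?subr_ge0 ?cos_le1//.
  have := cos_ge d; have := sin_max x; have : 0 <= 1 - cos d by rewrite subr_ge0 cos_le1.
  nra.
- exact: continuous_sinZ.
- exact: sin_max.
Qed.

Definition w1 u : R := 1 - u.
Definition w2 u : R := (1 - u) ^+ 2 / 2.

Lemma continuous_w1 : continuous w1.
Proof.
by apply: continuous_sub => u; [exact: cst_continuous|exact: cvg_id].
Qed.

Lemma continuous_w2 : continuous w2.
Proof.
have -> : w2 = fun u => w1 u * w1 u * 2^-1 by apply/funext => u.
apply: continuous_mul => [|u]; last exact: cst_continuous.
exact: (continuous_mul continuous_w1 continuous_w1).
Qed.

Lemma w1_le1 u : 0 <= u <= 1 -> `|w1 u| <= 1.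
Proof. by move=> /andP[u0 u1]; rewrite /w1 ger0_norm; lra. Qed.

Lemma w2_le1 u : 0 <= u <= 1 -> `|w2 u| <= 1.
Proof.
move=> /andP[u0 u1]; rewrite /w2 ger0_norm; last by rewrite divr_ge0 ?sqr_ge0.
have : (1 - u) ^+ 2 <= 1 by rewrite expr_le1//; lra.
lra.
Qed.

(** Integration by parts, carried out through an explicit antiderivative in u. *)
Lemma wcos1E x : x ^+ 2 * wcos w1 x = 1 - cos x.
Proof.
have D u : is_derive u (1 : R) (fun u : R => (1 - u) * x * sin (x * u) - cos (x * u))
    (x ^+ 2 * (w1 u * cos (x * u))).
  by apply: is_derive_eq; rewrite /w1 /GRing.scale/= /GRing.scale/=; ring.
have c1 : continuous (fun u => w1 u * cos (x * u)).
  by apply: continuous_mul; [exact: continuous_w1|exact: continuous_cosZ].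
rewrite /wcos -itgZ_continuous// (itg_FTC (@ler01 R) D).
  by rewrite subrr !mul0r mulr0 mulr1 sin0 cos0 mulr0; ring.
exact: continuous_Z.
Qed.

Lemma wsin1E x : x ^+ 2 * wsin w1 x = x - sin x.
Proof.
have D u : is_derive u (1 : R) (fun u : R => - ((1 - u) * x * cos (x * u)) - sin (x * u))
    (x ^+ 2 * (w1 u * sin (x * u))).
  by apply: is_derive_eq; rewrite /w1 /GRing.scale/= /GRing.scale/=; ring.
have c1 : continuous (fun u => w1 u * sin (x * u)).
  by apply: continuous_mul; [exact: continuous_w1|exact: continuous_sinZ].
rewrite /wsin -itgZ_continuous// (itg_FTC (@ler01 R) D).
  by rewrite subrr !mul0r mulr0 mulr1 sin0 cos0; ring.
exact: continuous_Z.
Qed.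

(** Integration by parts in u: the derivative of [w2] is - [w1], and the boundary terms vanish
    because [w2] is 0 at 1 and the sine is 0 at 0. *)
Lemma wsin1_wcos2 x : wsin w1 x = x * wcos w2 x.
Proof.
have D u : is_derive u (1 : R) (fun u : R => w2 u * sin (x * u))
    (x * (w2 u * cos (x * u)) - w1 u * sin (x * u)).
  by apply: is_derive_eq; rewrite /w1 /w2 /GRing.scale/= /GRing.scale/=; field.
have c1 : continuous (fun u => w1 u * sin (x * u)).
  by apply: continuous_mul; [exact: continuous_w1|exact: continuous_sinZ].
have c2 : continuous (fun u => w2 u * cos (x * u)).
  by apply: continuous_mul; [exact: continuous_w2|exact: continuous_cosZ].
have c3 : continuous (fun u => x * (w2 u * cos (x * u))).
  exact: continuous_Z.
apply/eqP; rewrite eq_sym -subr_eq0; apply/eqP.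
rewrite /wsin /wcos -itgZ_continuous// -itgB_continuous// (itg_FTC (@ler01 R) D).
  by rewrite /w2 subrr expr0n/= !mul0r mulr0 sin0 mulr0 subrr.
exact: continuous_sub.
Qed.

(** The remainder [wsin w1] replaces the quotient sin (h k) / (h k), so that the formula holds at k
    = 0 too and the deviation from h shows its factor h k. *)
Lemma itg_cos0 k h : 0 <= h -> itg 0 h (fun t => cos (k * t)) = h * (1 - h * k * wsin w1 (h * k)).
Proof.
move=> h0; have [->|k0] := eqVneq k 0.
  rewrite mulr0 mul0r subr0 mulr1 -[RHS]mul1r -[X in _ * X]subr0 -itg_cst//.
  by apply: eq_itg => t _; rewrite mul0r cos0.
have D t : is_derive t (1 : R) (fun t => k^-1 * sin (k * t)) (cos (k * t)).
  by apply: is_derive_eq; rewrite /GRing.scale/= /GRing.scale/=; field.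
rewrite (itg_FTC h0 D (@continuous_cosZ k)) mulr0 sin0 mulr0 subr0.
have := wsin1E (h * k); rewrite (mulrC h k); move: (wsin _ _) (sin _) => W S E.
have -> : S = k * h - (k * h) ^+ 2 * W by rewrite E; ring.
by field.
Qed.

Lemma itg_sin0 k h : 0 <= h -> itg 0 h (fun t => sin (k * t)) = h * (h * k * wcos w1 (h * k)).
Proof.
move=> h0; have [->|k0] := eqVneq k 0.
  rewrite mulr0 mul0r mulr0 -[RHS](mul0r (h - 0)) -itg_cst//.
  by apply: eq_itg => t _; rewrite mul0r sin0.
have D t : is_derive t (1 : R) (fun t => - (k^-1 * cos (k * t))) (sin (k * t)).
  by apply: is_derive_eq; rewrite /GRing.scale/= /GRing.scale/=; field.
rewrite (itg_FTC h0 D (@continuous_sinZ k)) mulr0 cos0.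
have := wcos1E (h * k); rewrite (mulrC h k); move: (wcos _ _) (cos _) => W S E.
have -> : S = 1 - (k * h) ^+ 2 * W by rewrite E; ring.
by field.
Qed.

Lemma wcosN w x : wcos w (- x) = wcos w x.
Proof. by apply: eq_itg => u _; rewrite mulNr cosN. Qed.

Lemma wsinN w x : continuous w -> wsin w (- x) = - wsin w x.
Proof.
move=> cw; rewrite -[RHS]mulN1r /wsin -itgZ_continuous.
  by apply: eq_itg => u _; rewrite mulNr sinN; ring.
by apply: continuous_mul => //; exact: continuous_sinZ.
Qed.

(* Both weights vanish only where [cos x = 1] and [sin x = x], that is at 0,
   where the first one is 1/2. *)
Lemma w1_neq0 x : wcos w1 x ^+ 2 + wsin w1 x ^+ 2 != 0.
Proof.
rewrite paddr_eq0 ?sqr_ge0// !sqrf_eq0; apply/negP => /andP[/eqP c0 /eqP s0].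
have := wsin1E x; have := wcos1E x; rewrite c0 s0 mulr0 => C S.
have x0 : x = 0.
  have cx : cos x = 1 by lra.
  have sx : sin x = x by lra.
  have := cos2Dsin2 x; rewrite cx sx expr1n => H.
  by apply/eqP; rewrite -sqrf_eq0; apply/eqP; lra.
have D u : is_derive u (1 : R) (fun u : R => - ((1 - u) ^+ 2 / 2)) (w1 u).
  by apply: is_derive_eq; rewrite /w1 /GRing.scale/= /GRing.scale/=; field.
have : wcos w1 x = 1 / 2.
  rewrite x0 /wcos (_ : itg _ _ _ = itg 0 1 w1).
    by rewrite (itg_FTC (@ler01 R) D continuous_w1); lra.
  by apply: eq_itg => u _; rewrite mul0r cos0 mulr1.
rewrite c0; lra.
Qed.

End trigonometric_weights.

(** * Fourier symbols of the two averages, and spline cut-offs *)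

Section symbols.
Context {R : realType}.
Implicit Types (p : R -> R) (m : R -> R[i]) (c x y d : R).

Lemma complexP (z w : R[i]) :
  complex.Re z = complex.Re w -> complex.Im z = complex.Im w -> z = w.
Proof. by case: z => a b; case: w => a' b' /= -> ->. Qed.

Definition cis x : R[i] := cos x +i* sin x.

Lemma cisD x y : cis (x + y) = cis x * cis y.
Proof.
by apply: complexP; rewrite /= ?cosD ?sinD; ring.
Qed.

Definition ix x : R[i] := 0 +i* x.

(** Minus the integral of (1 - u) e^(i x u) over [0, 1]; this is the quotient of 1 - [avg_symbol x]
    by i x, continued through x = 0. *)
Definition symB x : R[i] := - wcos w1 x +i* - wsin w1 x.

(* Fourier multiplier of the forward average over [[0, 1]]. *)
Definition avg_symbol x : R[i] := (1 - x * wsin w1 x) +i* (x * wcos w1 x).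

Lemma one_sub_avg_symbol x : 1 - avg_symbol x = ix x * symB x.
Proof.
by apply: complexP => /=; ring.
Qed.

(** With y = x / 2 the centered average has symbol sin y / y, and 1 - sin y / y = y^2 [wcos w2 y]:
    centering removes the first-order term, so a factor (i x)^2 can be split off. *)
Definition symB2 x : R[i] := (- (4^-1 * wcos w2 (2^-1 * x)))%:C.

Lemma one_sub_centered_symbol x :
  1 - avg_symbol x * cis (- (2^-1 * x)) = ix x ^+ 2 * symB2 x.
Proof.
set y := 2^-1 * x; have xy : x = y + y by rewrite /y; field.
have E : y ^+ 2 * wcos w2 y = y * wsin w1 y by rewrite wsin1_wcos2; ring.
(* Real and imaginary parts of the claim that the centered average has the real symbol sin y / y,
   written as [1 - y * wsin w1 y] in order to include y = 0. *)
suff [r i] : (1 - x * wsin w1 x) * cos y + (x * wcos w1 x) * sin y = 1 - y * wsin w1 y /\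
    (x * wcos w1 x) * cos y - (1 - x * wsin w1 x) * sin y = 0.
  apply: complexP; rewrite /= cosN sinN -/y.
    have E2 : y * wsin w1 y = x * x / 4 * wcos w2 y by rewrite -E xy; field.
    by rewrite mulrN opprK r E2; field.
  transitivity (- (x * wcos w1 x * cos y - (1 - x * wsin w1 x) * sin y)); first by ring.
  by rewrite i; ring.
have [x0|x0] := eqVneq x 0.
  have y0 : y = 0 by rewrite /y x0 mulr0.
  by rewrite y0 x0 sin0 cos0; split; ring.
have y0 : y != 0 by apply: contra x0 => /eqP y0; rewrite xy y0 addr0.
have S := wsin1E x; have C := wcos1E x; have S' := wsin1E y.
have sx : sin x = sin y * cos y * 2 by rewrite xy sinD; ring.
have cx : cos x = 1 - 2 * sin y ^+ 2 by rewrite xy cosD -!expr2 cos2sin2; ring.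
have cy : cos y ^+ 2 = 1 - sin y ^+ 2 by rewrite cos2sin2.
have S1 : x * wsin w1 x = 1 - sin x / x.
  by apply: (mulfI x0); rewrite mulrA -expr2 S; field.
have C1 : x * wcos w1 x = (1 - cos x) / x.
  by apply: (mulfI x0); rewrite mulrA -expr2 C; field.
have S2 : y * wsin w1 y = 1 - sin y / y.
  by apply: (mulfI y0); rewrite mulrA -expr2 S'; field.
rewrite S1 C1 S2 sx cx; split.
  have -> : (1 - (1 - sin y * cos y * 2 / x)) * cos y =  sin y * cos y ^+ 2 * 2 / x by ring.
  by rewrite cy xy; field; rewrite -xy x0 y0.
by field.
Qed.

(** The symmetry makes the real part even and the imaginary part odd. This is what controls the
    boundary terms at frequency 0 when the kernel is summed by parts. *)
Definition symbol m : Prop :=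
  [/\ loc_C11 (fun x => complex.Re (m x)), loc_C11 (fun x => complex.Im (m x)) &
      forall x, m (- x) = conjc (m x)].

Lemma symbolM m1 m2 : symbol m1 -> symbol m2 -> symbol (fun x => m1 x * m2 x).
Proof.
move=> [r1 i1 c1] [r2 i2 c2]; split.
- have := loc_C11D (loc_C11M r1 r2) (loc_C11N (loc_C11M i1 i2)).
  by congr loc_C11; apply/funext => x; case: (m1 x) => ? ?; case: (m2 x).
- have := loc_C11D (loc_C11M r1 i2) (loc_C11M i1 r2).
  by congr loc_C11; apply/funext => x; case: (m1 x) => ? ?; case: (m2 x).
- by move=> x; rewrite c1 c2 rmorphM.
Qed.

Lemma symbol_real p : loc_C11 p -> (forall x, p (- x) = p x) -> symbol (fun x => (p x)%:C).
Proof.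
move=> hp ep; split => //=; first exact: loc_C11_cst.
by move=> x; rewrite ep; apply: complexP; rewrite /= ?oppr0.
Qed.

Lemma symbolX m k : symbol m -> symbol (fun x => m x ^+ k).
Proof.
move=> hm; elim: k => [|k IH].
  have := symbol_real (loc_C11_cst 1) (fun=> erefl).
  by congr symbol; apply/funext.
have := symbolM hm IH.
by congr symbol; apply/funext => x; rewrite exprS.
Qed.

Lemma symbolD m1 m2 : symbol m1 -> symbol m2 -> symbol (fun x => m1 x + m2 x).
Proof.
move=> [r1 i1 c1] [r2 i2 c2]; split.
- have := loc_C11D r1 r2.
  by congr loc_C11; apply/funext => x; case: (m1 x) => ? ?; case: (m2 x).
- have := loc_C11D i1 i2.
  by congr loc_C11; apply/funext => x; case: (m1 x) => ? ?; case: (m2 x).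
- by move=> x; rewrite c1 c2 rmorphD.
Qed.

Lemma symbolV m : symbol m -> (forall x, m x != 0) -> symbol (fun x => (m x)^-1).
Proof.
move=> [r i c] m0.
have n0 x : complex.Re (m x) * complex.Re (m x) + complex.Im (m x) * complex.Im (m x) != 0.
  by move: (m0 x); rewrite eq_complex/= -!expr2 paddr_eq0 ?sqr_ge0// !sqrf_eq0.
have hV := loc_C11V (loc_C11D (loc_C11M r r) (loc_C11M i i)) n0.
split.
- have := loc_C11M r hV.
  by congr loc_C11; apply/funext => x; case: (m x) => ? ?/=; rewrite -!expr2.
- have := loc_C11N (loc_C11M i hV).
  by congr loc_C11; apply/funext => x; case: (m x) => ? ?/=; rewrite -!expr2.
- by move=> x; rewrite c fmorphV.
Qed.

Lemma symbol_scale c m : symbol m -> symbol (fun x => m (c * x)).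
Proof.
move=> [r i e]; split; [exact: (loc_C11_scale c r)|exact: (loc_C11_scale c i)|].
by move=> x; rewrite mulrN e.
Qed.

Lemma symbol_ix : symbol ix.
Proof.
split; [exact: loc_C11_cst|exact: loc_C11_id|].
by move=> x; exact: complexP.
Qed.

Lemma symbol_B : symbol symB.
Proof.
split.
- by apply: loc_C11N; apply: wcos_C11; [exact: continuous_w1|exact: w1_le1].
- by apply: loc_C11N; apply: wsin_C11; [exact: continuous_w1|exact: w1_le1].
- by move=> x; apply: complexP; rewrite /= ?wcosN// wsinN//; exact: continuous_w1.
Qed.

Lemma symB_neq0 x : symB x != 0.
Proof.
have := w1_neq0 x; apply: contra; rewrite eq_complex/= !oppr_eq0 => /andP[/eqP-> /eqP->].
by rewrite expr0n/= addr0.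
Qed.

Lemma symbol_B2 : symbol symB2.
Proof.
apply: symbol_real => [|x]; last by rewrite mulrN wcosN.
apply: loc_C11N; apply: loc_C11Z; apply: (loc_C11_scale 2^-1).
by apply: wcos_C11; [exact: continuous_w2|exact: w2_le1].
Qed.

Definition sqpos x : R := Num.max x 0 ^+ 2.

Lemma sqpos_C11 : loc_C11 sqpos.
Proof.
move=> M; exists (`|M| ^+ 2 + 2 * `|M| + 2).
have M0 := normr_ge0 M; have M2 := sqr_ge0 `|M|.
have mx x : `|x| <= M -> 0 <= Num.max x 0 <= `|M|.
  move=> h; rewrite le_max lexx orbT/= ge_max M0 andbT.
  by rewrite (le_trans (ler_norm _))// (le_trans h)// ler_norm.
have mlip x y : `|Num.max x 0 - Num.max y 0| <= `|x - y|.
  rewrite ler_norml; apply/andP; split; case: (leP x 0) => ?; case: (leP y 0) => ?;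
  have := ler_norm (x - y); have := ler_norm (- (x - y)); have := normr_ge0 (x - y); rewrite normrN; lra.
split.
- move=> x /mx /andP[h0 h1]; rewrite ger0_norm ?sqr_ge0//.
  by have : sqpos x <= `|M| ^+ 2; [rewrite ler_sqr ?nnegrE|lra].
- move=> x y /mx /andP[h0 h1] /mx /andP[h2 h3]; rewrite /sqpos subr_sqr normrM mulrC.
  apply: ler_pM => //.
  by rewrite ger0_norm; lra.
- move=> x d _ _.
  have H : `|sqpos (x + d) - 2 * sqpos x + sqpos (x - d)| <= 2 * d ^+ 2.
    rewrite /sqpos ler_norml; apply/andP; split;
    case: (leP (x + d) 0) => ?; case: (leP x 0) => ?; case: (leP (x - d) 0) => ?; nra.
  by rewrite (le_trans H)// ler_wpM2r ?sqr_ge0//; lra.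
Qed.

(** The quadratic spline that rises from 0 to 1 with second derivative 4 on (0, 1/2), -4 on (1/2, 1)
    and 0 elsewhere. *)
Definition ramp x : R := 2 * sqpos x - 4 * sqpos (x - 2^-1) + 2 * sqpos (x - 1).

Lemma ramp0 x : x <= 0 -> ramp x = 0.
Proof. by move=> x0; rewrite /ramp /sqpos !max_r; [ring|lra..]. Qed.

Lemma ramp1 x : 1 <= x -> ramp x = 1.
Proof. by move=> x1; rewrite /ramp /sqpos !max_l; [field|lra..]. Qed.

Definition cutoff x : R := ramp (2 - x) * ramp (2 + x).

Lemma cutoff1 x : `|x| <= 1 -> cutoff x = 1.
Proof. by rewrite ler_norml => /andP[? ?]; rewrite /cutoff !ramp1 ?mulr1//; lra. Qed.

Lemma cutoff0 x : 2 <= `|x| -> cutoff x = 0.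
Proof.
rewrite ler_normr => /orP[h|h]; first by rewrite /cutoff ramp0 ?mul0r//; lra.
by rewrite /cutoff mulrC ramp0 ?mul0r//; lra.
Qed.

Lemma cutoffN x : cutoff (- x) = cutoff x.
Proof. by rewrite /cutoff opprK mulrC. Qed.

Lemma ramp_C11 : loc_C11 ramp.
Proof.
have h c := loc_C11_comp_affine 1 c sqpos_C11.
have := loc_C11D (loc_C11D (loc_C11Z 2 sqpos_C11) (loc_C11Z (-4) (h (- 2^-1)))) (loc_C11Z 2 (h (- 1))).
by congr loc_C11; apply/funext => x; rewrite /ramp !mul1r mulNr.
Qed.

Lemma symbol_cutoff : symbol (fun x => (cutoff x)%:C).
Proof.
apply: symbol_real; last exact: cutoffN.
have := loc_C11M (loc_C11_comp_affine (-1) 2 ramp_C11) (loc_C11_comp_affine 1 2 ramp_C11).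
by congr loc_C11; apply/funext => x; rewrite /cutoff mulN1r mul1r (addrC _ 2) (addrC x).
Qed.

(* Equal to [ix] away from the origin, but nowhere zero. *)
Definition ix_away x : R[i] := ix x + (cutoff (4 * x))%:C.

Lemma ix_away_neq0 x : ix_away x != 0.
Proof.
rewrite eq_complex/= add0r addr0; apply/negP => /andP[c0 /eqP x0].
by move: c0; rewrite x0 cutoff1 ?oner_eq0// mulr0 normr0.
Qed.

Lemma ix_awayE x : 2^-1 <= `|x| -> ix_away x = ix x.
Proof.
by move=> h; rewrite /ix_away cutoff0 ?addr0// normrM ger0_norm//; lra.
Qed.

Lemma symbol_ix_away : symbol ix_away.
Proof. by apply: symbolD; [exact: symbol_ix|exact: (symbol_scale 4 symbol_cutoff)]. Qed.

End symbols.

(** * Fourier coefficients in one-sided real form, and the action of averages on them *)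

Section fourier_coefficients.
Context {R : realType}.
Implicit Types (p q : R -> R) (c : nat -> R[i]) (h x t : R) (j J : nat).

(** For c j = a - i b the j-th term is a cos (j x) + b sin (j x). The real function has one complex
    coefficient per frequency, which a multiplier simply multiplies. *)
Definition trig c J x : R := \sum_(j < J.+1) complex.Re (c j * cis (j%:R * x)).

Definition fweight j : R := if j == 0%N then (2 * pi)^-1 else pi^-1.

Definition fcos p j : R := itg (- pi) pi (fun t => p t * cos (j%:R * t)).
Definition fsin p j : R := itg (- pi) pi (fun t => p t * sin (j%:R * t)).

(* Normalized so that [p] is formally [trig (fourier p) oo]. *)
Definition fourier p j : R[i] :=
  (fweight j * fcos p j) +i* - (fweight j * fsin p j).

Lemma cosn_periodic j x : cos (j%:R * (x + 2 * pi)) = cos (j%:R * x) :> R.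
Proof.
rewrite mulrDr (_ : j%:R * (2 * pi) = (pi *+ 2) *+ j); last first.
  by rewrite -[in RHS]mulr_natl -[pi *+ 2]mulr_natl.
by rewrite (periodicn (@cosD2pi R)).
Qed.

Lemma sinn_periodic j x : sin (j%:R * (x + 2 * pi)) = sin (j%:R * x) :> R.
Proof.
rewrite mulrDr (_ : j%:R * (2 * pi) = (pi *+ 2) *+ j); last first.
  by rewrite -[in RHS]mulr_natl -[pi *+ 2]mulr_natl.
by rewrite (periodicn (@sinD2pi R)).
Qed.

Lemma pint_cosM p j : pint p -> pint (fun t => p t * cos (j%:R * t)).
Proof.
move=> ip; apply: (@pintM _ _ _ 1) => //.
- by apply: continuous_measurable_fun; exact: continuous_cosZ.
- exact: cosn_periodic.
- by move=> x; exact: cos_max.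
Qed.

Lemma pint_sinM p j : pint p -> pint (fun t => p t * sin (j%:R * t)).
Proof.
move=> ip; apply: (@pintM _ _ _ 1) => //.
- by apply: continuous_measurable_fun; exact: continuous_sinZ.
- exact: sinn_periodic.
- by move=> x; exact: sin_max.
Qed.

Lemma pint_cst (a : R) : pint (fun=> a).
Proof. by apply: (@pint_bounded _ _ `|a|). Qed.

Lemma pint_cos j : pint (fun t : R => cos (j%:R * t)).
Proof.
by have := pint_cosM j (pint_cst 1); congr pint; apply/funext => t; rewrite mul1r.
Qed.

Lemma pint_sin j : pint (fun t : R => sin (j%:R * t)).
Proof.
by have := pint_sinM j (pint_cst 1); congr pint; apply/funext => t; rewrite mul1r.
Qed.

Lemma pint_cis (a : R[i]) j : pint (fun t : R => complex.Re (a * cis (j%:R * t))).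
Proof.
case: a => a b.
exact: (pintB (pintZ a (pint_cos j)) (pintZ b (pint_sin j))).
Qed.

Lemma pint_sum (F : nat -> R -> R) n : (forall j, pint (F j)) ->
  pint (fun t => \sum_(j < n) F j t).
Proof.
move=> hF; elim: n => [|n IH].
  have := pint_cst 0; congr pint; apply/funext => t; by rewrite big_ord0.
have := pintD IH (hF n); congr pint; apply/funext => t; by rewrite big_ord_recr.
Qed.

Lemma itg_sum (F : nat -> R -> R) n a b : (forall j, pint (F j)) -> a <= b ->
  itg a b (fun t => \sum_(j < n) F j t) = \sum_(j < n) itg a b (F j).
Proof.
move=> hF ab; elim: n => [|n IH].
  rewrite big_ord0 -[RHS](mul0r (b - a)) -itg_cst//.
  by apply: eq_itg => t _; rewrite big_ord0.
rewrite big_ord_recr /= -IH -itgD//; last exact: pint_sum.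
by apply: eq_itg => t _; rewrite big_ord_recr.
Qed.

Lemma pint_trig c J : pint (trig c J).
Proof. by apply: (pint_sum (F := fun j t => complex.Re (c j * cis (j%:R * t)))) => j; exact: pint_cis. Qed.

Lemma pipi_le : - pi <= pi :> R.
Proof. by have := @pi_ge0 R; lra. Qed.

Lemma fourierB p q j : pint p -> pint q ->
  fourier (fun x => p x - q x) j = fourier p j - fourier q j.
Proof.
move=> ip iq; rewrite /fourier /fcos /fsin.
have -> : itg (- pi) pi (fun t => (p t - q t) * cos (j%:R * t)) = fcos p j - fcos q j.
  rewrite -itgB; [|exact: pint_cosM..].
  by apply: eq_itg => t _; rewrite mulrBl.
have -> : itg (- pi) pi (fun t => (p t - q t) * sin (j%:R * t)) = fsin p j - fsin q j.
  rewrite -itgB; [|exact: pint_sinM..].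
  by apply: eq_itg => t _; rewrite mulrBl.
by apply: complexP; rewrite /= /fcos /fsin; ring.
Qed.

Lemma itg_trans_period p t : pint p ->
  itg (- pi) pi (fun x => p (x + t)) = itg (- pi) pi p.
Proof.
move=> ip; have [mp _ _] := ip.
have [-> _] := itg_addr mp (pint_integrable (- pi + t) (pi + t) ip).
have := itg_period (- pi + t) (- pi) ip.
by rewrite (_ : - pi + t + 2 * pi = pi + t) 1?(_ : - pi + 2 * pi = pi)//; ring.
Qed.

(** Fubini moves the average from p to the test function: for each t, a shift by t over a full
    period replaces p (x + t) e x by p x e (x - t). *)
Lemma adot_moment h p (e : R -> R) : 0 < h -> pint p -> measurable_fun setT e ->
  (forall x, e (x + 2 * pi) = e x) -> (forall x, `|e x| <= 1) ->
  itg (- pi) pi (fun x => adot h p x * e x) =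
  h^-1 * itg 0 h (fun t => itg (- pi) pi (fun x => p x * e (x - t))).
Proof.
move=> h0 ip me pe e1.
transitivity (h^-1 * itg (- pi) pi (fun x => itg 0 h (fun t => p (x + t)) * e x)).
  rewrite -itgZ.
    by apply: eq_itg => t _; rewrite /adot itg_shift0// mulrA.
  have := pintZ h (pintM (pint_adot h0 ip) me pe e1); congr pint; apply/funext => x.
  by rewrite /adot itg_shift0// mulrA mulVKf ?gt_eqF.
rewrite (itg_Fubini _ _ _ ip me e1); apply: (congr1 (fun z => h^-1 * z)).
apply: eq_itg => t _.
have it : pint (fun x => p x * e (x - t)).
  apply: (pintM ip _ _ (fun x => e1 (x - t))) => [|x]; last by rewrite addrAC pe.
  by apply: measurableT_comp => //; exact: measurable_funD.
by rewrite -(itg_trans_period t it); apply: eq_itg => x _; rewrite addrK.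
Qed.

Lemma itg_trig1 h (a b : R) j : 0 < h ->
  itg 0 h (fun t => a * cos (j%:R * t) + b * sin (j%:R * t)) =
  h * (a * (1 - h * j%:R * wsin w1 (h * j%:R)) + b * (h * j%:R * wcos w1 (h * j%:R))).
Proof.
move=> h0; have [c s] := (@pint_cos j, @pint_sin j).
by rewrite itgD ?itgZ ?itg_cos0 ?itg_sin0 ?(ltW h0)//; [ring|exact: pintZ..].
Qed.

Lemma fcos_adot h p j : 0 < h -> pint p ->
  fcos (adot h p) j = (1 - h * j%:R * wsin w1 (h * j%:R)) * fcos p j
     + h * j%:R * wcos w1 (h * j%:R) * fsin p j.
Proof.
move=> h0 ip; have [i1 i2] := (pint_cosM j ip, pint_sinM j ip).
rewrite {1}/fcos adot_moment//; last 3 first.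
- by apply: continuous_measurable_fun; exact: continuous_cosZ.
- exact: cosn_periodic.
- by move=> x; exact: cos_max.
rewrite (_ : itg 0 h _ = itg 0 h (fun t => fcos p j * cos (j%:R * t) + fsin p j * sin (j%:R * t))).
  by rewrite itg_trig1// mulKf ?gt_eqF//; ring.
apply: eq_itg => t _; rewrite /fcos /fsin mulrC [X in _ = _ + X]mulrC -!itgZ// -itgD; [|exact: pintZ..].
by apply: eq_itg => x _; rewrite mulrBr cosB; ring.
Qed.

Lemma fsin_adot h p j : 0 < h -> pint p ->
  fsin (adot h p) j = (1 - h * j%:R * wsin w1 (h * j%:R)) * fsin p j
     - h * j%:R * wcos w1 (h * j%:R) * fcos p j.
Proof.
move=> h0 ip; have [i1 i2] := (pint_cosM j ip, pint_sinM j ip).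
rewrite {1}/fsin adot_moment//; last 3 first.
- by apply: continuous_measurable_fun; exact: continuous_sinZ.
- exact: sinn_periodic.
- by move=> x; exact: sin_max.
rewrite (_ : itg 0 h _ = itg 0 h (fun t => fsin p j * cos (j%:R * t) + - fcos p j * sin (j%:R * t))).
  by rewrite itg_trig1// mulKf ?gt_eqF//; ring.
apply: eq_itg => t _; rewrite /fcos /fsin mulNr mulrC [X in _ = _ - X]mulrC -!itgZ// -itgB; [|exact: pintZ..].
by apply: eq_itg => x _; rewrite mulrBr sinB; ring.
Qed.

Lemma fourier_adot h p j : 0 < h -> pint p ->
  fourier (adot h p) j = avg_symbol (h * j%:R) * fourier p j.
Proof.
move=> h0 ip; rewrite /fourier fcos_adot// fsin_adot//.
by apply: complexP => /=; ring.
Qed.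

Lemma adot_trig h c J x : 0 < h ->
  adot h (trig c J) x = trig (fun j => avg_symbol (h * j%:R) * c j) J x.
Proof.
move=> h0; rewrite /adot /trig.
rewrite (itg_sum (F := fun j t => complex.Re (c j * cis (j%:R * t)))); last 2 first.
- by move=> j; exact: pint_cis.
- by rewrite lerDl ltW.
rewrite mulr_sumr; apply: eq_bigr => j _.
rewrite itg_shift0; last exact: pint_cis.
case: (c j) => a b.
set A := a * cos (j%:R * x) - b * sin (j%:R * x).
set B := a * sin (j%:R * x) + b * cos (j%:R * x).
rewrite (_ : itg _ _ _ = itg 0 h (fun t => A * cos (j%:R * t) + - B * sin (j%:R * t))).
  by rewrite itg_trig1// mulKf ?gt_eqF// /A /B /=; ring.
by apply: eq_itg => t _; rewrite /= mulrDr cosD sinD /A /B; ring.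
Qed.

End fourier_coefficients.

(** * Orthogonality relations and recovery of coefficients *)

Section orthogonality.
Context {R : realType}.
Implicit Types (c : nat -> R[i]) (t : R) (j k J : nat).

Lemma sin_npi j : sin (j%:R * pi) = 0 :> R.
Proof.
elim: j => [|j IH]; first by rewrite mul0r sin0.
by rewrite -natr1 mulrDl mul1r sinDpi IH oppr0.
Qed.

Lemma itg_cos_period (k : R) : k != 0 -> sin (k * pi) = 0 ->
  itg (- pi) pi (fun t => cos (k * t)) = 0.
Proof.
move=> k0 s0.
have D t : is_derive t (1 : R) (fun t => k^-1 * sin (k * t)) (cos (k * t)).
  by apply: is_derive_eq; rewrite /GRing.scale/= /GRing.scale/=; field.
by rewrite (itg_FTC pipi_le D (@continuous_cosZ _ k)) mulrN sinN s0; ring.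
Qed.

Lemma itg_sin_period (k : R) : itg (- pi) pi (fun t => sin (k * t)) = 0.
Proof.
have [->|k0] := eqVneq k 0.
  rewrite -[RHS](mul0r (pi - - pi)) -(itg_cst _ pipi_le).
  by apply: eq_itg => t _; rewrite mul0r sin0.
have D t : is_derive t (1 : R) (fun t => - (k^-1 * cos (k * t))) (sin (k * t)).
  by apply: is_derive_eq; rewrite /GRing.scale/= /GRing.scale/=; field.
by rewrite (itg_FTC pipi_le D (@continuous_sinZ _ k)) mulrN cosN; ring.
Qed.

Lemma itg_cosB j k : itg (- pi) pi (fun t => cos ((j%:R - k%:R) * t)) =
  if j == k then 2 * pi else 0 :> R.
Proof.
case: eqP => [->|/eqP jk].
  rewrite subrr (_ : itg _ _ _ = itg (- pi) pi (fun=> 1)).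
    by rewrite (itg_cst _ pipi_le); ring.
  by apply: eq_itg => t _; rewrite mul0r cos0.
rewrite itg_cos_period//; first by rewrite subr_eq0 eqr_nat.
by rewrite mulrBl sinB !sin_npi; ring.
Qed.

Lemma itg_cosD j k : itg (- pi) pi (fun t => cos ((j%:R + k%:R) * t)) =
  if (j == 0)%N && (k == 0)%N then 2 * pi else 0 :> R.
Proof.
by rewrite -addn_eq0; have := itg_cosB (j + k) 0; rewrite subr0 natrD.
Qed.


Let ccos (a : R) : continuous (fun t => cos (a * t)). Proof. exact: continuous_cosZ. Qed.
Let csin (a : R) : continuous (fun t => sin (a * t)). Proof. exact: continuous_sinZ. Qed.

Lemma neq_and0 j k : j != k -> ~~ ((j == 0%N) && (k == 0%N)).
Proof. by apply: contra => /andP[/eqP-> /eqP->]. Qed.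

Lemma itg_cos_cos j k : itg (- pi) pi (fun t => cos (k%:R * t) * cos (j%:R * t)) =
  2^-1 * ((if j == k then 2 * pi else 0) + (if (j == 0)%N && (k == 0)%N then 2 * pi else 0)) :> R.
Proof.
rewrite -itg_cosB -itg_cosD -itgD_continuous// -itgZ_continuous; last exact: continuous_add.
by apply: eq_itg => t _; rewrite !(mulrDl, mulNr) cosB cosD; field.
Qed.

Lemma itg_sin_sin j k : itg (- pi) pi (fun t => sin (k%:R * t) * sin (j%:R * t)) =
  2^-1 * ((if j == k then 2 * pi else 0) - (if (j == 0)%N && (k == 0)%N then 2 * pi else 0)) :> R.
Proof.
rewrite -itg_cosB -itg_cosD -itgB_continuous// -itgZ_continuous; last exact: continuous_sub.
by apply: eq_itg => t _; rewrite !(mulrDl, mulNr) cosB cosD; field.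
Qed.

Lemma itg_sin_cos j k : itg (- pi) pi (fun t => sin (k%:R * t) * cos (j%:R * t)) = 0 :> R.
Proof.
have := itg_sin_period (j%:R + k%:R : R); have := itg_sin_period (j%:R - k%:R : R) => h1 h2.
transitivity (2^-1 * (itg (- pi) pi (fun t => sin ((j%:R + k%:R) * t)) -
    itg (- pi) pi (fun t => sin ((j%:R - k%:R) * t))) : R); last by rewrite h1 h2; ring.
rewrite -itgB_continuous// -itgZ_continuous; last exact: continuous_sub.
by apply: eq_itg => t _; rewrite !(mulrDl, mulNr) sinB sinD; field.
Qed.

Lemma fcos_cis (a : R[i]) j k : (k = 0%N -> complex.Im a = 0) ->
  fweight j * fcos (fun t => complex.Re (a * cis (k%:R * t))) j =
  if j == k then complex.Re a else 0.
Proof.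
case: a => a b /= b0.
have -> : fcos (fun t => a * cos (k%:R * t) - b * sin (k%:R * t)) j =
    a * itg (- pi) pi (fun t => cos (k%:R * t) * cos (j%:R * t)) -
    b * itg (- pi) pi (fun t => sin (k%:R * t) * cos (j%:R * t)).
  have [i1 i2] := (pint_cosM j (@pint_cos R k), pint_cosM j (@pint_sin R k)).
  rewrite -!itgZ// -itgB; [|exact: pintZ..].
  by apply: eq_itg => t _; ring.
rewrite itg_cos_cos itg_sin_cos /fweight.
have [<-|jk] := eqVneq j k; last by rewrite (negbTE (neq_and0 jk)); ring.
have : pi != 0 :> R by rewrite gt_eqF ?pi_gt0.
by move: (@pi R) => P P0; case: (j) => [|?] /=; field.
Qed.

Lemma fsin_cis (a : R[i]) j k : (k = 0%N -> complex.Im a = 0) ->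
  - (fweight j * fsin (fun t => complex.Re (a * cis (k%:R * t))) j) =
  if j == k then complex.Im a else 0.
Proof.
case: a => a b /= b0.
have -> : fsin (fun t => a * cos (k%:R * t) - b * sin (k%:R * t)) j =
    a * itg (- pi) pi (fun t => sin (j%:R * t) * cos (k%:R * t)) -
    b * itg (- pi) pi (fun t => sin (k%:R * t) * sin (j%:R * t)).
  have [i1 i2] := (pint_cosM k (@pint_sin R j), pint_sinM j (@pint_sin R k)).
  rewrite -!itgZ// -itgB; [|exact: pintZ..].
  by apply: eq_itg => t _; ring.
rewrite itg_sin_sin itg_sin_cos /fweight.
have [jk|jk] := eqVneq j k; last by rewrite (negbTE (neq_and0 jk)); ring.
subst k; have : pi != 0 :> R by rewrite gt_eqF ?pi_gt0.
move: (@pi R) => P P0.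
by case: j b0 => [/(_ erefl) ->|j _] /=; field.
Qed.

(** The imaginary part of [c 0] multiplies sin 0 and leaves no trace in the sum; coefficients are
    recovered only when it is 0. *)
Lemma fourier_trig c J j : complex.Im (c 0%N) = 0 ->
  fourier (trig c J) j = if (j <= J)%N then c j else 0.
Proof.
move=> c0.
have iF i : pint (fun t => complex.Re (c i * cis (i%:R * t))) by exact: pint_cis.
have fc : fcos (trig c J) j = \sum_(i < J.+1) fcos (fun t => complex.Re (c i * cis (i%:R * t))) j.
  rewrite /fcos -(itg_sum (F := fun i t => complex.Re (c i * cis (i%:R * t)) * cos (j%:R * t)))//.
  - by apply: eq_itg => t _; rewrite /trig mulr_suml.
  - by move=> i; exact: pint_cosM.
  - exact: pipi_le.
have fs : fsin (trig c J) j = \sum_(i < J.+1) fsin (fun t => complex.Re (c i * cis (i%:R * t))) j.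
  rewrite /fsin -(itg_sum (F := fun i t => complex.Re (c i * cis (i%:R * t)) * sin (j%:R * t)))//.
  - by apply: eq_itg => t _; rewrite /trig mulr_suml.
  - by move=> i; exact: pint_sinM.
  - exact: pipi_le.
have P (i : nat) : i = 0%N -> complex.Im (c i) = 0 by move=> ->.
have S (F : nat -> R) : \sum_(i < J.+1) (if j == i then F i else 0) = if (j <= J)%N then F j else 0.
  case: leqP => jJ.
    rewrite (bigD1 (Ordinal (jJ : (j < J.+1)%N)))//= eqxx big1 ?addr0// => i ij.
    by case: eqP => // e; move: ij; rewrite -val_eqE /= e eqxx.
  by rewrite big1// => i _; case: eqP => // e; move: (ltn_ord i); rewrite -e ltnS leqNgt jJ.
apply/eqP; rewrite eq_complex /fourier fc fs /= !mulr_sumr -sumrN.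
under eq_bigr do rewrite (fcos_cis _ (@P _)).
under [X in _ && (X == _)]eq_bigr do rewrite (fsin_cis _ (@P _)).
by rewrite (S (fun i => complex.Re (c i))) (S (fun i => complex.Im (c i))); case: ifP; rewrite !eqxx.
Qed.

End orthogonality.

(** * Multiplier kernels at scale 1/n: size n and decay 1/(n t^2) *)

Section multiplier_kernels.
Context {R : realType}.
Notation mu := (@lebesgue_measure R).
Implicit Types (p q : R -> R) (m : R -> R[i]) (c : nat -> R[i]) (h x y t : R) (j J n : nat).

(** The symbol is sampled at j / n, so n is the frequency scale. In the norm estimates J = L n with
    m vanishing beyond L, and the truncation loses nothing. *)
Definition mult m n J p : R -> R :=
  trig (fun j => m (j%:R / n%:R) * fourier p j) J.

Definition kernel m n J t : R :=
  \sum_(j < J.+1) fweight j * complex.Re (m (j%:R / n%:R) * cis (j%:R * t)).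

Lemma Re_cisB (a : R[i]) j y t : complex.Re (a * cis (j%:R * (y - t))) =
  complex.Re (a * cis (j%:R * y)) * cos (j%:R * t) +
  complex.Im (a * cis (j%:R * y)) * sin (j%:R * t).
Proof. by case: a => a b /=; rewrite mulrBr cosB sinB; ring. Qed.

Lemma pint_kernel m n J y : pint (fun t => kernel m n J (y - t)).
Proof.
apply: (pint_sum (F := fun j t => fweight j * complex.Re (m (j%:R / n%:R) * cis (j%:R * (y - t))))) => j.
apply: pintZ; set A := complex.Re (m (j%:R / n%:R) * cis (j%:R * y)).
set B := complex.Im (m (j%:R / n%:R) * cis (j%:R * y)).
have := pintD (pintZ A (pint_cos j)) (pintZ B (pint_sin j)).
by congr pint; apply/funext => t; rewrite Re_cisB.
Qed.

Lemma multE m n J p y : pint p ->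
  mult m n J p y = itg (- pi) pi (fun t => p t * kernel m n J (y - t)).
Proof.
move=> ip.
pose A j := complex.Re (m (j%:R / n%:R) * cis (j%:R * y)).
pose B j := complex.Im (m (j%:R / n%:R) * cis (j%:R * y)).
pose F j t := fweight j * A j * (p t * cos (j%:R * t)) + fweight j * B j * (p t * sin (j%:R * t)).
have iF j : pint (F j).
  by apply: pintD; apply: pintZ; [exact: pint_cosM|exact: pint_sinM].
transitivity (\sum_(j < J.+1) itg (- pi) pi (F j)).
  apply: eq_bigr => j _; rewrite itgD; last 2 first.
  - by apply: pintZ; exact: pint_cosM.
  - by apply: pintZ; exact: pint_sinM.
  rewrite itgZ; last exact: pint_cosM.
  rewrite itgZ; last exact: pint_sinM.
  rewrite /A /B /fourier -/(fcos p j) -/(fsin p j).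
  by case: (m _) => u v /=; ring.
rewrite -(itg_sum (F := F))//; last exact: pipi_le.
apply: eq_itg => t _; rewrite /kernel mulr_sumr; apply: eq_bigr => j _.
by rewrite Re_cisB /F -/(A j) -/(B j); ring.
Qed.

(* Two summations by parts; [f] will be [cos (j t)] or [sin (j t)]. *)
Lemma second_abel (p f : nat -> R) J t : (forall j, 2 * cos t * f j.+1 = f j.+2 + f j) ->
  (2 * cos t - 2) * \sum_(j < J) p j.+1 * f j.+1 =
  \sum_(j < J) (p j.+2 - 2 * p j.+1 + p j) * f j.+1 +
  p 1%N * f 0%N - p 0%N * f 1%N + p J * f J.+1 - p J.+1 * f J.
Proof.
move=> step; elim: J => [|J IH]; first by rewrite !big_ord0 mulr0; ring.
rewrite !big_ord_recr /= mulrDr IH.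
have -> : (2 * cos t - 2) * (p J.+1 * f J.+1) =
  p J.+1 * (2 * cos t * f J.+1) - 2 * p J.+1 * f J.+1 by ring.
by rewrite step; ring.
Qed.

Lemma cosn_rec j t : 2 * cos t * cos (j.+1%:R * t) = cos (j.+2%:R * t) + cos (j%:R * t) :> R.
Proof.
have -> : j.+2%:R * t = j.+1%:R * t + t by rewrite -[j.+2%:R]natr1 mulrDl mul1r.
have -> : j%:R * t = j.+1%:R * t - t by rewrite -[j.+1%:R]natr1 mulrDl mul1r addrK.
by rewrite cosD cosB; ring.
Qed.

Lemma sinn_rec j t : 2 * cos t * sin (j.+1%:R * t) = sin (j.+2%:R * t) + sin (j%:R * t) :> R.
Proof.
have -> : j.+2%:R * t = j.+1%:R * t + t by rewrite -[j.+2%:R]natr1 mulrDl mul1r.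
have -> : j%:R * t = j.+1%:R * t - t by rewrite -[j.+1%:R]natr1 mulrDl mul1r addrK.
by rewrite sinD sinB; ring.
Qed.

Lemma sum_bound (F : nat -> R) J (B : R) : (forall j, (j < J)%N -> `|F j| <= B) ->
  `|\sum_(j < J) F j| <= J%:R * B.
Proof.
move=> FB; rewrite (le_trans (ler_norm_sum _ _ _))//.
have -> : J%:R * B = \sum_(j < J) B by rewrite sumr_const card_ord mulr_natl.
by apply: ler_sum => j _; exact: FB.
Qed.

Lemma kernelE m n J t : 2 * pi * kernel m n J t =
  (complex.Re (m 0) + 2 * \sum_(j < J) complex.Re (m (j.+1%:R / n%:R)) * cos (j.+1%:R * t)) -
  2 * \sum_(j < J) complex.Im (m (j.+1%:R / n%:R)) * sin (j.+1%:R * t).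
Proof.
have pin : pi != 0 :> R by rewrite gt_eqF ?pi_gt0.
rewrite /kernel big_ord_recl /= mul0r /fweight/= mul0r.
rewrite mulrDr mulrA mulfV ?mul1r ?mulf_neq0// -addrA; congr (_ + _).
  by case: (m 0) => a b /=; rewrite cos0 sin0; ring.
rewrite -mulrBr -sumrB -mulrA mulr_sumr; congr (_ * _); apply: eq_bigr => j _.
rewrite /bump/= add1n mulrA mulfV// mul1r.
by case: (m _) => a b.
Qed.

Lemma node_differences (f : R -> R) (L : nat) : loc_C11 f -> exists2 C : R, 0 < C &
  forall n, (0 < n)%N ->
  [/\ forall j, (j <= L * n)%N -> `|f (j%:R / n%:R)| <= C,
      forall j, (j < L * n)%N ->
        `|f (j.+2%:R / n%:R) - 2 * f (j.+1%:R / n%:R) + f (j%:R / n%:R)| <= C / n%:R ^+ 2 &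
      `|f n%:R^-1 - 2 * f 0 + f (- n%:R^-1)| <= C / n%:R ^+ 2].
Proof.
(* Radius L + 1, because the differences centered at 0 and at L reach 1 / n <= 1 beyond the ends. *)
move=> hf; have [C C0 [a1 _ a3]] := loc_C11_pos (L%:R + 1) hf.
exists C => // n n0; have n0R : 0 < n%:R :> R by rewrite ltr0n.
have d1 : n%:R^-1 <= 1 :> R by rewrite invf_le1// ler1n.
have d0 : 0 <= n%:R^-1 :> R by rewrite invr_ge0 ltW.
have L1 : 0 <= L%:R :> R by [].
have nodeJ j : (j <= L * n)%N -> 0 <= (j%:R / n%:R : R) <= L%:R.
  by move=> jJ; rewrite divr_ge0//= ler_pdivrMr// -natrM ler_nat.
have succE j : j.+1%:R / n%:R = j%:R / n%:R + n%:R^-1 :> R.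
  by rewrite -natr1 mulrDl mul1r.
have nb y : - 1 <= y <= L%:R + 1 -> `|y| <= L%:R + 1.
  by move=> /andP[? ?]; rewrite ler_norml; apply/andP; split; lra.
split.
- by move=> j /nodeJ/andP[h1 h2]; apply/a1/nb/andP; split; lra.
- move=> j /nodeJ/andP[h1 h2]; rewrite -exprVn [j.+2%:R / _]succE.
  rewrite (_ : j%:R / n%:R = j.+1%:R / n%:R - n%:R^-1); last by rewrite succE addrK.
  by apply: a3; apply/nb/andP; split; lra.
- rewrite -exprVn -[X in f X - _]add0r -[X in _ + f X]sub0r.
  by apply: a3; apply/nb/andP; split; lra.
Qed.

(** The size bound counts terms. For the decay, the factor 2 - 2 cos t exchanges the coefficients
    for their second differences, which are J in number and of order 1 / n^2 each, with J = L n. *)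
Lemma kernel_bound m (L : nat) : symbol m -> (0 < L)%N ->
  (forall x, L%:R <= x -> m x = 0) ->
  exists2 C : R, 0 < C & forall n t, (0 < n)%N ->
    `|kernel m n (L * n) t| <= C * n%:R /\
    (2 - 2 * cos t) * `|kernel m n (L * n) t| <= C / n%:R.
Proof.
move=> [rm im cm] L0 m0.
have [C1 C10 H1] := node_differences L rm; have [C2 C20 H2] := node_differences L im.
pose C := C1 + C2; have C0 : 0 < C by rewrite addr_gt0.
(* Five contributions of equal size: the term at frequency 0, and the cosine and sine sums counted
   twice each. *)
exists (5 * L%:R * C); first by rewrite !mulr_gt0// ltr0n.
move=> n t n0; set J := (L * n)%N.
have n0R : 0 < n%:R :> R by rewrite ltr0n.
have J1 : 1 <= J%:R :> R by rewrite ler1n muln_gt0 L0.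
pose p j := complex.Re (m (j%:R / n%:R)); pose q j := complex.Im (m (j%:R / n%:R)).
have big_ j : (J <= j)%N -> m (j%:R / n%:R) = 0.
  by move=> jJ; apply: m0; rewrite ler_pdivlMr// -natrM ler_nat.
have [p1' p3' p0'] := H1 n n0; have [q1' q3' _] := H2 n n0.
have CC1 (a : R) : `|a| <= C1 / n%:R ^+ 2 -> `|a| <= C / n%:R ^+ 2.
  by move=> /le_trans; apply; rewrite ler_wpM2r ?invr_ge0 ?sqr_ge0// lerDl ltW.
have CC2 (a : R) : `|a| <= C2 / n%:R ^+ 2 -> `|a| <= C / n%:R ^+ 2.
  by move=> /le_trans; apply; rewrite ler_wpM2r ?invr_ge0 ?sqr_ge0// lerDr ltW.
have p1 j : (j <= J)%N -> `|p j| <= C.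
  by move=> /p1' /le_trans; apply; rewrite lerDl ltW.
have q1 j : (j <= J)%N -> `|q j| <= C.
  by move=> /q1' /le_trans; apply; rewrite lerDr ltW.
have p3 j : (j < J)%N -> `|p j.+2 - 2 * p j.+1 + p j| <= C / n%:R ^+ 2.
  by move=> /p3'/CC1.
have q3 j : (j < J)%N -> `|q j.+2 - 2 * q j.+1 + q j| <= C / n%:R ^+ 2.
  by move=> /q3'/CC2.
have q0 : q 0%N = 0.
  rewrite /q mul0r; have := cm 0; rewrite oppr0.
  by case: (m 0) => u v /eqP; rewrite eq_complex /= eqxx /= => /eqP h; lra.
(* The real part is even, so the second difference centered at 0 is 2 (p 1 - p 0). This boundary
   term is therefore of order 1 / n^2, where a Lipschitz bound would only give 1 / n. *)
have p00 : `|2 * (p 1%N - p 0%N)| <= C / n%:R ^+ 2.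
  apply: CC1; move: p0'; rewrite cm /p mul1r mul0r.
  by congr (`|_| <= _); case: (m n%:R^-1) => u v /=; ring.
have pJ : p J = 0 by rewrite /p big_.
have pJ1 : p J.+1 = 0 by rewrite /p big_.
have qJ : q J = 0 by rewrite /q big_.
have qJ1 : q J.+1 = 0 by rewrite /q big_.
have E : 2 * pi * kernel m n J t =
    (p 0%N + 2 * \sum_(j < J) p j.+1 * cos (j.+1%:R * t)) -
     2 * \sum_(j < J) q j.+1 * sin (j.+1%:R * t).
  by rewrite kernelE /p /q mul0r.
have pi1 : 1 <= 2 * pi :> R by have := @pi_ge2 R; lra.
have kpi (K : R) : `|2 * pi * kernel m n J t| <= K -> `|kernel m n J t| <= K.
  apply: le_trans; rewrite normrM ler_peMl// ger0_norm//; lra.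
have JL : 5 * J%:R = 5 * L%:R * n%:R :> R by rewrite /J natrM mulrA.
have c0' : 0 <= 2 - 2 * cos t by have := cos_le1 t; lra.
have C0' := ltW C0.
have trig_le (u v B : R) : `|u| <= B -> `|v| <= 1 -> `|u * v| <= B.
  by move=> hu hv; rewrite normrM -[B]mulr1 ler_pM.
split.
  apply: kpi; rewrite E.
  have s1 : `|\sum_(j < J) p j.+1 * cos (j.+1%:R * t)| <= J%:R * C.
    apply: (sum_bound (F := fun j => p j.+1 * cos (j.+1%:R * t))) => j jJ.
    by apply: trig_le; [exact: p1|exact: cos_max].
  have s2 : `|\sum_(j < J) q j.+1 * sin (j.+1%:R * t)| <= J%:R * C.
    apply: (sum_bound (F := fun j => q j.+1 * sin (j.+1%:R * t))) => j jJ.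
    by apply: trig_le; [exact: q1|exact: sin_max].
  have s0 : `|p 0%N| <= J%:R * C.
    by rewrite (le_trans (p1 0%N _))// ler_peMl.
  rewrite mulrAC -JL -mulrA; move: s0 s1 s2; move: (p 0%N) (\sum_(j < J) _) (\sum_(j < J) _) (J%:R * C) => u v w K.
  clear; rewrite !ler_norml => /andP[? ?] /andP[? ?] /andP[? ?]; apply/andP; split; lra.
rewrite -[X in X * _]ger0_norm// -normrM; apply: (@le_trans _ _ `|2 * pi * ((2 - 2 * cos t) * kernel m n J t)|).
  by rewrite [leRHS]normrM ler_peMl// ger0_norm//; lra.
have -> : 2 * pi * ((2 - 2 * cos t) * kernel m n J t) = - ((2 * cos t - 2) * (2 * pi * kernel m n J t)) by ring.
have -> : (2 * cos t - 2) * (2 * pi * kernel m n J t) = (2 * cos t - 2) * p 0%N +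
    2 * ((2 * cos t - 2) * \sum_(j < J) p j.+1 * cos (j.+1%:R * t)) -
    2 * ((2 * cos t - 2) * \sum_(j < J) q j.+1 * sin (j.+1%:R * t)) by rewrite E; ring.
rewrite normrN (second_abel (f := fun j => cos (j%:R * t)) p J (fun j => cosn_rec j t)).
rewrite (second_abel (f := fun j => sin (j%:R * t)) q J (fun j => sinn_rec j t)).
rewrite pJ pJ1 qJ qJ1 q0 !mul0r cos0 sin0 mul1r.
set S1 := \sum_(j < J) _; set S2 := \sum_(j < J) _.
rewrite (_ : _ - _ = 2 * (p 1%N - p 0%N) + 2 * S1 - 2 * S2); last by ring.
rewrite {}/S1 {}/S2.
have s1 : `|\sum_(j < J) (p j.+2 - 2 * p j.+1 + p j) * cos (j.+1%:R * t)| <= J%:R * (C / n%:R ^+ 2).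
  apply: (sum_bound (F := fun j => (p j.+2 - 2 * p j.+1 + p j) * cos (j.+1%:R * t))) => j jJ.
  by apply: trig_le; [exact: p3|exact: cos_max].
have s2 : `|\sum_(j < J) (q j.+2 - 2 * q j.+1 + q j) * sin (j.+1%:R * t)| <= J%:R * (C / n%:R ^+ 2).
  apply: (sum_bound (F := fun j => (q j.+2 - 2 * q j.+1 + q j) * sin (j.+1%:R * t))) => j jJ.
  by apply: trig_le; [exact: q3|exact: sin_max].
have s0 : `|2 * (p 1%N - p 0%N)| <= J%:R * (C / n%:R ^+ 2).
  by rewrite (le_trans p00)// ler_peMl// divr_ge0 ?sqr_ge0.
have -> : 5 * L%:R * C / n%:R = 5 * (J%:R * (C / n%:R ^+ 2)).
  by rewrite mulrA JL; field; rewrite gt_eqF.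
move: s0 s1 s2; move: (2 * (p 1%N - p 0%N)) (\sum_(j < J) _) (\sum_(j < J) _) (J%:R * (C / _)) => u v w K.
clear; rewrite !ler_norml => /andP[? ?] /andP[? ?] /andP[? ?].
by apply/andP; split; lra.
Qed.

Lemma sin_ge01 y : 0 <= y <= 1 -> cos 1 * y <= sin y.
Proof.
move=> /andP[y0 y1].
have D x : is_derive x (1 : R) (fun x : R => sin x) (cos x) by apply: is_derive_eq.
rewrite -[leRHS]subr0 -sin0 -(itg_FTC y0 D (@continuous_cos R)) -[y in leLHS]subr0 -(itg_cst _ y0).
apply: itg_le_continuous => [x||x /andP[x0 xy]]; first exact: cst_continuous.
  exact: continuous_cos.
have p2 := @pi_ge2 R.
rewrite leNgt ltr_cos ?in_itv/= -?leNgt; last 2 first.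
- by apply/andP; split; lra.
- by apply/andP; split; lra.
lra.
Qed.

(** Since 2 - 2 cos t = (2 sin (t / 2))^2, a weak Jordan inequality is enough: sin y >= y cos 1 on
    [0, 1] by integrating the cosine, and beyond 1 the sine still increases up to pi / 2 < 2. *)
Lemma cos_le_sqr t : `|t| <= pi -> (cos 1 * t / 2) ^+ 2 <= 2 - 2 * cos t :> R.
Proof.
wlog t0 : t / 0 <= t.
  move=> H tpi; have [/H/(_ tpi)//|/ltW] := leP 0 t; rewrite -oppr_ge0 => /H.
  by rewrite normrN cosN mulrN mulNr sqrrN; exact.
rewrite ger0_norm// => tpi; have p2 := @pihalf_lt2 R; have c1 := @cos1_gt0 R.
have S : cos 1 * (t / 2) / 2 <= sin (t / 2).
  have [h|h] := leP (t / 2) 1.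
    have := @sin_ge01 (t / 2); rewrite h divr_ge0// => /(_ isT) s.
    have : 0 <= cos 1 * (t / 2) by rewrite mulr_ge0 ?divr_ge0// ltW.
    lra.
  have s1 : cos 1 <= sin (1 : R) by have := @sin_ge01 1; rewrite lexx ler01 mulr1; exact.
  have s2 : sin (1 : R) <= sin (t / 2).
    apply: ltW; rewrite ltr_sin// in_itv/=; apply/andP; split; lra.
  rewrite (le_trans _ (le_trans s1 s2))// -mulrA ler_piMr ?ltW//; lra.
have -> : 2 - 2 * cos t = (2 * sin (t / 2)) ^+ 2.
  by rewrite (_ : t = t / 2 + t / 2) 1?cosD; [rewrite -!expr2 cos2sin2 (_ : (t / 2 + t / 2) / 2 = t / 2); [ring|field]|field].
rewrite ler_sqr ?nnegrE; first lra.
- by rewrite !mulr_ge0// ltW.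
- rewrite mulr_ge0// (le_trans _ S)// !mulr_ge0// ltW//.
Qed.

End multiplier_kernels.

(** * Pointwise domination of multipliers by dyadic averages *)

Section dyadic_majorant.
Context {R : realType}.
Notation mu := (@lebesgue_measure R).
Implicit Types (p : R -> R) (m : R -> R[i]) (h x y t a b c d : R) (i j k n : nat).

Definition box a b : R -> R := \1_`[a, b]%classic.

Lemma boxE a b t : box a b t = ((a <= t) && (t <= b))%R%:R.
Proof. by rewrite /box indicE; congr (nat_of_bool _)%:R; apply/idP/idP; rewrite inE/= in_itv. Qed.

Lemma box_integrable p a b c d : pint p ->
  mu.-integrable `[a, b] (EFin \o (fun t => p t * box c d t)).
Proof.
move=> ip; have I := pint_integrable a b ip.
have := (fun H => @integrableMl _ _ _ mu `[a, b]%classic H _ (box c d) I) => /(_ (measurable_itv _)).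
apply; first by apply: measurable_funTS; exact: measurable_indic.
exists 1; split; first exact: num_real.
move=> M M1 x _ /=; rewrite boxE; case: (_ && _); rewrite ?normr1 ?normr0; first exact: ltW.
by rewrite ltW// (lt_trans ltr01).
Qed.

Lemma itg_box_le p a b c d : pint p -> (forall t, 0 <= p t) ->
  itg a b (fun t => p t * box c d t) <= itg c d p.
Proof.
move=> ip p0; have I := pint_integrable c d ip; have [mp _ _] := ip.
have S : `[a, b] `&` `[c, d] `<=` (`[c, d]%classic : set R) by move=> t [].
have mS : measurable (`[a, b] `&` `[c, d] : set (measurableTypeR R)) by exact: measurableI.
have I' : mu.-integrable (`[a, b] `&` `[c, d]) (EFin \o p) by apply: integrableS I.
rewrite /itg (_ : Rintegral _ _ _ = \int[mu]_(t in `[a, b] `&` `[c, d]) p t).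
  apply: fine_le; [exact: integrable_fin_num|exact: integrable_fin_num|].
  apply: ge0_subset_integral => //.
    by apply/measurable_EFinP; exact: measurable_funTS.
by move=> t _; rewrite lee_fin.
rewrite Rintegral_mkcondr; apply: eq_Rintegral => t _.
rewrite patchE /box indicE; case: (_ \in _); by rewrite ?mulr1 ?mulr0.
Qed.

Lemma itg_boxes p a b (I : nat) (u v w : nat -> R) : pint p ->
  mu.-integrable `[a, b] (EFin \o (fun t => \sum_(j < I) w j * (p t * box (u j) (v j) t))) /\
  itg a b (fun t => \sum_(j < I) w j * (p t * box (u j) (v j) t)) =
    \sum_(j < I) w j * itg a b (fun t => p t * box (u j) (v j) t).
Proof.
move=> ip; elim: I => [|I [IH1 IH2]].
  rewrite big_ord0; split.
    have := pint_integrable a b (pint_cst 0); apply: eq_integrable => // t _ /=.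
    by rewrite big_ord0.
  rewrite /itg (_ : (fun t => _) = fun=> 0); last by apply/funext => t; rewrite big_ord0.
  by rewrite /Rintegral integral0.
have B := box_integrable a b (u I) (v I) ip.
have wB : mu.-integrable `[a, b] (EFin \o (fun t => w I * (p t * box (u I) (v I) t))).
  exact: (integrableZl _ (w I) B).
have E : (fun t => \sum_(j < I.+1) w j * (p t * box (u j) (v j) t)) =
   fun t => \sum_(j < I) w j * (p t * box (u j) (v j) t) + w I * (p t * box (u I) (v I) t).
  by apply/funext => t; rewrite big_ord_recr.
rewrite E; split.
  exact: (integrableD _ IH1 wB).
by rewrite big_ord_recr /= -IH2 /itg RintegralD// RintegralZl.
Qed.

Lemma itg_le_boxes p f a b (I : nat) (u v w : nat -> R) :
  pint p -> pint f -> (forall t, 0 <= p t) -> (forall j, 0 <= w j) ->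
  (forall t, a <= t <= b -> f t <= \sum_(j < I) w j * (p t * box (u j) (v j) t)) ->
  itg a b f <= \sum_(j < I) w j * itg (u j) (v j) p.
Proof.
move=> ip jf p0 w0 le_f; have [B1 B2] := itg_boxes a b I u v w ip.
apply: (@le_trans _ _ (itg a b (fun t => \sum_(j < I) w j * (p t * box (u j) (v j) t)))).
  apply: le_Rintegral => //; first exact: pint_integrable.
rewrite B2; apply: ler_sum => j _; apply: ler_wpM2l => //; exact: itg_box_le.
Qed.

(** Only the term of the least i with |t| <= 2^i / n is kept. If i > 0 then |t| > 2^(i-1) / n, and
    the decay gives k <= C n / 4^(i-1); this index shift is the factor 4. *)
Lemma dyadic_bound (C k t : R) n I : 0 < C -> (0 < n)%N -> k <= C * n%:R ->
  t ^+ 2 * k <= C / n%:R -> `|t| <= 2 ^+ I / n%:R ->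
  k <= \sum_(j < I.+1) 4 * C * n%:R / 4 ^+ j * (`|t| <= 2 ^+ j / n%:R)%R%:R.
Proof.
move=> C0 n0 k1 k2 tI; have n0R : 0 < n%:R :> R by rewrite ltr0n.
have /ex_minnP[i ti imin] : exists i, `|t| <= 2 ^+ i / n%:R by exists I.
have iI : (i < I.+1)%N by rewrite ltnS imin.
rewrite (bigD1 (Ordinal iI))//= ti mulr1.
have S0 : 0 <= \sum_(j < I.+1 | j != Ordinal iI) 4 * C * n%:R / 4 ^+ j * (`|t| <= 2 ^+ j / n%:R)%R%:R.
  by apply: sumr_ge0 => j _; rewrite !mulr_ge0 ?invr_ge0 ?exprn_ge0// ltW.
suff H : k <= 4 * C * n%:R / 4 ^+ i by rewrite (le_trans H)// lerDl.
case: i ti imin iI S0 => [|i] ti imin iI _.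
  have : 0 <= C * n%:R by rewrite mulr_ge0 ?ltW.
  rewrite expr0 divr1; lra.
have [k0|k0] := leP k 0.
  by rewrite (le_trans k0)// !mulr_ge0 ?invr_ge0 ?exprn_ge0// ltW.
have ti' : 2 ^+ i / n%:R < `|t| by rewrite ltNge; apply/negP => /imin; rewrite ltnn.
have t2 : 4 ^+ i / n%:R ^+ 2 <= t ^+ 2.
  rewrite -[t ^+ 2]real_normK ?num_real// (_ : 4 ^+ i / _ = (2 ^+ i / n%:R) ^+ 2).
    by rewrite ler_sqr ?nnegrE ?divr_ge0 ?exprn_ge0// ltW.
  by rewrite expr_div_n -exprM mulnC exprM; congr (_ ^+ _ / _); ring.
have : 4 ^+ i / n%:R ^+ 2 * k <= C / n%:R.
  by rewrite (le_trans _ k2)// ler_wpM2r// ltW.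
have n2 : 0 < n%:R ^+ 2 / 4 ^+ i :> R by rewrite divr_gt0 ?exprn_gt0.
rewrite -(ler_pM2l n2) => H; rewrite exprS.
have f0 : (4 : R) ^+ i != 0 by rewrite expf_neq0.
have -> : k = n%:R ^+ 2 / 4 ^+ i * (4 ^+ i / n%:R ^+ 2 * k).
  by field; rewrite f0 gt_eqF.
rewrite (le_trans H)// le_eqVlt; apply/orP; left; apply/eqP.
by field; rewrite f0 gt_eqF.
Qed.

Definition acen h p x : R := h^-1 * itg (x - h / 2) (x + h / 2) p.

(** A full length, as [acen] expects. The window of half-length 2^j / n around y lies in the window
    of this length around x whenever |x - y| <= D / n. *)
Definition radius (D : R) n j : R := 2 * ((2 ^+ j + D) / n%:R).

(** A substitute for the Hardy-Littlewood maximal function: Assumption A bounds a weighted sum of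
    averages term by term, whereas a supremum is unbounded already on L^1. With n + 3 terms the
    windows cover a period, by [pi_le_dyadic]. *)
Definition maxop (D : R) n p x : R :=
  \sum_(j < n.+3) 2 ^- j * acen (radius D n j) p x.

Lemma pi_le_dyadic n : (0 < n)%N -> pi <= 2 ^+ n.+2 / n%:R :> R.
Proof.
move=> n0; have n0R : 0 < n%:R :> R by rewrite ltr0n.
rewrite ler_pdivlMr// (le_trans (ler_wpM2r (ltW n0R) (_ : pi <= 4)))//.
  by have := @pihalf_lt2 R; lra.
rewrite !exprS mulrA (_ : 2 * 2 = 4) ?ler_pM2l//; last by ring.
by rewrite -natrX ler_nat ltnW// ltn_expl.
Qed.

Lemma kernel_dyadic m (L : nat) : symbol m -> (0 < L)%N ->
  (forall x, L%:R <= x -> m x = 0) ->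
  exists2 C : R, 0 < C & forall n t, (0 < n)%N -> `|t| <= pi ->
    `|kernel m n (L * n) t| <=
      \sum_(j < n.+3) C * n%:R / 4 ^+ j * (`|t| <= 2 ^+ j / n%:R)%R%:R.
Proof.
move=> sm L0 m0; have [C C0 kC] := kernel_bound sm L0 m0.
have c1 : 0 < (cos 1 / 2) ^+ 2 :> R by rewrite exprn_gt0// divr_gt0// cos1_gt0.
(* One constant for both hypotheses of [dyadic_bound]: the size bound needs C, the decay bound needs
   C divided by the constant of [cos_le_sqr]. *)
pose B := C * (1 + ((cos 1 / 2) ^+ 2)^-1).
have B0 : 0 < B by rewrite mulr_gt0// addr_gt0// invr_gt0.
have CB : C <= B by rewrite ler_pMr// lerDl invr_ge0 ltW.
exists (4 * B); first by rewrite mulr_gt0.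
move=> n t n0 tpi; have [k1 k2] := kC n t n0.
have n0R : 0 < n%:R :> R by rewrite ltr0n.
apply: dyadic_bound => //.
- by rewrite (le_trans k1)// ler_wpM2r.
- apply: (@le_trans _ _ (((cos 1 / 2) ^+ 2)^-1 * ((2 - 2 * cos t) * `|kernel m n (L * n) t|))).
    rewrite mulrA ler_wpM2r// ler_pdivlMl// (le_trans _ (cos_le_sqr tpi))//.
    by rewrite le_eqVlt; apply/orP; left; apply/eqP; ring.
  rewrite (le_trans (ler_wpM2l _ k2)) ?invr_ge0 ?(ltW c1)//.
  rewrite mulrA ler_wpM2r ?invr_ge0// mulrC /B mulrDr mulr1 lerDr ltW//.
- by rewrite (le_trans tpi)// pi_le_dyadic.
Qed.

Lemma pint_kernelM m (L : nat) n p y : symbol m -> (0 < L)%N ->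
  (forall x, L%:R <= x -> m x = 0) -> (0 < n)%N -> pint p ->
  pint (fun t => p t * kernel m n (L * n) (y - t)).
Proof.
move=> sm L0 m0 n0 ip; have [B _ kB] := kernel_bound sm L0 m0.
have [mk pk _] := pint_kernel m n (L * n) y.
by apply: (@pintM _ _ _ (B * n%:R)) => // t; have [] := kB n (y - t) n0.
Qed.

Lemma itg_kernel_bound m (L : nat) : symbol m -> (0 < L)%N ->
  (forall x, L%:R <= x -> m x = 0) ->
  exists2 C : R, 0 < C & forall n p y, (0 < n)%N -> pint p ->
    `|itg (- pi) pi (fun t => p t * kernel m n (L * n) (y - t))| <=
    \sum_(j < n.+3) C * n%:R / 4 ^+ j *
      itg (y - 2 ^+ j / n%:R) (y + 2 ^+ j / n%:R) (fun t => `|p t|).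
Proof.
move=> sm L0 m0; have [C C0 kC] := kernel_dyadic sm L0 m0.
exists C => // n p y n0 ip.
have ik := pint_kernelM y sm L0 m0 n0 ip; have ink := pint_norm ik.
rewrite (le_trans (itg_norm _ _ ik))//.
(* Periodicity moves the integral to the period centered at y, where |y - t| <= pi as the kernel
   bound demands. *)
have -> : itg (- pi) pi (fun t => `|p t * kernel m n (L * n) (y - t)|) =
    itg (y - pi) (y + pi) (fun t => `|p t * kernel m n (L * n) (y - t)|).
  have := itg_period (- pi) (y - pi) ink.
  by rewrite (_ : - pi + 2 * pi = pi) 1?(_ : y - pi + 2 * pi = y + pi)//; ring.
apply: (@itg_le_boxes (fun t => `|p t|) _ (y - pi) (y + pi) n.+3
  (fun j => y - 2 ^+ j / n%:R) (fun j => y + 2 ^+ j / n%:R)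
  (fun j => C * n%:R / 4 ^+ j) (pint_norm ip) ink) => //.
- by move=> j; rewrite !mulr_ge0 ?invr_ge0 ?exprn_ge0// ltW.
- move=> t /andP[t1 t2].
  have yt : `|y - t| <= pi by rewrite ler_norml; apply/andP; split; lra.
  rewrite normrM (le_trans (ler_wpM2l (normr_ge0 _) (kC n (y - t) n0 yt)))//.
  rewrite mulr_sumr; apply: ler_sum => j _; rewrite boxE.
  rewrite (_ : (`|y - t| <= 2 ^+ j / n%:R) = (y - 2 ^+ j / n%:R <= t) && (t <= y + 2 ^+ j / n%:R)).
    by rewrite mulrCA.
  rewrite ler_norml; apply/andP/andP => -[? ?]; split; lra.
Qed.

(** The kernel weight n / 4^j times a window length of order 2^j / n leaves the summable factor 2^-j
    in front of an average. *)
Lemma mult_bound m (L : nat) (D : R) : symbol m -> (0 < L)%N -> 0 < D ->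
  (forall x, L%:R <= x -> m x = 0) ->
  exists2 C : R, 0 < C & forall n p x y, (0 < n)%N -> pint p -> `|x - y| <= D / n%:R ->
    `|mult m n (L * n) p y| <= C * maxop D n (fun t => `|p t|) x.
Proof.
move=> sm L0 D0 m0; have [C C0 kC] := itg_kernel_bound sm L0 m0.
exists (2 * C * (1 + D)); first by rewrite !mulr_gt0// addr_gt0.
move=> n p x y n0 ip xy; have n0R : 0 < n%:R :> R by rewrite ltr0n.
have inp := pint_norm ip.
rewrite multE// (le_trans (kC n p y n0 ip))//.
rewrite /maxop mulr_sumr; apply: ler_sum => j _.
set r := radius D n j.
have j0 : 0 < 2 ^+ j :> R by rewrite exprn_gt0.
have r0 : 0 < r by rewrite mulr_gt0// divr_gt0// addr_gt0.
have rE : r / 2 = 2 ^+ j / n%:R + D / n%:R by rewrite /r /radius; field; rewrite gt_eqF.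
have -> : 2 * C * (1 + D) * (2 ^- j * acen r (fun t => `|p t|) x) =
   (2 * C * (1 + D) * 2 ^- j / r) * itg (x - r / 2) (x + r / 2) (fun t => `|p t|).
  by rewrite /acen; ring.
apply: ler_pM.
- by rewrite !mulr_ge0 ?invr_ge0 ?exprn_ge0// ltW.
- exact: itg_ge0.
- rewrite ler_pdivlMr// /r /radius.
  have -> : C * n%:R / 4 ^+ j * (2 * ((2 ^+ j + D) / n%:R)) = 2 * C / 4 ^+ j * (2 ^+ j + D).
    by field; rewrite expf_neq0// gt_eqF.
  have -> : 2 * C * (1 + D) * 2 ^- j = 2 * C / 4 ^+ j * ((1 + D) * 2 ^+ j).
    rewrite (_ : 4 = 2 * 2) ?exprMn; last by ring.
    by field; rewrite gt_eqF.
  apply: ler_wpM2l; first by rewrite !mulr_ge0 ?invr_ge0 ?exprn_ge0// ltW.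
  by rewrite mulrDl mul1r lerD2l ler_peMr ?(ltW D0)// exprn_ege1// ler1n.
- move: xy; rewrite ler_norml rE => /andP[? ?]; apply: itgS => //; lra.
Qed.

End dyadic_majorant.

(* The properties of the Borel real-valued members of X that the estimates use. *)
Record real_lattice (R : realType) (V : set (R -> R)) (N : (R -> R) -> R) (C0 : R) : Prop :=
  RealLattice {
  rl_pint : forall p, V p -> pint p;
  rl_add : forall p q, V p -> V q -> V (fun x => p x + q x);
  rl_scale : forall a p, V p -> V (fun x => a * p x);
  rl_ge0 : forall p, V p -> 0 <= N p;
  rl_normD : forall p q, V p -> V q -> N (fun x => p x + q x) <= N p + N q;
  rl_normZ : forall a p, V p -> N (fun x => a * p x) = `|a| * N p;
  rl_ideal : forall p q : R -> R, measurable_fun setT p -> (forall x, p (x + 2 * pi) = p x) ->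
    V q -> (forall x, `|p x| <= `|q x|) -> V p /\ N p <= N q;
  rl_one : V (fun=> 1);
  rl_const : 0 < C0;
  rl_cen : forall h p, 0 < h -> V p -> V (acen h p) /\ N (acen h p) <= C0 * N p
}.

(** * Averages, dyadic sums and multipliers as bounded operators on the lattice *)

Section real_lattice_theory.
Context {R : realType} {V : set (R -> R)} {N : (R -> R) -> R} {C0 : R}.
Hypothesis X : real_lattice V N C0.
Implicit Types (p q : R -> R) (h x t a b c : R) (i j J n : nat).

Lemma rl_sub p q : V p -> V q -> V (fun x => p x - q x).
Proof.
move=> vp /(rl_scale X (-1)) /(rl_add X vp); congr V; apply/funext => x.
by rewrite mulN1r.
Qed.

Lemma rl_normB p q : V p -> V q -> N (fun x => p x - q x) <= N p + N q.
Proof.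
move=> vp vq; have := rl_normD X vp (rl_scale X (-1) vq).
rewrite (rl_normZ X)// normrN normr1 mul1r; congr (N _ <= _); apply/funext => x.
by rewrite mulN1r.
Qed.

Lemma rl_triangle p q : V p -> V q -> N p <= N q + N (fun x => p x - q x).
Proof.
move=> vp vq; have := rl_normD X vq (rl_sub vp vq); congr (N _ <= _).
by apply/funext => x; rewrite addrC subrK.
Qed.

Lemma rl_dom p q : pint p -> V q -> (forall x, `|p x| <= `|q x|) -> V p /\ N p <= N q.
Proof. by move=> [mp pp _]; exact: (rl_ideal X). Qed.

Lemma rl_abs p : V p -> V (fun x => `|p x|) /\ N (fun x => `|p x|) = N p.
Proof.
move=> vp; have ip := rl_pint X vp.
have [v1 n1] : V (fun x => `|p x|) /\ N (fun x => `|p x|) <= N p.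
  by apply: rl_dom => // [|x]; [exact: pint_norm|rewrite normr_id].
have [_ n2] : V p /\ N p <= N (fun x => `|p x|).
  by apply: rl_dom => // x; rewrite normr_id.
by split=> //; apply/eqP; rewrite eq_le n1 n2.
Qed.

Lemma rl_bounded p C : pint p -> (forall x, `|p x| <= C) -> V p.
Proof.
move=> ip pC; have vC := rl_scale X C (rl_one X).
apply: (proj1 (rl_dom ip vC _)) => x.
by rewrite mulr1 (le_trans (pC x))// ler_norm.
Qed.

Lemma rl_sum (F : nat -> R -> R) (B : nat -> R) n : (forall j, V (F j)) ->
  (forall j, (j < n)%N -> N (F j) <= B j) ->
  V (fun x => \sum_(j < n) F j x) /\ N (fun x => \sum_(j < n) F j x) <= \sum_(j < n) B j.
Proof.
move=> vF; elim: n => [|n IH] FB.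
  have E : (fun x => \sum_(j < 0) F j x) = fun x => 0 * F 0%N x.
    by apply/funext => x; rewrite big_ord0 mul0r.
  rewrite E big_ord0; split; first exact: (rl_scale X).
  by rewrite (rl_normZ X)// normr0 mul0r.
have E : (fun x => \sum_(j < n.+1) F j x) = fun x => \sum_(j < n) F j x + F n x.
  by apply/funext => x; rewrite big_ord_recr.
have [v1 n1] := IH (fun j jn => FB j (ltnW jn)).
rewrite E big_ord_recr/=; split; first exact: (rl_add X).
by rewrite (le_trans (rl_normD X _ _))// lerD// FB.
Qed.

Lemma trig_bounded (c : nat -> R[i]) J :
  exists C, forall x, `|trig c J x| <= C.
Proof.
exists (\sum_(j < J.+1) (`|complex.Re (c j)| + `|complex.Im (c j)|)) => x.
rewrite (le_trans (ler_norm_sum _ _ _))//; apply: ler_sum => j _.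
case: (c j) => a b /=; rewrite (le_trans (ler_normB _ _))// !normrM lerD//.
  by rewrite ler_piMr// cos_max.
by rewrite ler_piMr// sin_max.
Qed.

Lemma rl_trig (c : nat -> R[i]) J : V (trig c J).
Proof. by have [C tC] := trig_bounded c J; apply: rl_bounded tC; exact: pint_trig. Qed.

(** The forward window of length h is half of the centered window of length 2 h; this is the factor
    2. *)
Lemma rl_adot h p : 0 < h -> V p -> V (adot h p) /\ N (adot h p) <= 2 * C0 * N p.
Proof.
move=> h0 vp; have ip := rl_pint X vp.
have [va na] := rl_abs vp.
have h2 : 0 < 2 * h by rewrite mulr_gt0.
have [v1 n1] := rl_cen X h2 va.
have v2 := rl_scale X 2 v1.
have [w1 w2] : V (adot h p) /\ N (adot h p) <= N (fun x => 2 * acen (2 * h) (fun t => `|p t|) x).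
  apply: rl_dom => //; first exact: pint_adot.
  move=> x; rewrite /adot /acen normrM [leRHS]normrM normrM.
  rewrite [`|h^-1|]ger0_norm ?invr_ge0 ?(ltW h0)// [`|2|]ger0_norm//.
  rewrite [`|(2 * h)^-1|]ger0_norm ?invr_ge0 ?(ltW h2)//.
  rewrite (_ : 2 * (_ * _) = h^-1 * `|itg (x - 2 * h / 2) (x + 2 * h / 2) (fun t => `|p t|)|); last first.
    by field; rewrite gt_eqF.
  rewrite ler_wpM2l ?invr_ge0 ?(ltW h0)// (le_trans (itg_norm _ _ ip))//.
  rewrite ger0_norm ?itg_ge0//.
  by apply: itgS; [exact: pint_norm|by []|lra|lra].
split => //; rewrite (le_trans w2)// (rl_normZ X)// ger0_norm//.
by rewrite -mulrA ler_pM2l// -na.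
Qed.

Lemma sum_half (n : nat) : \sum_(j < n) (2 : R) ^- j <= 2.
Proof.
suff -> : \sum_(j < n) (2 : R) ^- j = 2 - 2 * 2 ^- n.
  by rewrite gerBl mulr_ge0// invr_ge0 exprn_ge0.
elim: n => [|n IH]; first by rewrite big_ord0 expr0 invr1; ring.
by rewrite big_ord_recr /= IH exprS; field; rewrite expf_neq0.
Qed.

Lemma rl_maxop D n p : 0 < D -> (0 < n)%N -> V p ->
  V (maxop D n (fun t => `|p t|)) /\ N (maxop D n (fun t => `|p t|)) <= 2 * C0 * N p.
Proof.
move=> D0 n0 vp; have [va na] := rl_abs vp.
have n0R : 0 < n%:R :> R by rewrite ltr0n.
have r0 j : 0 < radius D n j by rewrite mulr_gt0// divr_gt0// addr_gt0// exprn_gt0.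
pose B j := 2 ^- j * (C0 * N p).
have vc j := rl_cen X (r0 j) va.
have [||w1 w2] := @rl_sum (fun j x => 2 ^- j * acen (radius D n j) (fun t => `|p t|) x) B n.+3.
- by move=> j; apply: (rl_scale X); exact: (vc j).1.
- move=> j _; rewrite (rl_normZ X); last exact: (vc j).1.
  rewrite ger0_norm ?invr_ge0 ?exprn_ge0// ler_wpM2l ?invr_ge0 ?exprn_ge0//.
  by rewrite -na; exact: (vc j).2.
split => //; rewrite (le_trans w2)// /B -mulr_suml -mulrA ler_wpM2r ?sum_half//.
by rewrite mulr_ge0 ?(rl_ge0 X)// ltW// (rl_const X).
Qed.

Lemma rl_mult (m : R -> R[i]) (L : nat) : symbol m -> (0 < L)%N ->
  (forall x, L%:R <= x -> m x = 0) ->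
  exists2 C : R, 0 < C & forall n p, (0 < n)%N -> V p -> N (mult m n (L * n) p) <= C * N p.
Proof.
move=> sm L0 m0; have [C c0 mC] := mult_bound sm L0 (@ltr01 R) m0.
exists (C * (2 * C0)); first by rewrite !mulr_gt0// (rl_const X).
move=> n p n0 vp; have ip := rl_pint X vp.
have [v1 n1] := rl_maxop (@ltr01 R) n0 vp.
have v2 := rl_scale X C v1.
have [_ h] : V (mult m n (L * n) p) /\ N (mult m n (L * n) p) <= N (fun x => C * maxop 1 n (fun t => `|p t|) x).
  apply: rl_dom => //; first exact: pint_trig.
  move=> x; rewrite (le_trans (mC n p x x n0 ip _))//; first by rewrite subrr normr0 divr_ge0.
  exact: ler_norm.
by rewrite (le_trans h)// (rl_normZ X)// ger0_norm ?(ltW c0)// -mulrA ler_pM2l.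
Qed.

End real_lattice_theory.

(** * Multipliers acting on trigonometric sums *)

Section multiplier_algebra.
Context {R : realType}.
Implicit Types (p : R -> R) (m : R -> R[i]) (c : nat -> R[i]) (h x t a d : R) (j J n : nat).

Lemma trig_ext c c2 J J' : (J <= J')%N -> (forall j, (j <= J)%N -> c j = c2 j) ->
  (forall j, (J < j <= J')%N -> c2 j = 0) -> trig c J = trig c2 J' :> (R -> R).
Proof.
move=> JJ cd d0; apply/funext => x; rewrite /trig.
rewrite (big_ord_widen J'.+1 (fun j => complex.Re (c j * cis (j%:R * x)))) ?ltnS//.
rewrite big_mkcond /=; apply: eq_bigr => j _; case: ifP; rewrite ltnS => jJ.
  by rewrite cd.
by rewrite d0 ?mul0r// ltnNge jJ -ltnS ltn_ord.
Qed.

Lemma symbol_Im0 m : symbol m -> complex.Im (m 0) = 0.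
Proof.
by case=> _ _ /(_ 0); rewrite oppr0; case: (m 0) => u v /eqP; rewrite eq_complex /= eqxx /= => /eqP h; lra.
Qed.

Lemma fourier_Im0 p : complex.Im (fourier p 0) = 0.
Proof.
rewrite /fourier /= /fsin (_ : itg _ _ _ = 0) ?mulr0 ?oppr0//.
rewrite -[RHS](mul0r (pi - - pi)) -(itg_cst _ pipi_le).
by apply: eq_itg => t _; rewrite mul0r sin0 mulr0.
Qed.

Lemma mult_trig m n J J' c : (J' <= J)%N -> complex.Im (c 0%N) = 0 ->
  mult m n J (trig c J') = trig (fun j => m (j%:R / n%:R) * c j) J'.
Proof.
move=> JJ c0; apply/esym/trig_ext => // j.
  by move=> jJ; rewrite fourier_trig// jJ.
by move=> /andP[jJ _]; rewrite fourier_trig// leqNgt jJ mulr0.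
Qed.

Lemma mult_id m n J J' c : (forall x, 0 <= x <= 1 -> m x = 1) -> (J' <= n)%N -> (0 < n)%N ->
  (J' <= J)%N -> complex.Im (c 0%N) = 0 -> mult m n J (trig c J') = trig c J'.
Proof.
move=> m1 Jn n0 JJ c0; rewrite mult_trig//; apply: trig_ext => // j.
  move=> jJ; rewrite m1 ?mul1r// divr_ge0//= ler_pdivrMr ?ltr0n// mul1r ler_nat.
  exact: leq_trans Jn.
by move=> /andP[/leq_trans h /h]; rewrite ltnn.
Qed.

Lemma trigB c c2 J x : trig (fun j => c j - c2 j) J x = trig c J x - trig c2 J x.
Proof.
rewrite /trig -sumrB; apply: eq_bigr => j _; rewrite mulrBl.
by case: (_ * _) => u v; case: (_ * _).
Qed.

Lemma trigZ a c J x : trig (fun j => a%:C * c j) J x = a * trig c J x.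
Proof.
rewrite /trig mulr_sumr; apply: eq_bigr => j _; rewrite -mulrA.
by case: (c j * _) => u v /=; rewrite mul0r subr0.
Qed.

End multiplier_algebra.

(** * Local regularity of double averages and local form of the cut-off error *)

Section averaging_is_nearly_band_limited.
Context {R : realType}.
Implicit Types (p q : R -> R) (h x y t a b : R) (i j n : nat).

Let v (x : R) : R[i] := (cutoff x)%:C.

(** Moving the outer window changes its integral only on two end pieces of length |x - t|, where the
    inner average is at most a local mean of |p|. The inner averages involved use p within 3 h of x,
    and 1 / h = 6 / (6 h); the two end pieces double 6 to 12. *)
Lemma adot_lip h p x t : 0 < h -> pint p -> `|x - t| <= h ->
  `|adot h (adot h p) x - adot h (adot h p) t| <=
    `|x - t| / h * (12 * acen (6 * h) (fun y => `|p y|) x).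
Proof.
move=> h0 ip; set q := adot h p; have iq : pint q by exact: pint_adot.
set K := acen _ _ _.
have qb y : x - h <= y <= x + 2 * h -> `|q y| <= 6 * K.
  move=> /andP[y1 y2]; rewrite /q /adot normrM ger0_norm ?invr_ge0 ?(ltW h0)//.
  rewrite /K /acen (_ : 6 * (_ * _) = h^-1 * itg (x - 6 * h / 2) (x + 6 * h / 2) (fun y => `|p y|)); last first.
    by field; rewrite gt_eqF.
  rewrite ler_wpM2l ?invr_ge0 ?(ltW h0)// (le_trans (itg_norm _ _ ip))//.
  by apply: itgS; [exact: pint_norm|by []|lra|lra].
have qi a b : x - h <= a -> a <= b -> b <= x + 2 * h -> `|itg a b q| <= 6 * K * (b - a).
  move=> xa ab bx; rewrite (le_trans (itg_norm _ _ iq))// -itg_cst//.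
  apply: itg_le; [exact: pint_norm|exact: pint_cst|].
  by move=> y /andP[? ?]; apply: qb; apply/andP; split; lra.
have E a b : a <= b -> b <= a + h -> itg a (a + h) q - itg b (b + h) q =
    itg a b q - itg (a + h) (b + h) q.
  move=> ab bh; have e1 := itgU iq ab bh.
  have e2 : itg b (b + h) q = itg b (a + h) q + itg (a + h) (b + h) q.
    by apply: itgU => //; lra.
  by rewrite e1 e2; ring.
have {}E a b : a <= b -> b <= a + h -> x - h <= a -> b <= x + h ->
    `|itg a (a + h) q - itg b (b + h) q| <= 12 * K * (b - a).
  move=> ab bh xa bx; rewrite E// (le_trans (ler_normB _ _))//.
  have -> : 12 * K * (b - a) = 6 * K * (b - a) + 6 * K * (b + h - (a + h)) by ring.
  by rewrite lerD// qi//; lra.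
move=> xt; rewrite {1 2}/adot -mulrBr normrM ger0_norm ?invr_ge0 ?(ltW h0)//.
rewrite (_ : _ / h * _ = h^-1 * (12 * K * `|x - t|)); last by ring.
rewrite ler_wpM2l ?invr_ge0 ?(ltW h0)//.
move: xt; rewrite ler_norml => /andP[xt1 xt2].
have [h1|h1] := leP x t.
  by rewrite [`|x - t|]distrC [`|t - x|]ger0_norm ?subr_ge0// E//; lra.
by rewrite [leLHS]distrC [`|x - t|]ger0_norm ?subr_ge0 ?(ltW h1)// E//; lra.
Qed.

(** The cut-off is 1 at frequency 0, so the multiplier fixes constants and the error is the integral
    of g x - g t against the kernel. *)
Lemma mult_cutoff_local : exists2 C : R, 0 < C &
  forall n g x, (0 < n)%N -> pint g ->
  `|g x - mult v n (2 * n) g x| <= \sum_(j < n.+3) C * n%:R / 4 ^+ j *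
     itg (x - 2 ^+ j / n%:R) (x + 2 ^+ j / n%:R) (fun t => `|g x - g t|).
Proof.
have v0 (x : R) : 2%:R <= x -> v x = 0.
  by move=> x2; rewrite /v cutoff0// ger0_norm// (le_trans _ x2).
have [C C0 kC] := itg_kernel_bound symbol_cutoff (isT : (0 < 2)%N) v0.
exists C => // n g x n0 ig.
have iF : pint (fun t => g x - g t) by apply: pintB => //; exact: pint_cst.
have kM p : pint p -> pint (fun t => p t * kernel v n (2 * n) (x - t)).
  by move=> ip; apply: (pint_kernelM x symbol_cutoff _ v0).
have one : mult v n (2 * n) (fun=> 1) x = 1.
  have e1 : (fun=> 1) = trig (fun=> 1) 0 :> (R -> R).
    by apply/funext => y; rewrite /trig big_ord_recl big_ord0 addr0 mul1r mul0r /= cos0.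
  rewrite e1 mult_id// -?e1// => y /andP[y0 y1].
  by rewrite /v cutoff1// ger0_norm.
have E : g x - mult v n (2 * n) g x = itg (- pi) pi (fun t => (g x - g t) * kernel v n (2 * n) (x - t)).
  rewrite -{1}[g x]mulr1 -one !multE//; last exact: pint_cst.
  rewrite -itgZ; last by apply: kM; exact: pint_cst.
  rewrite -itgB; last 2 first.
  - by apply: pintZ; apply: kM; exact: pint_cst.
  - exact: kM.
  by apply: eq_itg => t _; ring.
by rewrite E; exact: kC.
Qed.

End averaging_is_nearly_band_limited.

(** * Double averages are nearly band-limited at frequency L n *)

Section high_frequencies.
Context {R : realType} {V : set (R -> R)} {N : (R -> R) -> R} {C0 : R}.
Hypothesis X : real_lattice V N C0.
Implicit Types (p : R -> R) (h x y t a : R) (i j n L P : nat).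

Definition vcut (x : R) : R[i] := (cutoff x)%:C.

Lemma vcut0 x : 2 <= x -> vcut x = 0.
Proof. by move=> x2; rewrite /vcut cutoff0// ger0_norm// (le_trans _ x2). Qed.

Lemma sum_tail (P n : nat) : \sum_(j < n) (if (j <= P)%N then 0 else (2 : R) ^- j) <= 2 ^- P.
Proof.
have H : \sum_(j < n) (if (j <= P)%N then 0 else (2 : R) ^- j) =
    if (n <= P.+1)%N then 0 else 2 ^- P - 2 * 2 ^- n.
  elim: n => [|n IH]; first by rewrite big_ord0.
  rewrite big_ord_recr /= IH ltnS; case: (ltngtP n P.+1) => nP.
  - by rewrite -ltnS nP addr0.
  - rewrite leqNgt (ltnW nP) /= exprS; field; by rewrite !expf_neq0.
  - by rewrite nP ltnn add0r !exprS; field; rewrite !expf_neq0.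
rewrite H; case: ifP => _; first by rewrite invr_ge0 exprn_ge0.
by rewrite gerBl mulr_ge0// invr_ge0 exprn_ge0.
Qed.

(** The dyadic sum is cut at P. For j <= P the distance [tau j] is at most 2^-P h because L g >=
    4^P, and the Lipschitz bound gains 2^-P. For j > P the values of G are estimated separately, and
    the weights 2^-j sum to at most 2^-P. *)
Lemma rl_band_limited (g eps : R) : 0 < g -> 0 < eps -> exists L0 : nat, forall L n p,
  (L0 <= L)%N -> (0 < L)%N -> (0 < n)%N -> V p ->
  let A := adot (g / n%:R) in
  N (fun x => A (A p) x - mult vcut (L * n) (2 * (L * n)) (A (A p)) x) <= eps * N p.
Proof.
move=> g0 e0; have [C C1 HC] := @mult_cutoff_local R.
have c0 := rl_const X.
pose K := 2 * C * (12 * C0 + (1 + C0) * (2 * C0 * (2 * C0))).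
have K0 : 0 < K.
  rewrite mulr_gt0 ?mulr_gt0// addr_gt0 ?mulr_gt0// ?mulr_gt0//.
  by rewrite addr_gt0.
(* The weights [w] below add up to at most 3 2^-P, twice 2^-P from the first part and once from the
   tail; this P makes the total at most eps. *)
have [P hP] : exists P : nat, 3 * K / eps <= 2 ^+ P.
  exists (Num.truncn (3 * K / eps)).+1; rewrite ltW// (lt_le_trans (truncnS_gt _))//.
  by rewrite -natrX ler_nat ltnW// ltn_expl.
exists (Num.truncn (4 ^+ P / g)).+1 => L n p LL L1 n0 vp /=; set h := g / n%:R; set A := adot h.
have n0R : 0 < n%:R :> R by rewrite ltr0n.
have LP : 4 ^+ P <= L%:R * g.
  by rewrite -ler_pdivrMr// (le_trans (ltW (truncnS_gt _)))// ler_nat.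
have h0 : 0 < h by rewrite divr_gt0.

set n' := (L * n)%N; have n'0 : (0 < n')%N by rewrite muln_gt0 L1.
have n'0R : 0 < n'%:R :> R by rewrite ltr0n.
have [v1 N1] := rl_adot X h0 vp; have [v2 N2] := rl_adot X h0 v1.
rewrite -/A in v1 N1 v2 N2; set G := A (A p) in v2 N2 *.
have iG := rl_pint X v2; have ip := rl_pint X vp.
have [vaG naG] := rl_abs X v2; have [vap nap] := rl_abs X vp.
pose tau j := (2 ^+ j / n'%:R : R).
have tau0 j : 0 < tau j by rewrite divr_gt0// exprn_gt0.
pose w j := (2 ^- P * 2 ^- j + (if (j <= P)%N then 0 else 2 ^- j) : R).
have w0 j : 0 <= w j.
  rewrite addr_ge0 ?mulr_ge0 ?invr_ge0 ?exprn_ge0//.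
  by case: ifP => // _; rewrite invr_ge0 exprn_ge0.
(* One majorant for both ranges: the first summand comes from the Lipschitz bound, the second from
   the crude bound |G x| + |G t|. *)
pose M j (x : R) := 12 * acen (6 * h) (fun y => `|p y|) x + (`|G x| + acen (2 * tau j) (fun y => `|G y|) x).
pose F j (x : R) := 2 * C * w j * M j x.
have h6 : 0 < 6 * h by rewrite mulr_gt0.
have [va6 na6] := rl_cen X h6 vap.
have vc j : V (acen (2 * tau j) (fun y => `|G y|)) /\ N (acen (2 * tau j) (fun y => `|G y|)) <= C0 * N (fun y => `|G y|).
  by apply: (rl_cen X) => //; rewrite mulr_gt0.
have a60 x : 0 <= acen (6 * h) (fun y => `|p y|) x.
  by rewrite mulr_ge0 ?invr_ge0 ?(ltW h6)// itg_ge0.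
have at0 j x : 0 <= acen (2 * tau j) (fun y => `|G y|) x.
  by rewrite mulr_ge0 ?invr_ge0 ?itg_ge0// mulr_ge0// ltW.
have vM j : V (M j).
  apply: (rl_add X); first exact: (rl_scale X).
  by apply: (rl_add X) => //; exact: (vc j).1.
have NG : N G <= 2 * C0 * (2 * C0) * N p.
  by rewrite (le_trans N2)// -[leRHS]mulrA ler_wpM2l// mulr_ge0// ltW.
have NM j : N (M j) <= (12 * C0 + (1 + C0) * (2 * C0 * (2 * C0))) * N p.
  have s1 := rl_normD X (rl_scale X 12 va6) (rl_add X vaG (vc j).1).
  have s2 := rl_normD X vaG (vc j).1.
  rewrite (rl_normZ X)// ger0_norm// nap in s1 na6.
  have s3 := (vc j).2; rewrite naG in s2 s3.
  rewrite (le_trans s1)// [leRHS]mulrDl lerD//.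
    by rewrite -mulrA ler_pM2l// -nap.
  rewrite (le_trans s2)// -[leRHS]mulrA [leRHS]mulrDl mul1r lerD//.
  by rewrite (le_trans s3)// ler_pM2l.
have [||vS NS] := @rl_sum _ _ _ _ X F (fun j => w j * (K * N p)) n'.+3.
- by move=> j; apply: (rl_scale X).
- move=> j _; rewrite (rl_normZ X)// ger0_norm; last by rewrite !mulr_ge0// ltW.
  rewrite (_ : 2 * C * w j = w j * (2 * C)); last by ring.
  rewrite -mulrA ler_wpM2l// /K -mulrA ler_wpM2l// mulr_ge0// ltW//.
have [_ ] : V (fun x => G x - mult vcut n' (2 * n') G x) /\
   N (fun x => G x - mult vcut n' (2 * n') G x) <= N (fun x => \sum_(j < n'.+3) F j x).
  apply: (rl_dom X) => //; first by apply: pintB => //; exact: pint_trig.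
  move=> x; rewrite (le_trans (HC n' G x n'0 iG))// (le_trans _ (ler_norm _))//.
  apply: ler_sum => j _; rewrite -/(tau j).
  have iF : pint (fun t => `|G x - G t|) by apply: pint_norm; apply: pintB => //; exact: pint_cst.
  have xx : x - tau j <= x + tau j by have := tau0 j; lra.
  have Ctau : C * n'%:R / 4 ^+ j * (2 * tau j) = 2 * C * 2 ^- j.
    rewrite /tau (_ : 4 = 2 * 2) ?exprMn; last by ring.
    by field; rewrite expf_neq0// gt_eqF.
  have c40 : 0 <= C * n'%:R / 4 ^+ j by rewrite !mulr_ge0 ?invr_ge0 ?exprn_ge0// ltW.
  have C20 : 0 <= 2 * C * 2 ^- j by rewrite !mulr_ge0 ?invr_ge0 ?exprn_ge0// ltW.
  have [jP|jP] := leqP j P.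
    have th : tau j / h <= 2 ^- P.
      rewrite /tau /h /n' natrM ler_pdivrMr//.
      rewrite (_ : 2 ^- P * (g / n%:R) = (L%:R * g) / 2 ^+ P / (L%:R * n%:R)); last first.
        by field; rewrite expf_neq0//= gt_eqF// gt_eqF// ltr0n.
      rewrite ler_wpM2r ?invr_ge0 ?mulr_ge0// ler_pdivlMr ?exprn_gt0// (le_trans _ LP)//.
      rewrite (_ : 4 = 2 * 2) ?exprMn; last by ring.
      by rewrite ler_wpM2r ?exprn_ge0// ler_weXn2l// ler1n.
    have th1 : tau j <= h.
      have : tau j / h <= 1 by rewrite (le_trans th)// invf_le1 ?exprn_gt0// exprn_ege1// ler1n.
      by rewrite ler_pdivrMr// mul1r.
    have B : itg (x - tau j) (x + tau j) (fun t => `|G x - G t|) <=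
       2 ^- P * (12 * acen (6 * h) (fun y => `|p y|) x) * (x + tau j - (x - tau j)).
      rewrite -itg_cst//; apply: itg_le => //; first exact: pint_cst.
      move=> t /andP[t1 t2].
      have xt : `|x - t| <= tau j by rewrite ler_norml; apply/andP; split; lra.
      rewrite (le_trans (adot_lip h0 ip (le_trans xt th1)))//.
      apply: ler_wpM2r; first by rewrite mulr_ge0.
      by apply: le_trans th; rewrite ler_wpM2r// invr_ge0 ltW.
    rewrite (le_trans (ler_wpM2l c40 B))//.
    have -> : C * n'%:R / 4 ^+ j * (2 ^- P * (12 * acen (6 * h) (fun y => `|p y|) x) * (x + tau j - (x - tau j))) =
      (C * n'%:R / 4 ^+ j * (2 * tau j)) * (2 ^- P * (12 * acen (6 * h) (fun y => `|p y|) x)) by ring.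
    rewrite Ctau /F /w jP addr0 (mulrC (2 ^- P) (2 ^- j)) -!mulrA.
    rewrite !ler_wpM2l ?invr_ge0 ?exprn_ge0// ?(ltW C1)// /M lerDl addr_ge0//.
  have B : itg (x - tau j) (x + tau j) (fun t => `|G x - G t|) <=
      2 * tau j * (`|G x| + acen (2 * tau j) (fun y => `|G y|) x).
    have -> : 2 * tau j * (`|G x| + acen (2 * tau j) (fun y => `|G y|) x) =
        `|G x| * (x + tau j - (x - tau j)) + itg (x - tau j) (x + tau j) (fun y => `|G y|).
      rewrite /acen (_ : 2 * tau j / 2 = tau j); last by field.
      by field; rewrite gt_eqF.
    rewrite -itg_cst// -itgD; [|exact: pint_cst|exact: pint_norm].
    apply: itg_le => //; first by apply: pintD; [exact: pint_cst|exact: pint_norm].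
    by move=> t _; exact: ler_normB.
  rewrite (le_trans (ler_wpM2l c40 B))// mulrA Ctau /F.
  apply: ler_pM => //.
  - by rewrite addr_ge0.
  - rewrite ler_wpM2l ?mulr_ge0 ?(ltW C1)// /w leqNgt jP /= lerDr.
    by rewrite mulr_ge0 ?invr_ge0 ?exprn_ge0.
  - by rewrite /M lerDr mulr_ge0.
move=> H; rewrite (le_trans H)// (le_trans NS)//.
rewrite -mulr_suml mulrA ler_wpM2r ?(rl_ge0 X)//.
have Sw : \sum_(j < n'.+3) w j <= 3 * 2 ^- P.
  rewrite big_split /= -mulr_sumr.
  have := sum_tail P n'.+3; have P0 : 0 <= (2 : R) ^- P by rewrite invr_ge0 exprn_ge0.
  have := ler_wpM2l P0 (@sum_half R n'.+3); lra.
rewrite (le_trans (ler_wpM2r (ltW K0) Sw))//.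
rewrite mulrAC ler_pdivrMr ?exprn_gt0//.
by rewrite -ler_pdivrMl// mulrC.
Qed.

End high_frequencies.

(** * Powers of 1 - A' and 1 - A on the Fourier side *)

Section powers_of_differences.
Context {R : realType}.
Implicit Types (p q : R -> R) (m : R -> R[i]) (c : nat -> R[i]) (h x a b g : R) (i j k J n r s : nat).

Definition dpow h s p : R -> R := iter s (fun f x => f x - adot h f x) p.
Definition cpow h r p : R -> R := iter r (fun f x => f x - acen h f x) p.

Lemma pint_dpow h s p : 0 < h -> pint p -> pint (dpow h s p).
Proof.
move=> h0 ip; elim: s => //= s IH; apply: pintB => //; exact: pint_adot.
Qed.

Lemma adotB h p q : pint p -> pint q ->
  adot h (fun x => p x - q x) = fun x => adot h p x - adot h q x.
Proof. by move=> ip iq; apply/funext => x; rewrite /adot itgB// mulrBr. Qed.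

Lemma dpowB h s p q : 0 < h -> pint p -> pint q ->
  dpow h s (fun x => p x - q x) = fun x => dpow h s p x - dpow h s q x.
Proof.
move=> h0 ip iq; elim: s => //= s IH; rewrite -/(dpow h s _) IH adotB; last 2 first.
- exact: pint_dpow.
- exact: pint_dpow.
by apply/funext => x; ring.
Qed.

Lemma fourier_dpow h s p j : 0 < h -> pint p ->
  fourier (dpow h s p) j = (1 - avg_symbol (h * j%:R)) ^+ s * fourier p j.
Proof.
move=> h0 ip; elim: s => [|s IH]; first by rewrite expr0 mul1r.
rewrite /= -/(dpow h s p) fourierB; last 2 first.
- exact: pint_dpow.
- by apply: pint_adot => //; exact: pint_dpow.
by rewrite fourier_adot ?IH//; [rewrite exprS; ring|exact: pint_dpow].
Qed.

Lemma dpow_trig h s c J : 0 < h ->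
  dpow h s (trig c J) = trig (fun j => (1 - avg_symbol (h * j%:R)) ^+ s * c j) J.
Proof.
move=> h0; elim: s => [|s IH].
  by congr trig; apply/funext => j; rewrite expr0 mul1r.
rewrite /= -/(dpow h s _) IH; apply/funext => x; rewrite adot_trig// -trigB.
by congr (trig _ _ _); apply/funext => j; rewrite exprS; ring.
Qed.

Lemma acen_adot h p x : acen h p x = adot h p (x - h / 2).
Proof. by rewrite /acen /adot; congr (_ * itg _ _ _); field. Qed.

Lemma acen_trig h c J x : 0 < h -> acen h (trig c J) x =
  trig (fun j => avg_symbol (h * j%:R) * cis (- (2^-1 * (h * j%:R))) * c j) J x.
Proof.
move=> h0; rewrite acen_adot adot_trig//; apply: eq_bigr => j _.
rewrite (_ : j%:R * (x - h / 2) = - (2^-1 * (h * j%:R)) + j%:R * x); last by field.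
by rewrite cisD; congr complex.Re; ring.
Qed.

Lemma cpow_trig h r c J : 0 < h -> cpow h r (trig c J) =
  trig (fun j => (1 - avg_symbol (h * j%:R) * cis (- (2^-1 * (h * j%:R)))) ^+ r * c j) J.
Proof.
move=> h0; elim: r => [|r IH].
  by congr trig; apply/funext => j; rewrite expr0 mul1r.
rewrite /= -/(cpow h r _) IH; apply/funext => x; rewrite acen_trig// -trigB.
by congr (trig _ _ _); apply/funext => j; rewrite exprS; ring.
Qed.

Lemma acenB h p q x : pint p -> pint q ->
  acen h (fun x => p x - q x) x = acen h p x - acen h q x.
Proof. by move=> ip iq; rewrite /acen itgB// mulrBr. Qed.

Lemma ixM a x : ix (a * x) = a%:C * ix x.
Proof. by apply: complexP => /=; ring. Qed.

Lemma realcM a b : (a * b)%:C = a%:C * b%:C.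
Proof. by apply: complexP => /=; ring. Qed.

Lemma realcX a k : (a ^+ k)%:C = a%:C ^+ k.
Proof. by elim: k => // k IH; rewrite !exprS realcM IH. Qed.

Lemma realc_neq0 a : a != 0 -> a%:C != 0.
Proof. by move=> a0; rewrite eq_complex /= eqxx andbT. Qed.

Lemma symbol_cst a : symbol (fun=> a%:C).
Proof. by apply: (symbol_real (loc_C11_cst a)). Qed.

Lemma symbolB m1 m2 : symbol m1 -> symbol m2 -> symbol (fun x => m1 x - m2 x).
Proof.
move=> s1 s2; have := symbolD s1 (symbolM (symbol_cst (-1)) s2).
congr symbol; apply/funext => x; congr (_ + _).
by case: (m2 x) => u v; apply: complexP => /=; ring.
Qed.

(* The Fourier multiplier of [1 - adot (g / n)] at frequency [n * x] is
   [ix x * scaledB g x]. *)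
Definition scaledB g x : R[i] := g%:C * symB (g * x).

Lemma symbol_scaledB g : symbol (scaledB g).
Proof. by apply: symbolM; [exact: symbol_cst|exact: (symbol_scale g symbol_B)]. Qed.

Lemma scaledB_neq0 g x : 0 < g -> scaledB g x != 0.
Proof. by move=> g0; rewrite mulf_neq0 ?symB_neq0// realc_neq0// gt_eqF. Qed.

Lemma one_sub_avg g n j : 1 - avg_symbol (g / n%:R * j%:R) =
  ix (j%:R / n%:R) * scaledB g (j%:R / n%:R).
Proof.
rewrite one_sub_avg_symbol (_ : g / n%:R * j%:R = g * (j%:R / n%:R)); last by ring.
by rewrite ixM /scaledB; ring.
Qed.

End powers_of_differences.

(** * Realization of (1 - A')^s by polynomials, and Bernstein-type converses *)

Section realization.
Context {R : realType} {V : set (R -> R)} {N : (R -> R) -> R} {C0 : R}.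
Hypothesis X : real_lattice V N C0.
Implicit Types (p q : R -> R) (m : R -> R[i]) (c : nat -> R[i]) (h x y t a b d g : R) (i j J n L r s : nat).

Lemma rl_iter (A : (R -> R) -> R -> R) (C : R) s p : 0 <= C ->
  (forall q, V q -> V (A q) /\ N (A q) <= C * N q) -> V p ->
  let u := iter s (fun f x => f x - A f x) p in V u /\ N u <= (1 + C) ^+ s * N p.
Proof.
move=> c0 HA vp; elim: s => [|s [IH1 IH2]] /=; first by rewrite expr0 mul1r.
set u := iter s _ p in IH1 IH2 *; have [v1 n1] := HA u IH1.
split; first exact: (rl_sub X).
rewrite exprS -mulrA (le_trans (rl_normB X IH1 v1))//.
apply: (@le_trans _ _ ((1 + C) * N u)); first by rewrite [leRHS]mulrDl mul1r lerD2l.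
by rewrite ler_wpM2l// addr_ge0.
Qed.

Lemma rl_dpow h s p : 0 < h -> V p ->
  V (dpow h s p) /\ N (dpow h s p) <= (1 + 2 * C0) ^+ s * N p.
Proof.
move=> h0; have c0 := ltW (rl_const X).
by apply: rl_iter => [|q]; [exact: mulr_ge0|exact: (rl_adot X)].
Qed.

Lemma rl_cpow h r p : 0 < h -> V p ->
  V (cpow h r p) /\ N (cpow h r p) <= (1 + C0) ^+ r * N p.
Proof.
by move=> h0; apply: rl_iter => [|q]; [exact/ltW/(rl_const X)|exact: (rl_cen X)].
Qed.

(** With q = (1 - A') p one has p = q + A' q + A' A' p. Induction applies to q, and A' A' q = (1 -
    A') A' A' p is again controlled by A' A' p. *)
Lemma rl_reduce s : exists2 K : R, 0 < K & forall h p, 0 < h -> V p ->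
  N p <= K * (N (dpow h s p) + N (adot h (adot h p))).
Proof.
have c0 := rl_const X; have c1 : 0 < 1 + 2 * C0 by rewrite addr_gt0// mulr_gt0.
elim: s => [|s [K K0 IH]].
  exists 1 => // h p h0 vp; rewrite mul1r lerDl.
  have [v1 _] := rl_adot X h0 vp; have [v2 _] := rl_adot X h0 v1.
  exact: (rl_ge0 X).
exists ((1 + 2 * C0) * K * (1 + 2 * C0) + 1).
  by rewrite addr_gt0// !mulr_gt0.
(* The variables u0, ..., u6 stand for the norms of p, q, A' p, A' q, A' A' p, (1 - A')^s q and A'
   A' q. *)
have arith (u0 u1 u2 u3 u4 u5 u6 : R) : u0 <= u2 + u1 -> u2 <= u4 + u3 -> u3 <= 2 * C0 * u1 ->
    u1 <= K * (u5 + u6) -> u6 <= (1 + 2 * C0) * u4 -> 0 <= u4 -> 0 <= u5 ->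
    u0 <= ((1 + 2 * C0) * K * (1 + 2 * C0) + 1) * (u5 + u4).
  move=> H1 H2 H3 H4 H5 p4 p5.
  have {H1 H2 H3}H1 : u0 <= u4 + (1 + 2 * C0) * u1.
    rewrite mulrDl mul1r; move: (2 * C0 * u1) H1 H2 H3 => w; clear; lra.
  rewrite (le_trans H1)//.
  have H6 : (1 + 2 * C0) * u1 <= (1 + 2 * C0) * K * (1 + 2 * C0) * (u5 + u4).
    rewrite -!mulrA ler_pM2l// (le_trans H4)// ler_pM2l// [leRHS]mulrDr.
    by rewrite (le_trans (lerD (lexx _) H5))// lerD2r ler_peMl// lerDl mulr_ge0// ltW.
  by rewrite [leRHS]mulrDl mul1r [leLHS]addrC lerD// lerDr.
move=> h p h0 vp; set q := fun x => p x - adot h p x.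
have ip := rl_pint X vp; have iA := pint_adot h0 ip.
have [v1 n1] := rl_adot X h0 vp; have [v2 n2] := rl_adot X h0 v1.
have vq : V q by exact: (rl_sub X).
have Eq : dpow h s.+1 p = dpow h s q by rewrite /dpow iterSr.
have Aq : adot h q = fun x => adot h p x - adot h (adot h p) x by rewrite /q adotB.
have AAq : adot h (adot h q) = fun x => adot h (adot h p) x - adot h (adot h (adot h p)) x.
  by rewrite Aq adotB//; exact: pint_adot.
have H1 : N p <= N (adot h p) + N q by exact: (rl_triangle X).
have H2 : N (adot h p) <= N (adot h (adot h p)) + N (adot h q).
  by rewrite Aq; exact: (rl_triangle X).
have H3 := (rl_adot X h0 vq).2.
have H4 := IH h q h0 vq.
have [v3 n3] := rl_adot X h0 v2.
have H5 : N (adot h (adot h q)) <= (1 + 2 * C0) * N (adot h (adot h p)).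
  by rewrite AAq (le_trans (rl_normB X v2 v3))// [leRHS]mulrDl mul1r lerD2l.
by rewrite Eq; exact: (arith _ _ _ _ _ _ _ H1 H2 H3 H4 H5 (rl_ge0 X v2) (rl_ge0 X (rl_dpow s h0 vq).1)).
Qed.

Lemma symbol_vcut a : symbol (fun x => vcut (a * x)).
Proof. exact: (symbol_scale a symbol_cutoff). Qed.

Lemma vcut1 x : `|x| <= 1 -> vcut x = 1.
Proof. by move=> x1; rewrite /vcut cutoff1. Qed.

Lemma vcut_scale0 a L x : 0 <= a -> 2 <= a * L%:R -> L%:R <= x -> vcut (a * x) = 0.
Proof. by move=> a0 aL Lx; apply: vcut0; rewrite (le_trans aL)// ler_wpM2l. Qed.

(** Since a, b <= 2, both cut-offs equal 1 for |x| < 1/2 and their difference vanishes there;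
    elsewhere [ix] agrees with the zero-free [ix_away]. Division by the symbol of (1 - A')^s is thus
    legitimate. *)
Lemma rl_band g s a b L : 0 < g -> 0 < a <= 2 -> 0 < b <= 2 -> (0 < L)%N ->
  2 <= a * L%:R -> 2 <= b * L%:R ->
  exists2 C : R, 0 < C & forall n p, (0 < n)%N -> V p ->
    N (fun x => mult (fun x => vcut (a * x)) n (L * n) p x -
                mult (fun x => vcut (b * x)) n (L * n) p x)
    <= C * N (dpow (g / n%:R) s p).
Proof.
move=> g0 /andP[a0 a2] /andP[b0 b2] L0 aL bL.
pose m x := (vcut (a * x) - vcut (b * x)) * (ix_away x * scaledB g x)^-1 ^+ s.
have nz x : ix_away x * scaledB g x != 0.
  by rewrite mulf_neq0 ?ix_away_neq0// scaledB_neq0.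
have sm : symbol m.
  apply: symbolM; first by apply: symbolB; exact: symbol_vcut.
  apply: symbolX; apply: symbolV => //.
  by apply: symbolM; [exact: symbol_ix_away|exact: symbol_scaledB].
have m0 x : L%:R <= x -> m x = 0.
  move=> Lx; rewrite /m (vcut_scale0 (ltW a0) aL Lx) (vcut_scale0 (ltW b0) bL Lx).
  by rewrite subrr mul0r.
have [C c0 HC] := rl_mult X sm L0 m0.
exists C => // n p n0 vp; have n0R : 0 < n%:R :> R by rewrite ltr0n.
have h0 : 0 < g / n%:R by rewrite divr_gt0.
have ip := rl_pint X vp.
have [vd _] := rl_dpow s h0 vp.
have := HC n _ n0 vd; congr (N _ <= _); apply/funext => x.
rewrite /mult -trigB; congr (trig _ _ _); apply/funext => j.
rewrite fourier_dpow// one_sub_avg -mulrBl mulrA; congr (_ * _); rewrite /m -mulrA -exprMn.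
set z := j%:R / n%:R.
have [zl|zg] := leP 2^-1 `|z|.
  by rewrite -ix_awayE// mulVf// expr1n mulr1.
have z1 (e : R) : 0 < e <= 2 -> `|e * z| <= 1.
  move=> /andP[c1 c2]; rewrite normrM (ger0_norm (ltW c1)).
  have -> : 1 = 2 * 2^-1 :> R by rewrite mulfV.
  by apply: ler_pM => //; [exact: ltW|exact: ltW].
by rewrite !vcut1 ?z1 ?a0 ?b0// subrr !mul0r.
Qed.

Lemma fourier_mult_Im0 m n p : symbol m ->
  complex.Im (m (0%:R / n%:R) * fourier p 0) = 0.
Proof.
move=> /symbol_Im0; rewrite mul0r; have := fourier_Im0 p.
case: (m 0) => u v; case: (fourier p 0) => u' v' /= -> ->; ring.
Qed.

Lemma multB m n J p q : pint p -> pint q ->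
  mult m n J (fun x => p x - q x) = fun x => mult m n J p x - mult m n J q x.
Proof.
move=> ip iq; apply/funext => x; rewrite /mult -trigB; congr (trig _ _ _).
by apply/funext => j; rewrite fourierB// mulrBr.
Qed.

Lemma adot_mult m n J h p : 0 < h -> pint p ->
  adot h (mult m n J p) = mult m n J (adot h p).
Proof.
move=> h0 ip; apply/funext => x; rewrite adot_trig//; congr (trig _ _ _).
by apply/funext => j; rewrite fourier_adot//; ring.
Qed.

Lemma dpow_mult m n J h s p : 0 < h -> pint p ->
  dpow h s (mult m n J p) = mult m n J (dpow h s p).
Proof.
move=> h0 ip; rewrite dpow_trig// /mult; congr trig; apply/funext => j.
by rewrite fourier_dpow//; ring.
Qed.

Lemma mult_coarser a b n L p : 0 < a -> 2 * a <= b -> (0 < n)%N ->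
  mult (fun x => vcut (a * x)) n (L * n) (mult (fun x => vcut (b * x)) n (L * n) p) =
  mult (fun x => vcut (b * x)) n (L * n) p.
Proof.
move=> a0 ab n0; rewrite mult_trig//; last exact: (@fourier_mult_Im0 (fun x => vcut (b * x)) n p (symbol_vcut b)).
congr trig; apply/funext => j; set z := j%:R / n%:R.
have z0 : 0 <= z by rewrite divr_ge0.
have [bz|bz] := leP 2 (b * z); first by rewrite (vcut0 bz) mul0r mulr0.
rewrite (@vcut1 (a * z)) ?mul1r// ger0_norm; last by rewrite mulr_ge0// ltW.
have : 2 * a * z <= b * z by rewrite ler_wpM2r.
lra.
Qed.

Lemma mult_vcut_scale M n p : (0 < M)%N ->
  mult (fun x => vcut (M%:R^-1 * x)) n (2 * M * n) p = mult vcut (M * n) (2 * (M * n)) p.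
Proof.
move=> M0; rewrite /mult mulnA; congr trig; apply/funext => j; congr (vcut _ * _).
by rewrite natrM invfM; ring.
Qed.

(** Let V_a and V_b be the cut-offs that are 1 up to M n and M n / 2. From V_a V_b = V_b, the
    remainder u = p - V_a p equals (1 - V_a) p1 with p1 = p - V_b p, so A' A' u is at most a small
    multiple of p1; and p1 - u = V_a p - V_b p is covered by [rl_band]. Hence [rl_reduce] bounds u
    by admissible terms plus half of u. *)
Lemma rl_approx_band_limited g s : 0 < g -> exists M : nat, (0 < M)%N /\
  exists2 C : R, 0 < C & forall n p, (0 < n)%N -> V p ->
    N (fun x => p x - mult (fun x => vcut (M%:R^-1 * x)) n (2 * M * n) p x) <=
    C * N (dpow (g / n%:R) s p).
Proof.
move=> g0; have [K K0 red] := rl_reduce s.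
(* The factor 1 / (2 K) cancels the K of [rl_reduce] and leaves one half. *)
have [L0 small] := rl_band_limited X g0 (divr_gt0 (@ltr01 R) (mulr_gt0 (ltr0n _ 2) K0) : 0 < 1 / (2%:R * K)).
pose M1 := L0.+1; pose M := (2 * M1)%N.
have M10 : (0 < M1)%N by []; have M0 : (0 < M)%N by [].
have M1R : 1 <= M1%:R :> R by rewrite ler1n.
have MR : M%:R = 2 * M1%:R :> R by rewrite natrM.
pose a : R := M%:R^-1; pose b : R := M1%:R^-1.
have b0 : 0 < b by rewrite invr_gt0; lra.
have b1 : b <= 1 by rewrite invf_le1; lra.
have ab : 2 * a = b by rewrite /a /b MR; field; lra.
have a0 : 0 < a by lra.
have bM : 2 <= b * (2 * M)%:R.
  rewrite natrM MR /b (_ : _ * _ = 4) ?ler_nat//; field; lra.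
have aM : 2 <= a * (2 * M)%:R.
  rewrite natrM /a (_ : _ * _ = 2)//; field; rewrite MR; lra.
have ha : 0 < a <= 2 by apply/andP; split; lra.
have hb : 0 < b <= 2 by apply/andP; split; lra.
have [Cb Cb0 Hb] := rl_band s g0 ha hb (isT : (0 < 2 * M)%N) aM bM.
exists M; split => //.
have [Cv Cv0 Hv] := rl_mult X symbol_cutoff (isT : (0 < 2)%N) (fun x => @vcut0 R x).
exists (2 * (K * (1 + Cv) + Cb)); first by rewrite mulr_gt0// addr_gt0// mulr_gt0// addr_gt0.
move=> n p n0 vp; have n0R : 0 < n%:R :> R by rewrite ltr0n.
have h0 : 0 < g / n%:R by rewrite divr_gt0.
set h := g / n%:R in h0 *; set w := dpow h s p.
have ip := rl_pint X vp; have [vw _] := rl_dpow s h0 vp; rewrite -/w in vw.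
pose Va := mult (fun x => vcut (a * x)) n (2 * M * n).
pose Vb := mult (fun x => vcut (b * x)) n (2 * M * n).
have vVa q : V (Va q) by exact: (rl_trig X).
have vVb q : V (Vb q) by exact: (rl_trig X).
have iVa q : pint (Va q) := rl_pint X (vVa q).
have iVb q : pint (Vb q) := rl_pint X (vVb q).
(* The smallness is applied to [p1] and not to p: up to an admissible term [p1] is bounded by u, so
   that its share can be absorbed. *)
pose p1 x := p x - Vb p x; pose u x := p x - Va p x.
have v1 : V p1 by exact: (rl_sub X).
have vu : V u by exact: (rl_sub X).
have i1 := rl_pint X v1.
have uE : u = fun x => p1 x - Va p1 x.
  by rewrite /p1 /Va multB// -/(Va p) -/(Vb p) /Vb mult_coarser ?ab// -/(Vb p); apply/funext => x; rewrite /u; ring.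
have VaE q : Va q = mult vcut (M * n) (2 * (M * n)) q by exact: mult_vcut_scale.
have Aw : N (dpow h s u) <= (1 + Cv) * N w.
  rewrite /u dpowB// /Va dpow_mult// -/w -/(Va w).
  rewrite (le_trans (rl_normB X vw (vVa w)))// [leRHS]mulrDl mul1r lerD2l VaE Hv//.
  by rewrite muln_gt0 M0.
have AA : adot h (adot h u) = fun x => adot h (adot h p1) x - mult vcut (M * n) (2 * (M * n)) (adot h (adot h p1)) x.
  have iA1 := pint_adot h0 i1.
  rewrite uE adotB// adotB//; last exact: pint_adot.
  by rewrite /Va !adot_mult// -/(Va _) VaE.
have A2 : N (adot h (adot h u)) <= 1 / (2 * K) * N p1.
  rewrite AA; apply: small => //.
  by rewrite (leq_trans (leqnSn L0))// /M leq_pmull.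
have P1 : N p1 <= N u + Cb * N w.
  have -> : p1 = fun x => u x + (Va p x - Vb p x) by apply/funext => x; rewrite /p1 /u; ring.
  have vab : V (fun x => Va p x - Vb p x) by exact: (rl_sub X).
  by rewrite (le_trans (rl_normD X vu vab))// lerD2l Hb.
have U := red h u h0 vu.
rewrite -/a -/(Va p) -/u.
have U2 : N u <= K * (1 + Cv) * N w + 2^-1 * (N u + Cb * N w).
  rewrite (le_trans U)// mulrDr lerD//; first by rewrite -mulrA ler_pM2l.
  rewrite (le_trans (ler_wpM2l (ltW K0) A2))// mulrA (_ : K * _ = 2^-1); last by field; lra.
  by rewrite ler_wpM2l.
have B0 : 0 <= Cb * N w by rewrite mulr_ge0 ?(ltW Cb0) ?(rl_ge0 X).
rewrite [leRHS](_ : _ = 2 * (K * (1 + Cv) * N w) + 2 * (Cb * N w)); last by ring.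
move: U2 B0; move: (N u) (K * (1 + Cv) * N w) (Cb * N w) => u1 u2 u3; clear; lra.
Qed.

(** Coefficients of the smooth cut-off of p: unchanged for j <= n / 2 and zero from j = n on, so the
    degree is at most n. *)
Definition vproj n p : nat -> R[i] := fun j => vcut (2 * (j%:R / n%:R)) * fourier p j.

Definition trig_deriv s c : nat -> R[i] := fun j => ix j%:R ^+ s * c j.

Lemma vprojE n L p : (0 < L)%N -> (0 < n)%N ->
  mult (fun x => vcut (2 * x)) n (L * n) p = trig (vproj n p) n.
Proof.
move=> L0 n0; apply/esym/trig_ext => //; first exact: leq_pmull.
move=> j /andP[nj _]; rewrite vcut0 ?mul0r// ler_peMr//.
by rewrite ler_pdivlMr ?ltr0n// mul1r ler_nat ltnW.
Qed.

Lemma rl_approximation g s : 0 < g ->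
  exists2 C : R, 0 < C & forall n p, (0 < n)%N -> V p ->
    N (fun x => p x - trig (vproj n p) n x) <= C * N (dpow (g / n%:R) s p) /\
    N (trig (trig_deriv s (vproj n p)) n) <= C * n%:R ^+ s * N (dpow (g / n%:R) s p).
Proof.
move=> g0; have [M [M0 [C1 C10 H1]]] := rl_approx_band_limited s g0.
have M1 : 1 <= M%:R :> R by rewrite ler1n.
have ha : 0 < (M%:R^-1 : R) <= 2.
  by rewrite invr_gt0 ltr0n M0 /= (@le_trans _ _ 1)// ?invf_le1// ?ltr0n//; lra.
have hb : 0 < (2 : R) <= 2 by rewrite lexx ltr0n.
have aM : 2 <= M%:R^-1 * (2 * M)%:R :> R by rewrite natrM mulrCA mulVf ?mulr1//; lra.
have bM : 2 <= 2 * (2 * M)%:R :> R by rewrite natrM; lra.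
have M2 : (0 < 2 * M)%N by rewrite muln_gt0.
have [C2 C20 H2] := rl_band s g0 ha hb M2 aM bM.
(* The s derivatives supply exactly the factor (i x)^s of the symbol of (1 - A')^s, so only the
   zero-free [scaledB] remains to be divided by. *)
pose m (x : R) := vcut (2 * x) * (scaledB g x)^-1 ^+ s.
have sm : symbol m.
  apply: symbolM; first exact: symbol_vcut.
  by apply: symbolX; apply: symbolV => [|x]; [exact: symbol_scaledB|exact: scaledB_neq0].
have m0 x : 1%:R <= x -> m x = 0.
  by move=> x1; rewrite /m vcut0 ?mul0r//; lra.
have [C3 C30 H3] := rl_mult X sm (isT : (0 < 1)%N) m0.
exists (C1 + C2 + C3); first by rewrite !addr_gt0.
move=> n p n0 vp; have n0R : 0 < n%:R :> R by rewrite ltr0n.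
have h0 : 0 < g / n%:R by rewrite divr_gt0.
have [vw _] := rl_dpow s h0 vp; set w := dpow _ _ _ in vw *.
have w0 := rl_ge0 X vw; have ip := rl_pint X vp.
split.
  have E : (fun x => p x - trig (vproj n p) n x) = fun x =>
     (p x - mult (fun x => vcut (M%:R^-1 * x)) n (2 * M * n) p x) +
     (mult (fun x => vcut (M%:R^-1 * x)) n (2 * M * n) p x -
      mult (fun x => vcut (2 * x)) n (2 * M * n) p x).
    by apply/funext => x; rewrite vprojE//; ring.
  have vm m1 n1 J : V (mult m1 n1 J p) by exact: (rl_trig X).
  rewrite E (le_trans (rl_normD X (rl_sub X vp (vm _ _ _)) (rl_sub X (vm _ _ _) (vm _ _ _))))//.
  rewrite (le_trans (lerD (H1 n p n0 vp) (H2 n p n0 vp)))// -mulrDl.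
  by rewrite ler_wpM2r// lerDl ltW.
have -> : trig (trig_deriv s (vproj n p)) n = fun x => n%:R ^+ s * mult m n (1 * n) w x.
  apply/funext => x; rewrite -trigZ mul1n; congr (trig _ _ _); apply/funext => j.
  rewrite /w fourier_dpow// one_sub_avg /trig_deriv /vproj /m realcX.
  set z := j%:R / n%:R.
  have -> : ix j%:R = n%:R%:C * ix z :> R[i].
    by rewrite -ixM /z mulrCA mulfV ?mulr1// gt_eqF.
  have B0 : scaledB g z != 0 by exact: scaledB_neq0.
  rewrite [(ix z * scaledB g z) ^+ s]exprMn [(n%:R%:C * ix z) ^+ s]exprMn exprVn.
  move: (expf_neq0 s B0).
  move: (scaledB g z ^+ s) (ix z ^+ s) (n%:R%:C ^+ s) (vcut _) (fourier p j) => b0 b1 b2 b3 b4 nb.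
  by field.
rewrite (rl_normZ X); last exact: (rl_trig X).
rewrite ger0_norm ?exprn_ge0// mulrAC mulrC.
rewrite mulrC [leRHS]mulrC ler_wpM2l ?exprn_ge0// (le_trans (H3 n w n0 vw))//.
by rewrite ler_wpM2r// lerDr addr_ge0// ltW.
Qed.

Lemma trig_deriv_Im0 s c : (0 < s)%N -> complex.Im (trig_deriv s c 0%N) = 0.
Proof.
by case: s => // s _; rewrite /trig_deriv (_ : ix 0 = 0) ?exprS ?mul0r.
Qed.

Lemma vcut_node n j : (j <= n)%N -> (0 < n)%N -> vcut (j%:R / n%:R : R) = 1.
Proof.
move=> jn n0; rewrite vcut1// ger0_norm ?divr_ge0// ler_pdivrMr ?ltr0n//.
by rewrite mul1r ler_nat.
Qed.

(** The frequencies j / n of a polynomial of degree n are at most 1, where [vcut] is 1. Multiplying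
    by it gives any symbol compact support without changing the action. As s > 0, the derivative has
    coefficient 0 at frequency 0. *)
Lemma rl_trig_multiplier m s : symbol m -> (0 < s)%N ->
  exists2 C : R, 0 < C & forall n c c', (0 < n)%N ->
    (forall j, (j <= n)%N -> c' j = n%:R%:C ^- s * (m (j%:R / n%:R) * trig_deriv s c j)) ->
    N (trig c' n) <= C * n%:R ^- s * N (trig (trig_deriv s c) n).
Proof.
move=> sm s0; pose m' (x : R) := vcut (1 * x) * m x.
have sm' : symbol m' by apply: symbolM => //; exact: symbol_vcut.
have m0 (x : R) : 2%:R <= x -> m' x = 0.
  by move=> x2; rewrite /m' mul1r vcut0 ?mul0r.
have [C1 C10 H] := rl_mult X sm' (isT : (0 < 2)%N) m0.
exists C1 => // n c c' n0 E; have n0R : 0 < n%:R :> R by rewrite ltr0n.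
have -> : trig c' n = fun x => n%:R ^- s * mult m' n (2 * n) (trig (trig_deriv s c) n) x.
  rewrite mult_trig; [|exact: leq_pmull|exact: trig_deriv_Im0].
  apply/funext => x; rewrite -trigZ; apply: eq_bigr => j _.
  have jn : (j <= n)%N by rewrite -ltnS.
  congr (complex.Re (_ * _)); rewrite E// /m' mul1r vcut_node// mul1r; congr (_ * _).
  by rewrite -realcX fmorphV.
rewrite (rl_normZ X); last exact: (rl_trig X).
rewrite ger0_norm ?invr_ge0 ?exprn_ge0// mulrAC (mulrC (n%:R ^- s)) ler_wpM2r ?invr_ge0 ?exprn_ge0//.
by apply: H => //; exact: (rl_trig X).
Qed.

Lemma rl_dpow_trig g s : 0 < g -> (0 < s)%N ->
  exists2 C : R, 0 < C & forall n c, (0 < n)%N ->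
    N (dpow (g / n%:R) s (trig c n)) <= C * n%:R ^- s * N (trig (trig_deriv s c) n).
Proof.
move=> g0 s0; have sm : symbol (fun x => scaledB g x ^+ s).
  by apply: symbolX; exact: symbol_scaledB.
have [C1 C10 H] := rl_trig_multiplier sm s0.
exists C1 => // n c n0; have n0R : 0 < n%:R :> R by rewrite ltr0n.
rewrite dpow_trig ?divr_gt0//; apply: H => // j jn.
rewrite one_sub_avg /trig_deriv; set z := j%:R / n%:R.
have nc : n%:R%:C != 0 :> R[i] by rewrite realc_neq0// gt_eqF.
have -> : ix j%:R = n%:R%:C * ix z :> R[i].
  by rewrite -ixM /z mulrCA mulfV ?mulr1// gt_eqF.
rewrite [(ix z * scaledB g z) ^+ s]exprMn [(n%:R%:C * ix z) ^+ s]exprMn.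
move: (expf_neq0 s nc).
by move: (scaledB g z ^+ s) (ix z ^+ s) (n%:R%:C ^+ s) (c j) => b0 b1 b2 b3 nb; field.
Qed.

(** The symbol of (1 - A)^r carries (i x)^(2r). The derivative takes s of these powers, and s <= 2r
    keeps the remaining (i x)^(2r - s) an admissible symbol. *)
Lemma rl_cpow_trig g r s : 0 < g -> (0 < s)%N -> (s <= 2 * r)%N ->
  exists2 C : R, 0 < C & forall n c, (0 < n)%N ->
    N (cpow (g / n%:R) r (trig c n)) <= C * n%:R ^- s * N (trig (trig_deriv s c) n).
Proof.
move=> g0 s0 sr.
have sm : symbol (fun x => ix x ^+ (2 * r - s) * ((g ^+ 2)%:C * symB2 (g * x)) ^+ r).
  apply: symbolM; first by apply: symbolX; exact: symbol_ix.
  apply: symbolX; apply: symbolM; first exact: symbol_cst.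
  exact: (symbol_scale g symbol_B2).
have [C1 C10 H] := rl_trig_multiplier sm s0.
exists C1 => // n c n0; have n0R : 0 < n%:R :> R by rewrite ltr0n.
rewrite cpow_trig ?divr_gt0//; apply: H => // j jn.
rewrite one_sub_centered_symbol /trig_deriv; set z := j%:R / n%:R.
have nc : n%:R%:C != 0 :> R[i] by rewrite realc_neq0// gt_eqF.
have -> : ix j%:R = n%:R%:C * ix z :> R[i].
  by rewrite -ixM /z mulrCA mulfV ?mulr1// gt_eqF.
rewrite (_ : g / n%:R * j%:R = g * z); last by rewrite /z; ring.
rewrite (ixM g) realcX; set S := symB2 _.
have -> : ((g%:C * ix z) ^+ 2 * S) ^+ r = ix z ^+ (2 * r) * (g%:C ^+ 2 * S) ^+ r.
  by rewrite exprM -[RHS]exprMn; congr (_ ^+ r); ring.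
rewrite -[in ix z ^+ (2 * r)](subnK sr) exprD [(n%:R%:C * ix z) ^+ s]exprMn.
move: (expf_neq0 s nc).
move: (ix z ^+ _) (ix z ^+ s) ((g%:C ^+ 2 * S) ^+ r) (n%:R%:C ^+ s) (c j) => b0 b1 b2 b3 b4 nb.
by field.
Qed.

(** A polynomial of degree n is reproduced by the cut-off multiplier, so [mult_bound] controls its
    values near x by averages around x. This is the pointwise source of the Marcinkiewicz-type
    inequality for the nodes. *)
Lemma trig_local (d : R) : 0 < d -> exists2 C : R, 0 < C & forall n c x y, (0 < n)%N ->
  complex.Im (c 0%N) = 0 -> `|x - y| <= d / n%:R ->
  `|trig c n y| <= C * maxop d n (fun t => `|trig c n t|) x.
Proof.
move=> d0; have sm := @symbol_cutoff R.
have [C1 C10 H] := mult_bound sm (isT : (0 < 2)%N) d0 (fun x => @vcut0 R x).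
exists C1 => // n c x y n0 c0 xy.
have := H n (trig c n) x y n0 (pint_trig c n) xy.
rewrite (@mult_id _ _ n (2 * n) n c)// => [z /andP[z0 z1]|]; last exact: leq_pmull.
by apply: vcut1; rewrite ger0_norm.
Qed.

Lemma acenD h p q x : pint p -> pint q ->
  acen h (fun x => p x + q x) x = acen h p x + acen h q x.
Proof. by move=> ip iq; rewrite /acen itgD// mulrDr. Qed.

(* [1 - (1 - A)^r = A (1 + (1 - A) + ... + (1 - A)^(r-1))] averages its argument,
   hence is controlled at every point of a cell by the mean over a neighbourhood. *)
Lemma cpow_local g d r : 0 < g -> 0 < d -> exists2 C : R, 0 < C & forall n p, (0 < n)%N -> V p ->
  exists w, [/\ V w, N w <= C * N p, forall x, 0 <= w x &
    forall x y, `|x - y| <= d / n%:R -> `|p y - cpow (g / n%:R) r p y| <= w x].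
Proof.
move=> g0 d0; have c0 := rl_const X.
have c10 : 0 < 1 + C0 by rewrite addr_gt0.
pose S := \sum_(i < r) (1 + C0) ^+ i.
have S0 : 0 <= S by apply: sumr_ge0 => i _; rewrite exprn_ge0// ltW.
(* The ratio of the window lengths H = h + 2 d / n and h = g / n: the window of length h around y
   lies in that of length H around x. *)
have [b b0 bE] : exists2 b, 0 < b & b = (g + 2 * d) / g.
  by exists ((g + 2 * d) / g) => //; rewrite divr_gt0// addr_gt0// mulr_gt0.
have S1 : 0 < S + 1 by rewrite ltr_wpDl.
exists (b * C0 * (S + 1)); first by rewrite mulr_gt0// mulr_gt0.
move=> n p n0 vp; have n0R : 0 < n%:R :> R by rewrite ltr0n.
have h0 : 0 < g / n%:R by rewrite divr_gt0.
set h := g / n%:R in h0 *.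
pose v x := \sum_(i < r) cpow h i p x.
have [||vv Nv] := @rl_sum _ _ _ _ X (fun i => cpow h i p) (fun i => (1 + C0) ^+ i * N p) r.
- by move=> i; exact: (rl_cpow i h0 vp).1.
- by move=> i _; exact: (rl_cpow i h0 vp).2.
rewrite -/v in vv Nv; rewrite -mulr_suml -/S in Nv.
have E k y : p y - cpow h k p y = acen h (fun x => \sum_(i < k) cpow h i p x) y.
  elim: k => [|r' IH].
    rewrite subrr (_ : (fun x => _) = fun=> 0); last by apply/funext => x; rewrite big_ord0.
    by rewrite /acen /itg /Rintegral integral0 mulr0.
  rewrite (_ : (fun x => _) = fun x => \sum_(i < r') cpow h i p x + cpow h r' p x); last first.
    by apply/funext => x; rewrite big_ord_recr.
  rewrite acenD; last 2 first.
  - by apply: (pint_sum (F := fun i => cpow h i p)) => i; exact: (rl_pint X (rl_cpow i h0 vp).1).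
  - exact: (rl_pint X (rl_cpow r' h0 vp).1).
  by rewrite -IH /= -/(cpow h r' p); ring.
pose H := (g + 2 * d) / n%:R; have H0 : 0 < H by rewrite divr_gt0// addr_gt0// mulr_gt0.
have [va na] := rl_abs X vv.
have [vH NH] := rl_cen X H0 va.
have iv := rl_pint X vv; have iva := rl_pint X va.
exists (fun x => b * acen H (fun t => `|v t|) x); split.
- exact: (rl_scale X).
- rewrite (rl_normZ X b vH) ger0_norm ?(ltW b0)// -!mulrA ler_pM2l//.
  apply: (le_trans NH); rewrite ler_pM2l// na (le_trans Nv)// ler_wpM2r ?(rl_ge0 X)// lerDl//.
- by move=> x; rewrite !mulr_ge0 ?(ltW b0) ?itg_ge0// invr_ge0 ltW.
- move=> x y; rewrite ler_norml E -/v => /andP[xy1 xy2].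
  rewrite /acen normrM ger0_norm ?invr_ge0 ?(ltW h0)//.
  have -> : b * (H^-1 * itg (x - H / 2) (x + H / 2) (fun t => `|v t|)) =
      h^-1 * itg (x - H / 2) (x + H / 2) (fun t => `|v t|).
    rewrite mulrA; congr (_ * _); rewrite bE /H /h; field.
    by rewrite !gt_eqF//= addr_gt0// mulr_gt0.
  rewrite ler_wpM2l ?invr_ge0 ?(ltW h0)// (le_trans (itg_norm _ _ iv))//.
  have HE : H / 2 = h / 2 + d / n%:R by rewrite /H /h; field; rewrite gt_eqF.
  by apply: itgS => //; rewrite HE; lra.
Qed.

End realization.

(** * Periodic Borel representatives of Lebesgue measurable functions *)

Section lebesgue_measurable_functions.
Context {R : realType}.
Notation mu := (@lebesgue_measure R).
Implicit Types (f g : R -> R) (x : R).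

Lemma borel_lebesgue (A : set R) : measurable A -> @measurable _ (lebesgueR R) A.
Proof. exact: sub_caratheodory. Qed.

Lemma measurable_id_leb : measurable_fun (setT : set (lebesgueR R)) (fun x : lebesgueR R => x : measurableTypeR R).
Proof. by move=> _ A mA; rewrite setTI; exact: borel_lebesgue. Qed.

Lemma borel_leb g : measurable_fun setT g ->
  measurable_fun (setT : set (lebesgueR R)) g.
Proof.
move=> mg _ A mA; rewrite setTI; apply: borel_lebesgue.
by rewrite -[_ @^-1` _]setTI; exact: mg.
Qed.

(** Change of variables along the identity, seen as a measurable map from the Lebesgue to the Borel
    sets. *)
Lemma ge0_integral_leb (D : set R) (F : R -> \bar R) : measurable D -> measurable_fun setT F ->
  (forall x, 0 <= F x)%E ->
  (\int[leb R]_(x in (D : set (lebesgueR R))) F x = \int[mu]_(x in D) F x)%E.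
Proof.
move=> mD mF F0.
have H := @ge0_integral_pushforward _ _ _ _ R _ measurable_id_leb (leb R) D F.
rewrite -[LHS]H//; last exact: measurable_funS mF.
Qed.

Lemma Rintegral_leb (D : set R) g : measurable D -> measurable_fun setT g ->
  \int[leb R]_(x in (D : set (lebesgueR R))) g x = \int[mu]_(x in D) g x.
Proof.
move=> mD mg; rewrite /Rintegral; congr fine; rewrite integralE [in RHS]integralE.
have mE : measurable_fun setT (EFin \o g) by exact/measurable_EFinP.
congr (_ - _)%E.
- apply: (@ge0_integral_leb D ((EFin \o g)^\+)%E) => //; exact: measurable_funepos.
- apply: (@ge0_integral_leb D ((EFin \o g)^\-)%E) => //; exact: measurable_funeneg.
Qed.

Lemma ae_leb_filter : Filter (almost_everywhere (leb R)).
Proof. exact: ae_filter_ringOfSetsType. Qed.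

Lemma ae_leb1 (P Q : R -> Prop) : (forall x, P x -> Q x) ->
  (\forall x \ae leb R, P x) -> \forall x \ae leb R, Q x.
Proof. exact: (@filterS _ _ ae_leb_filter). Qed.

Lemma ae_leb2 (P1 P2 Q : R -> Prop) : (forall x, P1 x -> P2 x -> Q x) ->
  (\forall x \ae leb R, P1 x) -> (\forall x \ae leb R, P2 x) -> \forall x \ae leb R, Q x.
Proof. exact: (@filterS2 _ _ ae_leb_filter). Qed.

Lemma ae_lebT (P : R -> Prop) : (forall x, P x) -> \forall x \ae leb R, P x.
Proof. exact: (@filterE _ _ ae_leb_filter). Qed.

Lemma ae_Rintegral_leb (D : set (lebesgueR R)) f g : measurable D ->
  measurable_fun (setT : set (lebesgueR R)) f -> measurable_fun (setT : set (lebesgueR R)) g ->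
  (\forall x \ae leb R, f x = g x) ->
  \int[leb R]_(x in D) f x = \int[leb R]_(x in D) g x.
Proof.
move=> mD mf mg fg.
have H : \forall x \ae leb R, D x -> (f x)%:E = (g x)%:E.
  by apply: ae_leb1 fg => x ->.
rewrite /Rintegral; congr fine; apply: ae_eq_integral => //.
- by apply: measurable_funTS; exact/measurable_EFinP.
- by apply: measurable_funTS; exact/measurable_EFinP.
Qed.

Lemma lebesgue_set_borel (E : set R) : @measurable _ (lebesgueR R) E ->
  exists A B : set R, [/\ measurable A, measurable B, mu B = 0%E & A `\` B = E `\` B].
Proof.
move=> mE; have : (completed_algebra_gen mu).-sigma.-measurable E.
  by rewrite completed_caratheodory_measurable.
rewrite g_sigma_completed_algebra_genE => -[A mA [M [B [mB B0 MB]] AME]].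
exists A, B; split => //; rewrite -AME setDUl.
by rewrite (_ : M `\` B = set0) ?setU0//; apply/seteqP; split => // x [Mx]; case; exact: MB.
Qed.

(** Each set where f exceeds a rational is Borel outside a Borel null set, and B is the countable
    union of these null sets. Larger sets B' are allowed so that a periodic one can be used. *)
Lemma null_borel_rep f : measurable_fun (setT : set (lebesgueR R)) f ->
  exists B : set R, [/\ measurable B, mu B = 0%E & forall B' : set R, measurable B' -> B `<=` B' ->
    measurable_fun setT (fun x => f x * \1_(~` B') x)].
Proof.
move=> mf; pose q (k : nat) : R := ratr (odflt 0 (unpickle k)).
have mE k : @measurable _ (lebesgueR R) [set x | q k < f x].
  have := mf measurableT `]q k, +oo[%classic; rewrite setTI (_ : f @^-1` _ = [set x | q k < f x]).
    by apply; exact: measurable_itv.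
  by apply/seteqP; split => x /=; rewrite in_itv/= andbT.
pose A k := projT1 (cid (lebesgue_set_borel (mE k))).
pose B k := projT1 (cid (projT2 (cid (lebesgue_set_borel (mE k))))).
have AB k : [/\ measurable (A k), measurable (B k), mu (B k) = 0%E &
    A k `\` B k = [set x | q k < f x] `\` B k].
  exact: (projT2 (cid (projT2 (cid (lebesgue_set_borel (mE k)))))).
have mB : measurable (\bigcup_k B k) by apply: bigcupT_measurable => k; have [] := AB k.
exists (\bigcup_k B k); split => //.
  have : mu.-negligible (\bigcup_k B k).
    by apply: negligible_bigcup => k; apply/negligibleP; have [] := AB k.
  by move/negligibleP; exact.
move=> B' mB' BB'.
move=> mD; apply: (measurability _ (RGenOInfty.measurableE R)) => //.
move=> _ [_ [r ->] <-]; rewrite setTI.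
have mr : measurable ([set x | r < f x] `&` ~` B').
  have -> : [set x | r < f x] `&` ~` B' = \bigcup_k (if r <= q k then A k `&` ~` B' else set0).
    apply/seteqP; split => x.
      move=> [/= rf nB]; have [z] := rat_in_itvoo rf; rewrite in_itv/= => /andP[rz zf].
      have qz : q (pickle z) = ratr z by rewrite /q pickleK.
      exists (pickle z) => //; rewrite qz ltW//; split => //.
      have [_ _ _ E] := AB (pickle z).
      have : ([set x | q (pickle z) < f x] `\` B (pickle z)) x.
        by rewrite /= qz; split => // Bx; apply: nB; apply: BB'; exists (pickle z).
      by rewrite -E => -[].
    move=> [k _]; case: ifP => // rq [Ax nB]; split => //=.
    have [_ _ _ E] := AB k.
    have : (A k `\` B k) x by split => // Bx; apply: nB; apply: BB'; exists k.
    by rewrite E => -[/= h _]; exact: le_lt_trans h.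
  apply: bigcupT_measurable => k; case: ifP => // _; apply: measurableI.
    by have [] := AB k.
  exact: measurableC.
(* The modified function is 0 on B', which thus belongs to the superlevel set exactly when r < 0. *)
have [r0|r0] := leP 0 r.
  rewrite (_ : _ @^-1` _ = [set x | r < f x] `&` ~` B')//.
  apply/seteqP; split => x /=; rewrite in_itv/= andbT indicE.
    case: (boolP (x \in _)) => [/set_mem h|_]; first by rewrite mulr1.
    by rewrite mulr0 ltNge r0.
  by move=> [h nB]; rewrite mem_set// mulr1.
rewrite (_ : _ @^-1` _ = ([set x | r < f x] `&` ~` B') `|` B'); first exact: measurableU.
apply/seteqP; split => x /=; rewrite in_itv/= andbT indicE.
  case: (boolP (x \in _)) => [/set_mem h|/negP h _]; first by rewrite mulr1; left.
  by right; apply: contrapT => nB; apply: h; exact: mem_set.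
case=> [[h nB]|Bx]; first by rewrite mem_set// mulr1.
by rewrite memNset ?mulr0// => nB; apply: nB.
Qed.

Definition periodized (A : set R) : set R := [set y | exists j : int, A (y + 2 * pi * j%:~R)].

Lemma periodizedE (A : set R) : periodized A =
  \bigcup_k (fun y : R => y + 2 * pi * (odflt 0 (unpickle k) : int)%:~R) @^-1` A.
Proof.
apply/seteqP; split => y; last by move=> [k _ h]; exists (odflt 0 (unpickle k)).
by move=> [j h]; exists (pickle j) => //; rewrite /= pickleK.
Qed.

Lemma measurable_periodized (A : set R) : measurable A -> measurable (periodized A).
Proof.
move=> mA; rewrite periodizedE; apply: bigcupT_measurable => k.
rewrite -[_ @^-1` _]setTI.
exact: (measurable_addr (2 * pi * (odflt 0 (unpickle k) : int)%:~R)).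
Qed.

Lemma periodized_null (A : set R) : measurable A -> mu A = 0%E -> mu (periodized A) = 0%E.
Proof.
move=> mA A0; have : mu.-negligible (periodized A); last first.
  by move/negligibleP; apply; exact: measurable_periodized.
rewrite periodizedE; apply: negligible_bigcup => k.
pose t : R := 2 * pi * (odflt 0 (unpickle k) : int)%:~R.
apply/negligibleP; last by rewrite -A0 -[RHS](lebesgue_measure_addr t mA).
by rewrite -[_ @^-1` _]setTI; exact: (measurable_addr t).
Qed.

Lemma periodizedD (A : set R) y : periodized A (y + 2 * pi) <-> periodized A y.
Proof.
split=> -[j h].
  by exists (j + 1); move: h; congr A; rewrite rmorphD/=; ring.
by exists (j - 1); move: h; congr A; rewrite rmorphB/=; ring.
Qed.

(** The null set is replaced by the union of its translates by periods, still null. The last clause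
    keeps the imaginary part identically 0 in the case of real scalars. *)
Lemma borel_rep f : measurable_fun (setT : set (lebesgueR R)) f ->
  (forall x, f (x + 2 * pi) = f x) -> exists g, [/\ measurable_fun setT g,
  (forall x, g (x + 2 * pi) = g x), (\forall x \ae leb R, f x = g x) &
  forall x, f x = 0 -> g x = 0].
Proof.
move=> mf pf; have [B [mB B0 HB]] := null_borel_rep mf.
have mB' := measurable_periodized mB; have B'0 := periodized_null mB B0.
set B' := periodized B in mB' B'0.
have BB' : B `<=` B' by move=> x Bx; exists 0; rewrite mulr0 addr0.
exists (fun x => f x * \1_(~` B') x); split.
- exact: HB.
- move=> x; rewrite pf; congr (_ * _); rewrite !indicE; congr (nat_of_bool _)%:R.
  have E := periodizedD B x.
  by apply/idP/idP => /set_mem h; apply/mem_set => h'; apply: h; apply/E.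
- exists B'; split => //; first exact: borel_lebesgue.
  move=> x /= fx; apply: contrapT => nB; apply: fx.
  by rewrite indicE mem_set// mulr1.
- by move=> x ->; rewrite mul0r.
Qed.

End lebesgue_measurable_functions.

Section complex_norms.
Context {R : realType}.
Implicit Types (z w : R[i]) (a b : R).

Local Notation normc := ComplexField.Normc.normc.

Lemma le_norm_normc z w : (`|z| <= `|w|) = (normc z <= normc w).
Proof. by rewrite -lecR. Qed.

Lemma normc_realc a : normc a%:C = `|a|.
Proof. by rewrite /= expr0n/= addr0 sqrtr_sqr. Qed.

Lemma normc_Re z : `|complex.Re z| <= normc z.
Proof. by case: z => a b /=; rewrite -sqrtr_sqr ler_wsqrtr// lerDl sqr_ge0. Qed.

Lemma normc_Im z : `|complex.Im z| <= normc z.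
Proof. by case: z => a b /=; rewrite -sqrtr_sqr ler_wsqrtr// lerDr sqr_ge0. Qed.

Lemma normc_le_sum z : normc z <= `|complex.Re z| + `|complex.Im z|.
Proof.
case: z => a b /=; rewrite -[leRHS]ger0_norm ?addr_ge0// -sqrtr_sqr ler_wsqrtr//.
rewrite sqrrD !real_normK ?num_real// addrAC lerDl mulrn_wge0// mulr_ge0//.
Qed.

End complex_norms.

(** * The real lattice induced by X *)

Section induced_real_lattice.
Context {R : realType} {K : scalars} (X : banach_lattice R K).
Hypothesis hA : assumption_A X.
Notation mu := (@lebesgue_measure R).
Implicit Types (p q : R -> R) (h x y a : R).

Definition emb p : R -> R[i] := fun x => (p x)%:C.

Definition real_part_set : set (R -> R) := [set p | [/\ measurable_fun setT p,
  (forall x, p (x + 2 * pi) = p x) & bl_set X (emb p)]].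

Definition real_part_norm p : R := bl_norm X (emb p).

Lemma in_scalars_realc a : in_scalars K a%:C.
Proof. by case: K. Qed.

Lemma measurable_circle_emb p : measurable_fun setT p ->
  (forall x, p (x + 2 * pi) = p x) -> measurable_circle K (emb p).
Proof.
move=> mp pp; split; first by move=> x; rewrite /emb pp.
- by move=> x; exact: in_scalars_realc.
- exact: borel_leb.
- exact: measurable_cst.
Qed.

(** The integral axiom, applied to the whole circle, bounds the integral of |p| over a period by its
    norm. *)
Lemma real_part_pint p : real_part_set p -> pint p.
Proof.
move=> [mp pp Xp]; split => //.
have mE : circle_set (`[- pi, pi[%classic : set R).
  by split => //; apply: borel_lebesgue; exact: measurable_itv.
have [c c0 Hc] := bl_integral X mE.
have := Hc _ Xp; rewrite /circle_int_norm.
set I := (\int[leb R]_(x in _) _)%E => HI.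
have Iy : (I < +oo)%E.
  rewrite ltey; apply/negP => /eqP E; move: HI; rewrite E.
  rewrite gt0_muley ?lte_fin ?invr_gt0 ?mulr_gt0 ?pi_gt0//.
have IE : I = (\int[mu]_(x in `[(- pi)%R, pi[) `|(p x)%:E|)%E.
  rewrite -(@ge0_integral_leb _ _ (fun x => `|(p x)%:E|%E)).
  - by apply: eq_integral => x _; rewrite normc_realc.
  - exact: measurable_itv.
  - by apply: measurableT_comp => //; exact/measurable_EFinP.
  - by [].
apply/integrableP; split; first by apply: measurable_funTS; exact/measurable_EFinP.
rewrite -integral_itv_bndo_bndc.
  by rewrite IE in Iy.
by apply: measurable_funTS; apply: measurableT_comp => //; exact/measurable_EFinP.
Qed.

Lemma real_part_ideal p q : measurable_fun setT p ->
  (forall x, p (x + 2 * pi) = p x) -> bl_set X (emb q) ->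
  (\forall x \ae leb R, `|p x| <= `|q x|) ->
  real_part_set p /\ real_part_norm p <= real_part_norm q.
Proof.
move=> mp pp Xq pq.
have [Xp Np] : bl_set X (emb p) /\ bl_norm X (emb p) <= bl_norm X (emb q).
  apply: bl_ideal => //; first exact: measurable_circle_emb.
  by apply: ae_leb1 pq => x; rewrite le_norm_normc !normc_realc.
by split.
Qed.

Lemma chi_circle x : chi (`[- pi, pi[%classic : set R) x = 1.
Proof.
rewrite /chi indicE mem_set//=.
have [y [j [ypi ->]]] := period_rep x.
by exists (- j); rewrite rmorphN/= in_itv/= mulrN addrK.
Qed.

Lemma steklovE h p x : measurable_fun setT p ->
  steklov h (emb p) x = (acen h p x)%:C.
Proof.
move=> mp; rewrite /steklov /acen /itg.
have mI : measurable (`[x - h / 2, x + h / 2]%classic : set R) by exact: measurable_itv.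
apply: complexP => /=.
  by rewrite Rintegral_leb.
by rewrite (_ : Rintegral _ _ _ = 0) ?mulr0// /Rintegral integral0.
Qed.

Lemma measurable_acen h p : pint p -> measurable_fun setT (acen h p).
Proof.
move=> ip; rewrite (_ : acen h p = (adot h p) \o (fun x => x + - (h / 2))).
  apply: measurableT_comp; last exact: measurable_addr.
  by apply: measurable_funM => //; exact: measurable_itg_window.
by apply/funext => x; rewrite acen_adot.
Qed.

Lemma acen_periodic h p x : pint p -> acen h p (x + 2 * pi) = acen h p x.
Proof. by move=> ip; rewrite !acen_adot addrAC adot_periodic. Qed.

Lemma real_part_lattice : exists C0, real_lattice real_part_set real_part_norm C0.
Proof.
have [hA1 [C HC]] := hA; exists (Num.max C 1); split.
- exact: real_part_pint.
- move=> p q [mp pp Xp] [mq pq Xq]; split.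
  + exact: measurable_funD.
  + by move=> x; rewrite pp pq.
  + have := bl_add Xp Xq; congr (bl_set X); apply/funext => x.
    by rewrite /emb rmorphD.
- move=> a p [mp pp Xp]; split.
  + exact: measurable_funM.
  + by move=> x; rewrite pp.
  + have := bl_scale (in_scalars_realc a) Xp; congr (bl_set X); apply/funext => x.
    by rewrite /emb rmorphM.
- by move=> p [_ _ Xp]; exact: bl_norm_ge0.
- move=> p q [_ _ Xp] [_ _ Xq]; have := bl_normD Xp Xq.
  by congr (bl_norm X _ <= _); apply/funext => x; rewrite /emb rmorphD.
- move=> a p [_ _ Xp]; have := bl_normZ (in_scalars_realc a) Xp.
  rewrite normc_realc => <-; congr (bl_norm X _); apply/funext => x.
  by rewrite /emb rmorphM.
- move=> p q mp pp [mq pq Xq] pq'; apply: real_part_ideal => //.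
  exact: ae_lebT.
- split; [exact: measurable_cst|by []|].
  have mE : circle_set (`[- pi, pi[%classic : set R).
    by split => //; apply: borel_lebesgue; exact: measurable_itv.
  have := bl_chi X mE; congr (bl_set X); apply/funext => x; exact: chi_circle.
- by rewrite lt_max ltr01 orbT.
- move=> h p h0 vp; have ip := real_part_pint vp; have [mp pp Xp] := vp.
  have SE : steklov h (emb p) = emb (acen h p) by apply/funext => x; exact: steklovE.
  have Xa : bl_set X (emb (acen h p)) by rewrite -SE; exact: hA1.
  split.
    split => //; first exact: measurable_acen.
    by move=> x; exact: acen_periodic.
  have C1 : C <= Num.max C 1 by rewrite le_max lexx.
  have M1 : 0 < Num.max C 1 by rewrite lt_max ltr01 orbT.
  (* Assumption A is given on the unit ball. A function of norm 0 cannot be normalized, but it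
     vanishes almost everywhere and all its averages are 0; the other functions are rescaled. *)
  rewrite /real_part_norm -SE; have := bl_norm_ge0 Xp; rewrite le_eqVlt => /orP[/eqP N0|N0].
    rewrite -N0 mulr0 SE le_eqVlt; apply/orP; left; apply/eqP/(bl_norm_eq0 Xa).
    apply: ae_lebT => x; rewrite /emb /acen.
    have /(bl_norm_eq0 Xp) p0 := esym N0.
    rewrite (_ : itg _ _ _ = 0) ?mulr0// /itg -Rintegral_leb//.
    have m0 : measurable_fun (setT : set (lebesgueR R)) (fun=> 0 : R) by exact: measurable_cst.
    rewrite (@ae_Rintegral_leb R _ p (fun=> 0) _ (borel_leb mp) m0).
    + by rewrite /Rintegral integral0.
    + by apply: borel_lebesgue; exact: measurable_itv.
    + by apply: ae_leb1 p0 => y; rewrite /emb => /eqP; rewrite eq_complex /= => /andP[/eqP].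
  set n := bl_norm X (emb p) in N0 *.
  have sc := in_scalars_realc n^-1.
  have Xs := bl_scale sc Xp.
  have Ns : bl_norm X (fun x => n^-1%:C * emb p x) <= 1.
    by rewrite bl_normZ// normc_realc ger0_norm ?invr_ge0 ?(ltW N0)// mulVf// gt_eqF.
  have := HC h _ h0 Xs Ns.
  have -> : steklov h (fun x => n^-1%:C * emb p x) = fun x => n^-1%:C * steklov h (emb p) x.
    apply/funext => x; rewrite SE.
    have -> : (fun x => n^-1%:C * emb p x) = emb (fun x => n^-1 * p x).
      by apply/funext => y; rewrite /emb rmorphM.
    rewrite steklovE; last exact: measurable_funM.
    by rewrite /emb -rmorphM /acen itgZ//; congr (_%:C); ring.
  rewrite bl_normZ//; last by rewrite SE.
  rewrite normc_realc ger0_norm ?invr_ge0 ?(ltW N0)// ler_pdivrMl// => H.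
  by rewrite (le_trans H)// mulrC ler_wpM2r// ltW.
Qed.

End induced_real_lattice.

(** * Passage from members of X to their representatives *)

Section representatives.
Context {R : realType} {K : scalars} (X : banach_lattice R K).
Hypothesis hA : assumption_A X.
Implicit Types (p q : R -> R) (f g : R -> R[i]) (h x y a b : R) (r s : nat).

Let V := real_part_set X.
Let N := real_part_norm X.

Definition cfun p q : R -> R[i] := fun x => p x +i* q x.

(* Borel representatives of the real and imaginary parts of a member of X. *)
Definition rep f p q : Prop :=
  [/\ bl_set X f, V p, V q, (\forall x \ae leb R, f x = cfun p q x) &
      (K = RealScalars -> forall x, q x = 0)].

Lemma rep_exists f : bl_set X f -> exists p q, rep f p q.
Proof.
move=> Xf; have [pf sf mr mi] := bl_measurable Xf.
have [|p [mp pp ep zp]] := borel_rep mr; first by move=> x; rewrite pf.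
have [|q [mq pq eq zq]] := borel_rep mi; first by move=> x; rewrite pf.
exists p, q.
have ideal (u : R -> R) : measurable_fun setT u -> (forall x, u (x + 2 * pi) = u x) ->
    (\forall x \ae leb R, `|u x| <= ComplexField.Normc.normc (f x)) -> V u.
  move=> mu pu le_u; split => //.
  suff [] : bl_set X (emb u) /\ bl_norm X (emb u) <= bl_norm X f by [].
  apply: (bl_ideal (measurable_circle_emb (K := K) mu pu) Xf).
  by apply: ae_leb1 le_u => x; rewrite le_norm_normc normc_realc.
split => //.
- by apply: ideal => //; apply: ae_leb1 ep => x <-; exact: normc_Re.
- by apply: ideal => //; apply: ae_leb1 eq => x <-; exact: normc_Im.
- by apply: ae_leb2 ep eq => x; rewrite /cfun => <- <-; case: (f x).
- by move=> KR x; apply: zq; have := sf x; rewrite KR.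
Qed.

(** From |Re f|, |Im f| <= |f| <= |Re f| + |Im f| and the ideal property. Complex estimates thereby
    reduce to two real ones at the price of a factor 2. *)
Lemma rep_norm f p q : rep f p q ->
  [/\ N p <= bl_norm X f, N q <= bl_norm X f & bl_norm X f <= N p + N q].
Proof.
move=> [Xf [mp pp Xp] [mq pq Xq] e _]; split.
- suff [] : bl_set X (emb p) /\ bl_norm X (emb p) <= bl_norm X f by [].
  apply: (bl_ideal (measurable_circle_emb (K := K) mp pp) Xf).
  apply: ae_leb1 e => x ->; rewrite le_norm_normc normc_realc; exact: (normc_Re (cfun p q x)).
- suff [] : bl_set X (emb q) /\ bl_norm X (emb q) <= bl_norm X f by [].
  apply: (bl_ideal (measurable_circle_emb (K := K) mq pq) Xf).
  apply: ae_leb1 e => x ->; rewrite le_norm_normc normc_realc; exact: (normc_Im (cfun p q x)).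
have [C0 L] := real_part_lattice hA.
have vp : V p by []. have vq : V q by [].
have [va na] := rl_abs L vp; have [vb nb] := rl_abs L vq.
rewrite /N -na -nb; apply: le_trans (rl_normD L va vb).
have [_ _ Xs] := rl_add L va vb.
suff [] : bl_set X f /\ bl_norm X f <= bl_norm X (emb (fun x => `|p x| + `|q x|)) by [].
apply: (bl_ideal (bl_measurable Xf) Xs).
apply: ae_leb1 e => x ->; rewrite le_norm_normc normc_realc ger0_norm ?addr_ge0//.
exact: (normc_le_sum (cfun p q x)).
Qed.

Lemma rep_cfun p q : V p -> V q -> (K = RealScalars -> forall x, q x = 0) -> rep (cfun p q) p q.
Proof.
move=> vp vq q0; split => //; last exact: ae_lebT.
have [C0 L] := real_part_lattice hA.
have [va na] := rl_abs L vp; have [vb nb] := rl_abs L vq.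
have [_ _ Xs] := rl_add L va vb.
have [mp pp _] := vp; have [mq pq _] := vq.
suff [] : bl_set X (cfun p q) /\ bl_norm X (cfun p q) <= bl_norm X (emb (fun x => `|p x| + `|q x|)) by [].
apply: (fun H => bl_ideal H Xs); last first.
- apply: ae_lebT => x; rewrite le_norm_normc normc_realc ger0_norm ?addr_ge0//.
  exact: (normc_le_sum (cfun p q x)).
- split; first by move=> x; rewrite /cfun pp pq.
  + by move=> x; case: (K) q0 => // q0; rewrite /= q0.
  + exact: borel_leb.
  + exact: borel_leb.
Qed.

Lemma bl_sub f g : bl_set X f -> bl_set X g -> bl_set X (fun x => f x - g x).
Proof.
move=> Xf Xg; have := bl_add Xf (bl_scale (in_scalars_realc (K := K) (-1 : R)) Xg).
congr (bl_set X); apply/funext => x; congr (_ + _).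
by rewrite (_ : (-1)%:C = -1) ?mulN1r// rmorphN rmorph1.
Qed.

Lemma bl_normB f g : bl_set X f -> bl_set X g ->
  bl_norm X (fun x => f x - g x) <= bl_norm X f + bl_norm X g.
Proof.
move=> Xf Xg; have sc := in_scalars_realc (K := K) (-1 : R).
have := bl_normD Xf (bl_scale sc Xg); rewrite bl_normZ// normc_realc normrN normr1 mul1r.
congr (bl_norm X _ <= _); apply/funext => x; congr (_ + _).
by rewrite (_ : (-1)%:C = -1) ?mulN1r// rmorphN rmorph1.
Qed.

Lemma rep_sub f g p q p' q' : rep f p q -> rep g p' q' ->
  rep (fun x => f x - g x) (fun x => p x - p' x) (fun x => q x - q' x).
Proof.
move=> [Xf vp vq e z] [Xg vp' vq' e' z']; have [C0 L] := real_part_lattice hA.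
split; first exact: bl_sub.
- exact: (rl_sub L).
- exact: (rl_sub L).
- apply: ae_leb2 e e' => x -> ->; exact: complexP.
- by move=> KR x; rewrite z// z'// subrr.
Qed.

Lemma rep_steklov h f p q x : rep f p q ->
  steklov h f x = cfun (acen h p) (acen h q) x.
Proof.
move=> [Xf [mp pp _] [mq pq _] e _]; have [_ _ mr mi] := bl_measurable Xf.
have mI : measurable (`[x - h / 2, x + h / 2]%classic : set R) by exact: measurable_itv.
have mL : @measurable _ (lebesgueR R) `[x - h / 2, x + h / 2]%classic by exact: borel_lebesgue.
rewrite /steklov /cfun /acen /itg -!Rintegral_leb//.
apply: complexP => /=; congr (_ * _);
  apply: ae_Rintegral_leb => //.
- exact: borel_leb.
- by apply: ae_leb1 e => y ->.
- exact: borel_leb.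
- by apply: ae_leb1 e => y ->.
Qed.

Lemma rep_steklov_dot h f p q x : rep f p q ->
  steklov_dot h f x = cfun (adot h p) (adot h q) x.
Proof. by move=> hr; rewrite /steklov_dot (rep_steklov _ _ hr) /cfun !acen_adot addrK. Qed.

Lemma itg_zero a b p : (forall x, p x = 0) -> itg a b p = 0.
Proof.
by move=> p0; rewrite /itg /Rintegral (_ : p = fun=> 0) ?integral0//; apply/funext.
Qed.

Lemma rep_dpow h s f p q : 0 < h -> rep f p q ->
  rep (id_minus_pow (steklov_dot h) s f) (dpow h s p) (dpow h s q).
Proof.
move=> h0 hf; elim: s => //= s IH; have [C0 L] := real_part_lattice hA.
have [_ v1 v2 _ z] := IH.
have hc : rep (cfun (adot h (dpow h s p)) (adot h (dpow h s q))) (adot h (dpow h s p)) (adot h (dpow h s q)).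
  apply: rep_cfun; [exact: (rl_adot L h0 v1).1|exact: (rl_adot L h0 v2).1|].
  by move=> KR x; rewrite /adot itg_zero ?mulr0//; exact: z.
have := rep_sub IH hc; congr rep; apply/funext => x.
by rewrite (rep_steklov_dot _ _ IH).
Qed.

(** Averages depend only on the class of f, so the difference between f and its representative
    passes through (1 - A)^r unchanged. This is recorded at every point because the discrete norm
    reads the values of f itself at the nodes. *)
Lemma rep_cpow h r f p q : 0 < h -> rep f p q ->
  rep (id_minus_pow (steklov h) r f) (cpow h r p) (cpow h r q) /\
  forall x, id_minus_pow (steklov h) r f x = f x - cfun p q x + cfun (cpow h r p) (cpow h r q) x.
Proof.
move=> h0 hf; have [C0 L] := real_part_lattice hA.
elim: r => [|r [IH1 IH2]]; first by split => // x; rewrite subrK.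
have [_ v1 v2 _ z] := IH1.
have hc : rep (cfun (acen h (cpow h r p)) (acen h (cpow h r q))) (acen h (cpow h r p)) (acen h (cpow h r q)).
  apply: rep_cfun; [exact: (rl_cen L h0 v1).1|exact: (rl_cen L h0 v2).1|].
  by move=> KR x; rewrite /acen itg_zero ?mulr0//; exact: z.
split.
  have := rep_sub IH1 hc; congr rep; apply/funext => x.
  by rewrite /= -/(id_minus_pow (steklov h) r f) (rep_steklov _ _ IH1).
move=> x; rewrite /= -/(id_minus_pow (steklov h) r f) (rep_steklov _ _ IH1) IH2 -addrA.
by congr (_ + _).
Qed.

End representatives.

(** * The discrete semi-norm and its local majorants *)

Section discrete_norm.
Context {R : realType} {K : scalars} (X : banach_lattice R K).
Hypothesis hA : assumption_A X.
Implicit Types (p : R -> R) (f g : R -> R[i]) (h y t a b : R) (m k : nat) (x : nat -> R).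

Let V := real_part_set X.
Let N := real_part_norm X.

Lemma normc_ge0 (z : R[i]) : 0 <= ComplexField.Normc.normc z.
Proof. by case: z => a b; exact: sqrtr_ge0. Qed.

(** Real-valued form of the function inside [discrete_norm]; being bounded and Borel, it lies in the
    real lattice for every f. *)
Definition node_step m x f t : R :=
  \sum_(1 <= k < m.+1) ComplexField.Normc.normc (f (x k)) * \1_(periodized `[x k, x k.+1[) t.

Lemma node_step_ge0 m x f t : 0 <= node_step m x f t.
Proof.
apply: sumr_ge0 => k _; apply: mulr_ge0; first exact: normc_ge0.
by rewrite indicE.
Qed.

Lemma real_part_node_step m x f : V (node_step m x f).
Proof.
have [C0 L] := real_part_lattice hA.
have H t : `|node_step m x f t| <= \sum_(1 <= k < m.+1) ComplexField.Normc.normc (f (x k)).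
  rewrite ger0_norm ?node_step_ge0//; apply: ler_sum => k _.
  apply: ler_piMr; first exact: normc_ge0.
  by rewrite indicE; case: (_ \in _).
apply: (rl_bounded L _ H); apply: (pint_bounded _ _ H).
- apply: measurable_sum => k; apply: measurable_funM => //.
  by apply: measurable_indic; apply: measurable_periodized; exact: measurable_itv.
- move=> t; apply: eq_bigr => k _; congr (_ * _); rewrite !indicE; congr (nat_of_bool _)%:R.
  by apply/idP/idP => /set_mem h; apply/mem_set; apply/periodizedD.
Qed.

Lemma discrete_normE m x f : discrete_norm X m x f = N (node_step m x f).
Proof.
rewrite /discrete_norm /N /real_part_norm; congr (bl_norm X _); apply/funext => t.
rewrite /emb rmorph_sum/=; apply: eq_bigr => k _.
by rewrite rmorphM.
Qed.

Lemma discrete_norm_ge0 m x f : 0 <= discrete_norm X m x f.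
Proof. by rewrite discrete_normE; have [C0 L] := real_part_lattice hA; exact/(rl_ge0 L)/real_part_node_step. Qed.

Lemma eq_discrete_norm m x f g : (forall t, f t = g t) -> discrete_norm X m x f = discrete_norm X m x g.
Proof. by move=> /funext ->. Qed.

Lemma discrete_normD m x f g :
  discrete_norm X m x (fun t => f t + g t) <= discrete_norm X m x f + discrete_norm X m x g.
Proof.
have [C0 L] := real_part_lattice hA; rewrite !discrete_normE.
have vf := real_part_node_step m x f; have vg := real_part_node_step m x g.
apply: le_trans (rl_normD L vf vg).
apply: (proj2 (rl_dom L (rl_pint L (real_part_node_step m x _)) (rl_add L vf vg) _)) => t.
rewrite !ger0_norm ?addr_ge0 ?node_step_ge0// -big_split/=; apply: ler_sum => k _.
by rewrite -mulrDl ler_wpM2r ?indicE// le_normcD.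
Qed.

Lemma discrete_normN m x f : discrete_norm X m x (fun t => - f t) = discrete_norm X m x f.
Proof.
rewrite !discrete_normE; congr N; apply/funext => t; apply: eq_bigr => k _.
by rewrite normcN.
Qed.

Lemma discrete_normB m x f g :
  discrete_norm X m x (fun t => f t - g t) <= discrete_norm X m x f + discrete_norm X m x g.
Proof. by rewrite -[in leRHS](discrete_normN m x g); exact: discrete_normD. Qed.

Section nodes.
Context {gamma gamma' : R} {n m : nat} {x : nat -> R}.
Hypotheses (g0 : 0 < gamma) (g'0 : 0 < gamma') (n0 : (0 < n)%N) (hx : nodes gamma gamma' n m x).

Lemma node_lt k : (1 <= k <= m)%N -> x k < x k.+1.
Proof.
move=> km; have [_ _ /(_ k km)/andP[h _]] := hx.
by rewrite -subr_gt0 (lt_le_trans _ h)// divr_gt0// ltr0n.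
Qed.

Lemma node_le k l : (1 <= k <= l)%N -> (l <= m.+1)%N -> x k <= x l.
Proof.
move=> /andP[k1]; elim: l => [|l IH]; first by case: k k1.
rewrite leq_eqVlt => /orP[/eqP ->//|]; rewrite ltnS => kl lm.
apply: (le_trans (IH kl (ltnW lm))); apply/ltW/node_lt.
by rewrite (leq_trans k1 kl).
Qed.

(** The translates of t in the cells k < l are distinct, the one in cell l being larger by at least
    2 pi. It would then lie beyond x 1 + 2 pi, the right end of the last cell. *)
Lemma periodized_cell_lt k l t : (1 <= k < l)%N -> (l <= m)%N ->
  periodized `[x k, x k.+1[ t -> periodized `[x l, x l.+1[ t -> False.
Proof.
move=> /andP[k1 kl] lm -[i ti] -[j tj].
move: ti tj; rewrite /= !in_itv/= => /andP[a1 a2] /andP[b1 b2].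
have [_ xm _] := hx.
have h1 : x 1%N <= x k by apply: node_le; rewrite ?k1// (leq_trans (ltnW kl))// (leq_trans lm).
have h2 : x k.+1 <= x l by apply: node_le; rewrite ?kl// (leq_trans lm).
have h3 : x l.+1 <= x m.+1 by apply: node_le; rewrite ?ltnS ?lm.
have P0 := @pi_gt0 R.
have ij : i < j.
  rewrite -(ltr_int R) -(ltr_pM2l (mulr_gt0 (ltr0Sn R 1) P0)); lra.
have : (i + 1)%:~R <= j%:~R :> R by rewrite ler_int lezD1.
rewrite rmorphD/= -(ler_pM2l (mulr_gt0 (ltr0Sn R 1) P0)) mulrDr mulr1; lra.
Qed.

(** The periodized cells are disjoint, so at most one term is non-zero at t, and a translate of t by
    periods is within gamma' / n of its node. *)
Lemma node_step_le f u : pint u -> (forall t, 0 <= u t) ->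
  (forall k t, (1 <= k <= m)%N -> `|t - x k| <= gamma' / n%:R ->
    ComplexField.Normc.normc (f (x k)) <= u t) ->
  forall t, node_step m x f t <= u t.
Proof.
move=> iu u0 H t; rewrite /node_step.
have [[k [km kt]]|hn] := pselect (exists k, (1 <= k <= m)%N /\ periodized `[x k, x k.+1[ t); last first.
  rewrite big_nat big1// => k; rewrite ltnS => km.
  by rewrite indicE memNset ?mulr0// => h; apply: hn; exists k.
have kin : k \in index_iota 1 m.+1 by rewrite mem_index_iota ltnS.
rewrite (bigD1_seq k)//= ?iota_uniq// indicE mem_set// mulr1 big_seq_cond big1 ?addr0.
  have [j] := kt; rewrite /= in_itv/= => /andP[a1 a2].
  have [_ pu _] := iu; rewrite -(periodic_int t j pu); apply: H => //.
  have [_ _ /(_ k km)/andP[_ h]] := hx.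
  by rewrite ger0_norm ?subr_ge0// (le_trans _ h)// lerD2r ltW.
move=> l /andP[]; rewrite mem_index_iota ltnS => lm lk.
rewrite indicE memNset ?mulr0// => lt; move: lk; rewrite neq_ltn => /orP[] lk.
  by apply: (periodized_cell_lt _ _ lt kt); rewrite ?lk ?(andP lm).1 ?(andP km).2.
by apply: (periodized_cell_lt _ _ kt lt); rewrite ?lk ?(andP km).1 ?(andP lm).2.
Qed.

Lemma discrete_norm_local f u : V u -> (forall t, 0 <= u t) ->
  (forall k t, (1 <= k <= m)%N -> `|t - x k| <= gamma' / n%:R ->
    ComplexField.Normc.normc (f (x k)) <= u t) ->
  discrete_norm X m x f <= N u.
Proof.
move=> vu u0 H; have [C0 L] := real_part_lattice hA; rewrite discrete_normE.
apply: (proj2 (rl_dom L (rl_pint L (real_part_node_step m x f)) vu _)) => t.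
rewrite !ger0_norm ?node_step_ge0//; exact: node_step_le (rl_pint L vu) u0 H t.
Qed.

End nodes.
End discrete_norm.

(** * Trigonometric polynomials, their coefficients and derivatives *)

Section derivatives_of_trig.
Context {R : realType}.
Implicit Types (c : nat -> R[i]) (x : R) (J n s j : nat).

Lemma is_derive_cis (z : R[i]) j x : is_derive x 1 (fun y => complex.Re (z * cis (j%:R * y)))
  (complex.Re (ix j%:R * z * cis (j%:R * x))).
Proof.
case: z => a b; rewrite (_ : (fun y => _) = fun y => a * cos (j%:R * y) - b * sin (j%:R * y))//.
apply: is_derive_eq; rewrite /GRing.scale/= /GRing.scale/=.
by move: (j%:R : R) => k; ring.
Qed.

Lemma is_derive_trig c J x :
  is_derive x 1 (trig c J) (trig (fun j => ix j%:R * c j) J x).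
Proof.
elim: J => [|J IH].
  rewrite (_ : trig c 0 = fun y => complex.Re (c 0%N * cis (0%:R * y))); last first.
    by apply/funext => y; rewrite /trig big_ord1.
  rewrite (_ : trig _ 0 x = complex.Re (ix 0%:R * c 0%N * cis (0%:R * x))).
    exact: is_derive_cis.
  by rewrite /trig big_ord1.
rewrite (_ : trig c J.+1 = trig c J + fun y => complex.Re (c J.+1 * cis (J.+1%:R * y))); last first.
  by apply/funext => y; rewrite /trig big_ord_recr.
rewrite (_ : trig _ J.+1 x = trig (fun j => ix j%:R * c j) J x
    + complex.Re (ix J.+1%:R * c J.+1 * cis (J.+1%:R * x))).
  by apply: is_deriveD => //; exact: is_derive_cis.
by rewrite /trig big_ord_recr.
Qed.

Lemma derive1n_trig s c J : derive1n s (trig c J) = trig (trig_deriv s c) J.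
Proof.
elim: s => [|s IH].
  by rewrite derive1n0; congr trig; apply/funext => j; rewrite /trig_deriv mul1r.
rewrite derive1nS IH; apply/funext => x; rewrite derive1E.
have D := is_derive_trig (trig_deriv s c) J x; rewrite derive_val.
by congr (trig _ J x); apply/funext => j; rewrite /trig_deriv exprS mulrA.
Qed.

Lemma trigE c n x : trig c n x = complex.Re (c 0%N) +
  \sum_(1 <= j < n.+1) (complex.Re (c j) * cos (j%:R * x) - complex.Im (c j) * sin (j%:R * x)).
Proof.
rewrite /trig -(big_mkord xpredT (fun j => complex.Re (c j * cis (j%:R * x)))) big_ltn//.
congr (_ + _).
  by rewrite mul0r /cis cos0 sin0; case: (c 0%N) => a b /=; rewrite mulr1 mulr0 subr0.
by apply: eq_bigr => j _; case: (c j).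
Qed.

Lemma Re_sum n (F : nat -> R[i]) :
  complex.Re (\sum_(1 <= j < n) F j) = \sum_(1 <= j < n) complex.Re (F j).
Proof. exact: (big_morph _ (@raddfD _ _ (@complex.Re R)) (erefl _)). Qed.

Lemma Im_sum n (F : nat -> R[i]) :
  complex.Im (\sum_(1 <= j < n) F j) = \sum_(1 <= j < n) complex.Im (F j).
Proof. exact: (big_morph _ (@raddfD _ _ (@complex.Im R)) (erefl _)). Qed.

Lemma trig0 n x : trig (fun=> 0 : R[i]) n x = 0.
Proof. by rewrite /trig big1// => j _; rewrite mul0r. Qed.

End derivatives_of_trig.

Section trigonometric_polynomials.
Context {R : realType} {K : scalars} (X : banach_lattice R K).
Hypothesis hA : assumption_A X.
Implicit Types (p q : R -> R) (f T : R -> R[i]) (h t a b d : R) (n j : nat) (c : nat -> R[i]).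

Let V := real_part_set X.
Let N := real_part_norm X.

(* [c] and [c'] are the coefficients of the real and of the imaginary part. *)
Definition trig_coeffs T n c c' : Prop :=
  [/\ complex.Im (c 0%N) = 0, complex.Im (c' 0%N) = 0,
      K = RealScalars -> forall j, c' j = 0 & T = cfun (trig c n) (trig c' n)].

Lemma trig_poly_coeffs n T : trig_poly K n T -> exists c c', trig_coeffs T n c c'.
Proof.
move=> [a [b [sab ET]]].
(* The combination a cos + b sin is the real part of (a - i b) e^(i j t); the constant term has no
   sine companion, so its coefficient is taken real. *)
exists (fun j => if j is 0 then (complex.Re (a 0%N))%:C else complex.Re (a j) +i* - complex.Re (b j)).
exists (fun j => if j is 0 then (complex.Im (a 0%N))%:C else complex.Im (a j) +i* - complex.Im (b j)).
split => //.
  move=> KR [|j]; first by have [] := sab 0%N; rewrite KR /= => ->.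
  by have [] := sab j.+1; rewrite KR /= => -> ->; rewrite oppr0.
apply/funext => t; rewrite ET /cfun !trigE/=.
apply: complexP => /=.
  rewrite raddfD /= Re_sum; congr (_ + _); rewrite !big_nat; apply: eq_bigr => -[|j]// _.
  by case: (a _) => ? ?; case: (b _) => ? ? /=; ring.
rewrite raddfD /= Im_sum; congr (_ + _); rewrite !big_nat; apply: eq_bigr => -[|j]// _.
by case: (a _) => ? ?; case: (b _) => ? ? /=; ring.
Qed.

Lemma trig_coeffs_poly n T c c' : trig_coeffs T n c c' -> trig_poly K n T.
Proof.
move=> [c0 c'0 z ->].
exists (fun j => complex.Re (c j) +i* complex.Re (c' j)).
exists (fun j => - complex.Im (c j) +i* - complex.Im (c' j)).
split.
  by move=> j; case: (K) z => //= /(_ erefl j) ->; rewrite oppr0.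
move=> t; rewrite /cfun !trigE.
apply: complexP => /=.
  by rewrite raddfD /= Re_sum; congr (_ + _); apply: eq_bigr => j _ /=; ring.
by rewrite raddfD /= Im_sum; congr (_ + _); apply: eq_bigr => j _ /=; ring.
Qed.

Lemma trig_polyB n T T' : trig_poly K n T -> trig_poly K n T' -> trig_poly K n (fun t => T t - T' t).
Proof.
move=> [a [b [sab ET]]] [a' [b' [sab' ET']]].
exists (fun j => a j - a' j), (fun j => b j - b' j); split.
  by move=> j; have := sab j; have := sab' j; case: (K) => //= -[] h1 h2 [] h3 h4;
    rewrite !raddfB/= h1 h2 h3 h4 subr0.
move=> t; rewrite ET ET' opprD addrACA -sumrB; congr (_ + _).
by apply: eq_bigr => j _; ring.
Qed.

Lemma rep_trig n T c c' : trig_coeffs T n c c' -> rep X T (trig c n) (trig c' n).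
Proof.
move=> [_ _ z ->]; have [C0 L] := real_part_lattice hA.
apply: rep_cfun => //; [exact: (rl_trig L)|exact: (rl_trig L)|].
by move=> KR t; rewrite (_ : c' = fun=> 0) ?trig0//; apply/funext => j; exact: z.
Qed.

Lemma bl_trig n T : trig_poly K n T -> bl_set X T.
Proof. by move=> /trig_poly_coeffs[c [c' /rep_trig[]]]. Qed.

Lemma rep_derivative n T c c' s : trig_coeffs T n c c' ->
  rep X (nth_derivative s T) (trig (trig_deriv s c) n) (trig (trig_deriv s c') n).
Proof.
move=> [_ _ z ->]; have [C0 L] := real_part_lattice hA.
rewrite (_ : nth_derivative _ _ = cfun (trig (trig_deriv s c) n) (trig (trig_deriv s c') n)).
  apply: rep_cfun => //; [exact: (rl_trig L)|exact: (rl_trig L)|].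
  move=> KR t; rewrite (_ : trig_deriv s c' = fun=> 0) ?trig0//.
  by apply/funext => j; rewrite /trig_deriv z// mulr0.
by apply/funext => t; rewrite /nth_derivative /cfun -!derive1n_trig.
Qed.

Lemma rep_N_le f p q a b : rep X f p q -> N p <= a -> N q <= b -> bl_norm X f <= a + b.
Proof. by move=> /(rep_norm hA)[_ _ h] pa qb; rewrite (le_trans h)// lerD. Qed.

Lemma trig_poly_approximation d s : 0 < d -> exists2 C : R, 0 < C &
  forall n f, (0 < n)%N -> bl_set X f -> exists T, [/\ trig_poly K n T,
    bl_norm X (fun t => f t - T t) <= C * bl_norm X (id_minus_pow (steklov_dot (d / n%:R)) s f) &
    n%:R ^- s * bl_norm X (nth_derivative s T) <=
      C * bl_norm X (id_minus_pow (steklov_dot (d / n%:R)) s f)].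
Proof.
move=> d0; have [C0 L] := real_part_lattice hA.
have [C C1 H] := rl_approximation L s d0.
(* The factor 2 adds up the estimates for the real and the imaginary part. *)
exists (C * 2); first by rewrite mulr_gt0.
move=> n f n0 Xf; have [p [q hf]] := rep_exists Xf.
have n0R : 0 < n%:R :> R by rewrite ltr0n.
have h0 : 0 < d / n%:R by rewrite divr_gt0.
have [_ vp vq _ zq] := hf.
have hT : trig_coeffs (cfun (trig (vproj n p) n) (trig (vproj n q) n)) n (vproj n p) (vproj n q).
  split => //.
  - exact: (@fourier_mult_Im0 _ (fun x => vcut (2 * x)) n p (symbol_vcut 2)).
  - exact: (@fourier_mult_Im0 _ (fun x => vcut (2 * x)) n q (symbol_vcut 2)).
  - move=> KR j; rewrite /vproj (_ : fourier q j = 0) ?mulr0//.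
    rewrite /fourier /fcos /fsin !itg_zero ?mulr0 ?oppr0// => t; by rewrite zq// mul0r.
exists (cfun (trig (vproj n p) n) (trig (vproj n q) n)).
have [Np Nq _] := rep_norm hA (rep_dpow hA s h0 hf).
have [H1 H2] := H n p n0 vp; have [H3 H4] := H n q n0 vq.
have e (w : R) : C * 2 * w = C * w + C * w by rewrite -mulrA mulrDl mul1r mulrDr.
split; first exact: trig_coeffs_poly hT.
- rewrite e; apply: (rep_N_le (rep_sub hA hf (rep_trig hT))).
  + by rewrite (le_trans H1)// ler_pM2l.
  + by rewrite (le_trans H3)// ler_pM2l.
- have ns : 0 < n%:R ^+ s :> R by rewrite exprn_gt0.
  rewrite ler_pdivrMl// e mulrDr; apply: (rep_N_le (rep_derivative s hT)).
  + by rewrite (le_trans H2)// [leRHS]mulrCA mulrA ler_wpM2l// mulr_ge0// ltW.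
  + by rewrite (le_trans H4)// [leRHS]mulrCA mulrA ler_wpM2l// mulr_ge0// ltW.
Qed.

Lemma steklov_dot_pow_trig d s : 0 < d -> (0 < s)%N -> exists2 C : R, 0 < C &
  forall n T, (0 < n)%N -> trig_poly K n T ->
    bl_norm X (id_minus_pow (steklov_dot (d / n%:R)) s T) <=
      C * (n%:R ^- s * bl_norm X (nth_derivative s T)).
Proof.
move=> d0 s0; have [C0 L] := real_part_lattice hA.
have [C C1 H] := rl_dpow_trig L d0 s0.
exists (C * 2); first by rewrite mulr_gt0.
move=> n T n0 /trig_poly_coeffs[c [c' hT]].
have n0R : 0 < n%:R :> R by rewrite ltr0n.
have h0 : 0 < d / n%:R by rewrite divr_gt0.
have [Np Nq _] := rep_norm hA (rep_derivative s hT).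
have e (w : R) : C * 2 * w = C * w + C * w by rewrite -mulrA mulrDl mul1r mulrDr.
have c0 : 0 <= C * n%:R ^- s by rewrite mulr_ge0 ?invr_ge0 ?exprn_ge0// ltW.
rewrite e !mulrA; apply: (rep_N_le (rep_dpow hA s h0 (rep_trig hT))).
- by rewrite (le_trans (H n c n0))// ler_wpM2l.
- by rewrite (le_trans (H n c' n0))// ler_wpM2l.
Qed.

End trigonometric_polynomials.

(** * Linearity of the powers on X, and their discrete norms *)

Section linear_powers.
Context {R : realType} (A : (R -> R[i]) -> R -> R[i]) (S : set (R -> R[i])).
Hypothesis AS : forall f, S f -> S (A f).
Hypothesis SB : forall f g, S f -> S g -> S (fun x => f x - g x).
Hypothesis AB : forall f g x, S f -> S g -> A (fun y => f y - g y) x = A f x - A g x.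

Lemma id_minus_pow_mem j f : S f -> S (id_minus_pow A j f).
Proof. by move=> Sf; elim: j => //= j IH; apply: SB => //; exact: AS. Qed.

(** Additivity is asked for only on a stable set S, since integrals are additive on integrable
    functions. *)
Lemma id_minus_powB j f g : S f -> S g -> id_minus_pow A j (fun x => f x - g x) =
  fun x => id_minus_pow A j f x - id_minus_pow A j g x.
Proof.
move=> Sf Sg; elim: j => //= j IH; apply/funext => x.
rewrite -!/(id_minus_pow A j _) IH AB; [by ring|exact: id_minus_pow_mem|exact: id_minus_pow_mem].
Qed.

End linear_powers.

Section steklov_powers.
Context {R : realType} {K : scalars} (X : banach_lattice R K).
Hypothesis hA : assumption_A X.
Implicit Types (p q : R -> R) (f g : R -> R[i]) (h t : R) (r s : nat) (c : nat -> R[i]).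

Let V := real_part_set X.
Let N := real_part_norm X.

Lemma bl_steklov_dot h f : 0 < h -> bl_set X f -> bl_set X (steklov_dot h f).
Proof.
move=> h0 Xf; have [p [q hf]] := rep_exists Xf; have [C0 L] := real_part_lattice hA.
have [_ vp vq _ z] := hf.
have -> : steklov_dot h f = cfun (adot h p) (adot h q).
  by apply/funext => t; exact: rep_steklov_dot hf.
have [] : rep X (cfun (adot h p) (adot h q)) (adot h p) (adot h q); last by [].
apply: rep_cfun => //; [exact: (rl_adot L h0 vp).1|exact: (rl_adot L h0 vq).1|].
by move=> KR t; rewrite /adot itg_zero ?mulr0//; exact: z.
Qed.

Lemma steklovB h f g t : bl_set X f -> bl_set X g ->
  steklov h (fun y => f y - g y) t = steklov h f t - steklov h g t.
Proof.
move=> Xf Xg; have [C0 L] := real_part_lattice hA.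
have [p [q hf]] := rep_exists Xf; have [p' [q' hg]] := rep_exists Xg.
have [_ /(rl_pint L) vp /(rl_pint L) vq _ _] := hf.
have [_ /(rl_pint L) vp' /(rl_pint L) vq' _ _] := hg.
by rewrite (rep_steklov h t hf) (rep_steklov h t hg) (rep_steklov h t (rep_sub hA hf hg)) /cfun !acenB.
Qed.

Lemma steklov_powB h r f g : 0 < h -> bl_set X f -> bl_set X g ->
  id_minus_pow (steklov h) r (fun t => f t - g t) =
  fun t => id_minus_pow (steklov h) r f t - id_minus_pow (steklov h) r g t.
Proof.
move=> h0; apply: id_minus_powB => [{}f|{}f {}g|{}f {}g t]; last exact: steklovB.
- exact: hA.1.
- exact: bl_sub.
Qed.

Lemma steklov_dot_powB h s f g : 0 < h -> bl_set X f -> bl_set X g ->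
  id_minus_pow (steklov_dot h) s (fun t => f t - g t) =
  fun t => id_minus_pow (steklov_dot h) s f t - id_minus_pow (steklov_dot h) s g t.
Proof.
move=> h0; apply: id_minus_powB => [{}f|{}f {}g|{}f {}g t Xf Xg]; last exact: steklovB.
- exact: bl_steklov_dot.
- exact: bl_sub.
Qed.

Lemma bl_steklov_dot_pow h s f : 0 < h -> bl_set X f -> bl_set X (id_minus_pow (steklov_dot h) s f).
Proof. by move=> h0 Xf; have [p [q /(rep_dpow hA s h0)[]]] := rep_exists Xf. Qed.

Lemma steklov_dot_pow_bounded s : exists2 C : R, 0 < C & forall h f, 0 < h -> bl_set X f ->
  bl_norm X (id_minus_pow (steklov_dot h) s f) <= C * bl_norm X f.
Proof.
have [C0 L] := real_part_lattice hA; have c0 := rl_const L.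
have C1 : 0 < (1 + 2 * C0) ^+ s by rewrite exprn_gt0// addr_gt0// mulr_gt0.
exists ((1 + 2 * C0) ^+ s * 2); first by rewrite mulr_gt0.
move=> h f h0 Xf; have [p [q hf]] := rep_exists Xf; have [_ vp vq _ _] := hf.
have [Np Nq _] := rep_norm hA hf.
move: C1 (rl_dpow L s h0 vp).2 (rl_dpow L s h0 vq).2.
move: ((1 + 2 * C0) ^+ s) => C C1 H1 H2.
have -> : C * 2 * bl_norm X f = C * bl_norm X f + C * bl_norm X f by ring.
apply: (rep_N_le hA (rep_dpow hA s h0 hf)).
- by rewrite (le_trans H1)// ler_pM2l.
- by rewrite (le_trans H2)// ler_pM2l.
Qed.

Section nodes.
Context {gamma gamma' : R}.
Hypotheses (g0 : 0 < gamma) (g'0 : 0 < gamma').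

Lemma discrete_norm_steklov d r : 0 < d -> exists2 C : R, 0 < C & forall n m x f,
  (0 < n)%N -> nodes gamma gamma' n m x -> bl_set X f ->
  discrete_norm X m x (fun t => f t - id_minus_pow (steklov (d / n%:R)) r f t) <= C * bl_norm X f.
Proof.
move=> d0; have [C0 L] := real_part_lattice hA.
have [C C1 H] := cpow_local L r d0 g'0.
exists (C * 2); first by rewrite mulr_gt0.
move=> n m x f n0 hx Xf; have [p [q hf]] := rep_exists Xf; have [_ vp vq _ _] := hf.
have h0 : 0 < d / n%:R by rewrite divr_gt0// ltr0n.
have [Np Nq _] := rep_norm hA hf.
have [_ E] := rep_cpow hA r h0 hf.
have [w [vw Nw w0 pw]] := H n p n0 vp; have [w' [vw' Nw' w'0 qw']] := H n q n0 vq.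
apply: (@le_trans _ _ (N (fun t => w t + w' t))).
  apply: (discrete_norm_local hA g0 n0 hx (rl_add L vw vw')) => [t|k t km tx]; first exact: addr_ge0.
  apply: le_trans (lerD (pw t (x k) tx) (qw' t (x k) tx)).
  (* By the pointwise identity [E] the node values of f cancel, and what remains is p - (1 - A)^r p
     and its analogue for q. *)
  rewrite E opprD addrA opprB addrCA subrr addr0.
  exact: normc_le_sum (cfun p q (x k) - cfun (cpow _ r p) (cpow _ r q) (x k)).
apply: le_trans (rl_normD L vw vw') _.
have -> : C * 2 * bl_norm X f = C * bl_norm X f + C * bl_norm X f by ring.
by apply: lerD; [rewrite (le_trans Nw)// ler_pM2l|rewrite (le_trans Nw')// ler_pM2l].
Qed.

(** The two parts are kept separate so that, for (1 - A)^r T, each can be bounded by its own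
    derivative in [discrete_norm_steklov_trig]. *)
Lemma discrete_norm_coeffs : exists2 C : R, 0 < C & forall n m x T c c',
  (0 < n)%N -> nodes gamma gamma' n m x -> trig_coeffs (K := K) T n c c' ->
  discrete_norm X m x T <= C * (N (trig c n) + N (trig c' n)).
Proof.
have [C0 L] := real_part_lattice hA; have c0 := rl_const L.
have [C C1 H] := trig_local g'0.
exists (C * (2 * C0)); first by rewrite !mulr_gt0.
move=> n m x T c c' n0 hx [ic ic' z ET].
have [v1 n1] := rl_maxop L g'0 n0 (rl_trig L c n).
have [v2 n2] := rl_maxop L g'0 n0 (rl_trig L c' n).
set w := maxop _ _ _ in v1 n1; set w' := maxop _ _ _ in v2 n2.
have v1' := rl_scale L C v1; have v2' := rl_scale L C v2.
have B k t : `|t - x k| <= gamma' / n%:R -> ComplexField.Normc.normc (T (x k)) <= C * w t + C * w' t.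
  move=> tx; rewrite ET; apply: le_trans (normc_le_sum _) _ => /=.
  by apply: lerD; apply: H.
have w0 t : 0 <= C * w t + C * w' t.
  apply: le_trans (lerD (H n c t t n0 ic _) (H n c' t t n0 ic' _)).
  - by rewrite addr_ge0.
  - by rewrite subrr normr0 divr_ge0// ltW.
  - by rewrite subrr normr0 divr_ge0// ltW.
apply: le_trans (discrete_norm_local hA g0 n0 hx (rl_add L v1' v2') w0 _) _ => [k t _|]; first exact: B.
apply: le_trans (rl_normD L v1' v2') _.
rewrite (rl_normZ L C v1) (rl_normZ L C v2) (ger0_norm (ltW C1)) -mulrDr -mulrA ler_pM2l//.
by rewrite mulrDr lerD.
Qed.

Lemma discrete_norm_trig : exists2 C : R, 0 < C & forall n m x T,
  (0 < n)%N -> nodes gamma gamma' n m x -> trig_poly K n T ->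
  discrete_norm X m x T <= C * bl_norm X T.
Proof.
have [C C1 H] := discrete_norm_coeffs; exists (C * 2); first by rewrite mulr_gt0.
move=> n m x T n0 hx /trig_poly_coeffs[c [c' hT]].
apply: le_trans (H _ _ _ _ _ _ n0 hx hT) _.
have [Np Nq _] := rep_norm hA (rep_trig hA hT).
by rewrite -mulrA ler_pM2l// mulrDl mul1r lerD.
Qed.

Lemma discrete_norm_steklov_trig d r s : 0 < d -> (0 < r)%N -> (0 < s)%N -> (s <= 2 * r)%N ->
  exists2 C : R, 0 < C & forall n m x T, (0 < n)%N -> nodes gamma gamma' n m x -> trig_poly K n T ->
  discrete_norm X m x (id_minus_pow (steklov (d / n%:R)) r T) <=
    C * (n%:R ^- s * bl_norm X (nth_derivative s T)).
Proof.
move=> d0 r0 s0 sr; have [C0 L] := real_part_lattice hA.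
have [C C1 H] := discrete_norm_coeffs; have [C' C1' H'] := rl_cpow_trig L d0 s0 sr.
exists (C * (C' * 2)); first by rewrite !mulr_gt0.
move=> n m x T n0 hx /trig_poly_coeffs[c [c' hT]].
have n0R : 0 < n%:R :> R by rewrite ltr0n.
have h0 : 0 < d / n%:R by rewrite divr_gt0.
have [[Xg vp vq _ z] E] := rep_cpow hA r h0 (rep_trig hA hT).
set b := fun j => (1 - avg_symbol (d / n%:R * j%:R) * cis (- (2^-1 * (d / n%:R * j%:R)))) ^+ r.
(* As r > 0, the multiplier of (1 - A)^r vanishes at frequency 0, which settles the conditions at 0
   in [trig_coeffs]. *)
have b0 : b 0%N = 0.
  rewrite /b !mulr0 oppr0.
  have -> : cis (0 : R) = 1 by rewrite /cis cos0 sin0.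
  by rewrite mulr1 one_sub_avg_symbol (_ : ix 0 = 0)// mul0r expr0n; case: (r) r0.
have hg : trig_coeffs (K := K) (id_minus_pow (steklov (d / n%:R)) r T) n
    (fun j => b j * c j) (fun j => b j * c' j).
  have [_ _ zc ET] := hT.
  split; [by rewrite b0 mul0r|by rewrite b0 mul0r|by move=> KR j; rewrite zc// mulr0|].
  by apply/funext => t; rewrite E {1}ET subrr add0r !cpow_trig.
apply: le_trans (H _ _ _ _ _ _ n0 hx hg) _; rewrite -!cpow_trig// -mulrA ler_pM2l//.
have [Np Nq _] := rep_norm hA (rep_derivative hA s hT).
have e (w : R) : C' * 2 * w = C' * w + C' * w by rewrite -mulrA mulrDl mul1r mulrDr.
have c0 : 0 <= C' * n%:R ^- s by rewrite mulr_ge0 ?invr_ge0 ?exprn_ge0// ltW.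
rewrite e !mulrA; apply: lerD.
- by rewrite (le_trans (H' n c n0))// ler_wpM2l.
- by rewrite (le_trans (H' n c' n0))// ler_wpM2l.
Qed.

End nodes.
End steklov_powers.

(** * Linearity of sampling and the two-sided estimate *)

Section sampling.
Context {R : realType}.
Implicit Types (f g : R -> R[i]) (m : nat) (x : nat -> R) (phi : nat -> R -> R[i]).

Lemma sampling_opB m x phi f g t :
  sampling_op m x phi (fun y => f y - g y) t = sampling_op m x phi f t - sampling_op m x phi g t.
Proof. by rewrite /sampling_op -sumrB; apply: eq_bigr => k _; rewrite mulrBl. Qed.

End sampling.

Unset Implicit Arguments.

Theorem theorem3p3 (R : realType) (K : scalars) (X : banach_lattice R K)
    (r s : nat) (gamma gamma' : R)
    (m : nat -> nat) (x : nat -> nat -> R) (phi : nat -> nat -> R -> R[i])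
    (K1 K3 K4 : R) :
  let G n := sampling_op (m n) (x n) (phi n) in
  let normX := bl_norm X in
  let normXn n := discrete_norm X (m n) (x n) in
  assumption_A X ->
  (0 < r)%N -> (0 < s)%N -> (s <= 2 * r)%N ->
  0 < gamma -> 0 < gamma' ->
  (forall n, (0 < n)%N -> nodes gamma gamma' n (m n) (x n)) ->
  (forall n f, (0 < n)%N -> bl_set X f -> trig_poly K n (G n f)) ->
  0 < K1 -> 0 < K3 -> 0 < K4 ->
  (forall n f, (0 < n)%N -> bl_set X f -> normX (G n f) <= K1 * normXn n f) ->
  (forall n T, (0 < n)%N -> trig_poly K n T ->
     K4 * (n%:R ^- s) * normX (nth_derivative s T) <= normX (fun t => T t - G n T t)
     <= K3 * (n%:R ^- s) * normX (nth_derivative s T)) ->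
  exists c C : R, 0 < c /\ 0 < C /\
    forall f n, bl_set X f -> (0 < n)%N ->
      let lhs := normX (fun t => f t - G n f t)
                 + normXn n (fun t => f t - G n f t) in
      let rhs := normX (id_minus_pow (steklov_dot (gamma / n%:R)) s f)
                 + normXn n (id_minus_pow (steklov (gamma / n%:R)) r f) in
      c * rhs <= lhs <= C * rhs.
Proof.
move=> G normX normXn hA r0 s0 sr g0 g'0 hx GT K10 K30 K40 GK1 GK.
have [Ca Ca0 Ha] := trig_poly_approximation hA s g0.
have [Cb Cb0 Hb] := steklov_dot_pow_trig hA g0 s0.
have [Cd Cd0 Hd] := steklov_dot_pow_bounded hA s.
have [Ce Ce0 He] := discrete_norm_steklov hA g0 g'0 r g0.
have [Ct Ct0 Ht] := discrete_norm_trig hA g0 g'0.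
have [Cs Cs0 Hs] := discrete_norm_steklov_trig hA g0 g'0 g0 r0 s0 sr.
pose E n := id_minus_pow (@steklov_dot R (gamma / n%:R)) s.
pose S n := id_minus_pow (@steklov R (gamma / n%:R)) r.
pose W n f := normX (E n f) + normXn n (S n f).
have GB n f g t : G n (fun y => f y - g y) t = G n f t - G n g t by exact: sampling_opB.
(* Both bounds split u = f - g into u - (1 - A)^r u and (1 - A)^r u. Only the first summand has a
   discrete norm controlled by the norm of u, with constant [Ce]. *)
have DNS n f g : (0 < n)%N -> bl_set X f -> bl_set X g ->
    normXn n (fun t => f t - g t) <= Ce * normX (fun t => f t - g t) +
      (normXn n (S n f) + normXn n (S n g)) /\
    normXn n (S n f) <= normXn n (fun t => f t - g t) +
      Ce * normX (fun t => f t - g t) + normXn n (S n g).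
  move=> n0 Xf Xg; have h0 : 0 < gamma / n%:R by rewrite divr_gt0// ltr0n.
  have B := He n _ _ _ n0 (hx n n0) (bl_sub Xf Xg); have SB := steklov_powB hA r h0 Xf Xg.
  rewrite SB in B; split.
    apply: le_trans (lerD B (discrete_normB hA (m n) (x n) _ _)).
    apply: le_trans (discrete_normD hA _ _ _ _).
    by rewrite le_eqVlt; apply/orP; left; apply/eqP; apply: eq_discrete_norm => t; rewrite /S; ring.
  apply: le_trans (lerD (le_trans (discrete_normB hA (m n) (x n) _ _) (lerD (lexx _) B)) (lexx _)).
  apply: le_trans (discrete_normD hA _ _ _ _).
  by rewrite le_eqVlt; apply/orP; left; apply/eqP; apply: eq_discrete_norm => t; rewrite /S; ring.
have lower : exists2 C : R, 0 < C & forall f n, bl_set X f -> (0 < n)%N ->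
    W n f <= C * (normX (fun t => f t - G n f t) + normXn n (fun t => f t - G n f t)).
  (* The lower hypothesis on T - G T, for T = G f, followed by the bound [K1], controls n^-s times
     the norm of (G f)^(s) by K4^-1 K1 times the discrete norm of f - G f. It occurs with [Cb] and
     with [Cs]. *)
  have [M M0 ME] : exists2 M, 0 < M & M = (Cb + Cs) * (K4^-1 * K1).
    by eexists; last reflexivity; rewrite mulr_gt0 ?addr_gt0// mulr_gt0// invr_gt0.
  exists (Cd + (1 + Ce) + M); first by rewrite !addr_gt0.
  move=> f n Xf n0; have h0 : 0 < gamma / n%:R by rewrite divr_gt0// ltr0n.
  have tG := GT n f n0 Xf; have XG := bl_trig hA tG; have Xg := bl_sub Xf XG.
  have E1 : normX (fun t => G n f t - G n (G n f) t) <= K1 * normXn n (fun t => f t - G n f t).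
    rewrite (_ : (fun t => _) = G n (fun t => f t - G n f t)); first exact: GK1.
    by apply/funext => t; rewrite GB.
  have /andP[E2 _] := GK n _ n0 tG.
  have E3 := Hd _ _ h0 Xg; have E4 := Hb n _ n0 tG; have E6 := Hs n _ _ _ n0 (hx n n0) tG.
  rewrite (steklov_dot_powB hA s h0 Xf XG) -!/(E n _) in E3 E4; rewrite -/(S n _) in E6.
  have E7 : normX (E n f) <= normX (fun t => E n f t - E n (G n f) t) + normX (E n (G n f)).
    have v1 := bl_steklov_dot_pow hA s h0 Xf; have v2 := bl_steklov_dot_pow hA s h0 XG.
    have := bl_normD (bl_sub v1 v2) v2; congr (bl_norm X _ <= _).
    by apply/funext => t; rewrite subrK.
  have [_ E8] := DNS n _ _ n0 Xf XG.
  set d := normXn n (fun t => f t - G n f t) in E1 E8 *.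
  set e := normX (fun t => f t - G n f t) in E3 E8 *.
  have d0 : 0 <= d by exact: discrete_norm_ge0.
  have e0 : 0 <= e by exact: bl_norm_ge0.
  have F : (Cb + Cs) * (n%:R ^- s * normX (nth_derivative s (G n f))) <= M * d.
    by rewrite ME -mulrA ler_pM2l ?addr_gt0// -mulrA ler_pdivlMl// mulrA (le_trans E2).
  apply: le_trans (lerD (le_trans E7 (lerD E3 E4)) (le_trans E8 (lerD (lexx _) E6))) _.
  move: F; rewrite -/normX; move: (_ * normX (nth_derivative _ _)) => t F.
  have -> : Cd * e + Cb * t + (d + Ce * e + Cs * t) = Cd * e + d + Ce * e + (Cb + Cs) * t by ring.
  apply: le_trans (lerD (lexx _) F) _.
  have -> : (Cd + (1 + Ce) + M) * (e + d) =
      Cd * e + d + Ce * e + M * d + (Cd * d + e + Ce * d + M * e) by ring.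
  by rewrite lerDl !addr_ge0// mulr_ge0// ltW.
have upper : exists2 C : R, 0 < C & forall f n, bl_set X f -> (0 < n)%N ->
    normX (fun t => f t - G n f t) + normXn n (fun t => f t - G n f t) <= C * W n f.
  (* Q bounds the discrete norm of f - T by W: 1 for (1 - A)^r f, [Cs] [Ca] for (1 - A)^r T and [Ce]
     [Ca] for the averaged part of f - T. *)
  have [Q Q0 QE] : exists2 Q, 0 < Q & Q = 1 + (Cs + Ce) * Ca.
    by eexists; last reflexivity; rewrite addr_gt0// mulr_gt0// addr_gt0.
  (* [Ca] and Q estimate f - T in the two norms. T - G T and G (f - T) are polynomials of degree n,
     so their discrete norms cost only the further factor [Ct]. *)
  exists (Ca + Q + (1 + Ct) * (K3 * Ca + K1 * Q)).
    by rewrite !addr_gt0// mulr_gt0 ?addr_gt0 ?mulr_gt0.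
  move=> f n Xf n0; have h0 : 0 < gamma / n%:R by rewrite divr_gt0// ltr0n.
  have [T [tT A1 A2]] := Ha n f n0 Xf; have XT := bl_trig hA tT; have Xd := bl_sub Xf XT.
  have tGT := trig_polyB tT (GT n T n0 XT); have tGd := GT n _ n0 Xd.
  have B1 := (andP (GK n T n0 tT)).2; have B2 := GK1 n _ n0 Xd.
  have B3 := Ht n _ _ _ n0 (hx n n0) tGT; have B4 := Ht n _ _ _ n0 (hx n n0) tGd.
  have B6 := Hs n _ _ _ n0 (hx n n0) tT; have [B7 _] := DNS n _ _ n0 Xf XT.
  have fE : (fun t => f t - G n f t) =
      fun t => (f t - T t) + ((T t - G n T t) - G n (fun y => f y - T y) t).
    by apply/funext => t; rewrite GB; ring.
  have N1 : normX (fun t => f t - G n f t) <= normX (fun t => f t - T t) +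
      (normX (fun t => T t - G n T t) + normX (G n (fun y => f y - T y))).
    have X1 := bl_trig hA tGT; have X2 := bl_trig hA tGd.
    rewrite fE; apply: le_trans (bl_normD Xd (bl_sub X1 X2)) _.
    by rewrite lerD2l; exact: bl_normB.
  have N2 : normXn n (fun t => f t - G n f t) <= normXn n (fun t => f t - T t) +
      (normXn n (fun t => T t - G n T t) + normXn n (G n (fun y => f y - T y))).
    rewrite fE; apply: le_trans (discrete_normD hA _ _ _ _) _.
    by rewrite lerD2l; exact: discrete_normB.
  have D0 : 0 <= normXn n (S n f) by exact: discrete_norm_ge0.
  have W0 : 0 <= normX (E n f) by apply/bl_norm_ge0/bl_steklov_dot_pow.
  have WZ : normX (E n f) <= W n f by rewrite lerDl.
  have e1 : normX (fun t => f t - T t) <= Ca * W n f by rewrite (le_trans A1)// ler_pM2l.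
  have t1 : n%:R ^- s * normX (nth_derivative s T) <= Ca * W n f.
    by rewrite (le_trans A2)// ler_pM2l.
  have q1 : normXn n (fun t => f t - T t) <= Q * W n f.
    have -> : Q * W n f = Ce * (Ca * W n f) + (W n f + Cs * (Ca * W n f)) by rewrite QE; ring.
    apply: le_trans B7 _; rewrite lerD ?ler_pM2l// lerD//; first by rewrite lerDr.
    by rewrite (le_trans B6)// ler_pM2l.
  have b1 : normX (fun t => T t - G n T t) <= K3 * (Ca * W n f).
    by rewrite (le_trans B1)// -mulrA ler_pM2l.
  have c1 : normX (G n (fun y => f y - T y)) <= K1 * (Q * W n f).
    by rewrite (le_trans B2)// ler_pM2l.
  have b2 : normXn n (fun t => T t - G n T t) <= Ct * (K3 * (Ca * W n f)).
    by rewrite (le_trans B3)// ler_pM2l.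
  have c2 : normXn n (G n (fun y => f y - T y)) <= Ct * (K1 * (Q * W n f)).
    by rewrite (le_trans B4)// ler_pM2l.
  apply: le_trans (lerD (le_trans N1 (lerD e1 (lerD b1 c1)))
    (le_trans N2 (lerD q1 (lerD b2 c2)))) _.
  by rewrite le_eqVlt; apply/orP; left; apply/eqP; ring.
have [c c0 Hc] := lower; have [C CC0 HC] := upper.
exists c^-1, C; split; first by rewrite invr_gt0.
split=> // f n Xf n0; cbv zeta; apply/andP; split; last exact: HC.
by rewrite ler_pdivrMl//; exact: Hc.
Qed.
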